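(* Let $\Delta$, $H$, $K$, $K_1$, $K_2$ be as defined in the context, and let $x_1=K_1$ and $x_2=K_2$, which are adjacent vertices of $\Delta$. Then $H\le K={\rm Aut}(\Delta)$. Moreover, for each $G\in\{H,K\}$, $\Delta$ is a locally $5$-arc transitive $G$-graph of local characteristic $3$, and the following hold: (i) $|\Delta(x_1)|=4$ and $|\Delta(x_2)|=3$; (ii) $\Delta$ is of pushing up type with respect to the 1-arc $(x_1,x_2)$ and the prime $3$; (iii) $G_{x_2}$ is transitive on the set of $6$-arcs originating at $x_2$; (iv) the vertex stabilizer amalgam $(H_{x_1},H_{x_2};H_{x_1,x_2})$ is of shape $\mathcal D_2$; (v) the vertex stabilizer amalgam $(K_{x_1},K_{x_2};K_{x_1,x_2})$ is of shape $\mathcal E_2$. Moreover $H\cong {\rm PSU}_3(8)\rtimes\langle\overline\sigma^3\rangle$ and $K\cong{\rm PSU}_3(8)\rtimes\langle\overline\sigma\rangle$, where $\overline\sigma$ acts on ${\rm PSU}_3(8)$ as a field automorphism of order $6$.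
   Context: Construction. Let $\mathbb F_{64}$ be the field with $64$ elements, $\zeta$ a generator of $\mathbb F_{64}^*$, $\rho:x\mapsto x^2$ the Frobenius automorphism and $\tau=\rho^3$ (so $x^\tau=x^8$). On $\mathbb F_{64}^3$ with standard basis $e_1,e_2,e_3$ take the Hermitian form $(x,y)=x_1y_1^\tau+x_2y_2^\tau+x_3y_3^\tau$, with special unitary group ${\rm SU}_3(8)$ and semilinear unitary group $\Gamma{\rm U}_3(8)$. For $X\in\Gamma{\rm U}_3(8)$ let $\overline X$ be its image in ${\rm P\Gamma U}_3(8)=\Gamma{\rm U}_3(8)/\{\text{scalars}\}$; ${\rm PSU}_3(8)$ is the image of ${\rm SU}_3(8)$. Let $\sigma\in\Gamma{\rm U}_3(8)$ be the semilinear map $\sum a_ie_i\mapsto\sum a_i^\rho e_i$ (conjugation by $\sigma$ applies $\rho$ to matrix entries; $\overline\sigma$ has order $6$). Let $\beta=\zeta^7$ (of order $9$) and $a=\beta^3$ (of order $3$). Define the matrices of ${\rm SU}_3(8)$: $A=\begin{pmatrix}0&0&1\\1&0&0\\0&1&0\end{pmatrix}$, $B={\rm diag}(1,a,a^{-1})$, $C={\rm diag}(\beta,\beta^4,\beta^4)$, $D=\begin{pmatrix}1&1&1\\1&a&a^{-1}\\1&a^{-1}&a\end{pmatrix}$, $E={\rm diag}(1,\beta,\beta^{-1})$, $F=\begin{pmatrix}1&0&0\\0&0&1\\0&1&0\end{pmatrix}$. Put $H_1=\langle\overline A,\overline B,\overline C,\overline D,\overline\sigma^3\rangle$, $H_2=\langle\overline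 A,\overline B,\overline C,\overline E,\overline F,\overline\sigma^3\rangle$, $H=\langle H_1,H_2\rangle$, $K_1=\langle H_1,\overline\sigma^2\rangle$, $K_2=\langle H_2,\overline\sigma^2\rangle$, $K=\langle K_1,K_2\rangle$. Let $\Delta$ be the coset graph whose vertices are the right cosets $K_1g$ and $K_2g$ ($g\in K$), with $K_1g$ adjacent to $K_2h$ iff $K_1g\cap K_2h\neq\emptyset$; $K$ (hence $H$) acts on $\Delta$ by right multiplication. Graph notions. A $G$-graph is a graph $\Delta$ with a group $G\le{\rm Aut}(\Delta)$. An $s$-arc is a path $(y_0,\dots,y_s)$ with $y_{i-1}\ne y_{i+1}$ for $1\le i\le s-1$. $\Delta$ is locally $s$-arc transitive if for every vertex $z$, $G_z$ is transitive on the $s$-arcs starting at $z$. $\Delta(z)$ is the set of neighbours of $z$; $G_z^{[i]}$ is the kernel of the action of $G_z$ on vertices at distance $\le i$ from $z$. $\Delta$ is of local characteristic $p$ (w.r.t. $G$) if $C_{G_z}(O_p(G_z^{[1]}))\le O_p(G_z^{[1]})$ for all vertices $z$; it is of pushing up type w.r.t. the 1-arc $(x_1,x_2)$ and prime $p$ if it is of local characteristic $p$ and $O_p(G_{x_1}^{[1]})\le O_p(G_{x_2}^{[1]})$. The vertex stabilizer amalgam w.r.t. $(x_1,x_2)$ is $(G_{x_1},G_{x_2};G_{x_1,x_2})$. Groups. ${\rm AGL}_n(3)$ is ${\rm GL}_n(3)$ extended by its natural module $\mathbb F_3^n$; ${\rm AGL}_1(3)\cong{\rm Sym}(3)$. In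 ${\rm AGL}_2(3)$ let $S_0\in{\rm Syl}_3$, $U=O_3({\rm AGL}_2(3))$, $U_0=C_U(S_0)=Z(S_0)$, and ${\rm AGL}_2(3,S)=N_{{\rm AGL}_2(3)}(S_0)\cong E_9\rtimes(C_2\times{\rm AGL}_1(3))$. ${\rm AGL}_2(3,S)^{\#}$ is the unique index-2 subgroup $X$ of ${\rm AGL}_2(3,S)$ with $X=C_X(U_0)C_X(U/U_0)$, $C_X(U/U_0)=S_0$, $C_X(U_0)/S_0\cong{\rm GL}_1(3)$; ${\rm AGL}_2(3,S)^{*}$ is the unique index-2 subgroup $Y$ with $Y=C_Y(U_0)C_Y(U/U_0)$, $C_Y(U/U_0)/S_0\cong{\rm GL}_1(3)$, $C_Y(U_0)=S_0$. $SP_2$ is the extraspecial group of order $27$ and exponent $9$. Amalgams. For a finite amalgam $H_1\leftarrow H_{12}\rightarrow H_2$ (with $H_{12}$ regarded as a subgroup of both), $T_i$ is the largest subgroup of $H_{12}$ normal in $H_i$, and $X$ is the unique inclusion-minimal subgroup of $H_{12}$ with $T_1T_2\le X$ and $X=H_{12}\cap\langle X^{H_i}\rangle$ for $i=1,2$. The amalgam has shape ${\rm AGL}_2(3,S)$ if $H_{12}=X$, $T_2=C_X(Z(O_3(X)))$ and $H_2/Z(O_3(X))\cong{\rm AGL}_2(3,S)$. Such an amalgam has shape $\mathcal D_2$ if: $H_1\cong{\rm AGL}_2(3)$, $H_{12}\cong{\rm AGL}_2(3,S)$; $H_2\cong O_3(X)\cdot(C_2\times{\rm AGL}_1(3))$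 and $T_2\cong{\rm AGL}_2(3,S)^{\#}$; and $C_{O_3(H_2)}(T)\cong C_9$ for $T\in{\rm Syl}_2(T_2)$. It has shape $\mathcal E_2$ if: $H_1\cong C_3\times{\rm AGL}_2(3)$, $H_{12}\cong C_3\times{\rm AGL}_2(3,S)$; $H_2\cong O_3(X)\cdot(C_2\times{\rm AGL}_1(3))$ and $T_2\cong C_3\times{\rm AGL}_2(3,S)^{\#}$; $Z(O_3(X))\rtimes H_2/C_{H_2}(Z(O_3(X)))\cong{\rm AGL}_2(3,S)^*$; and $C_{O_3(H_2)}(T)\cong SP_2$ for $T\in{\rm Syl}_2(T_2)$. *)

(* Defs.v *)
From HB Require Import structures.
From mathcomp Require Import all_boot all_order all_algebra.
From mathcomp Require Import all_fingroup all_solvable all_field.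

Set Implicit Arguments.
Unset Strict Implicit.
Unset Printing Implicit Defensive.

Import GRing.Theory.
Local Open Scope group_scope.

(* Junk value 1 when f is not injective; see [to_permE].                       *)
Definition to_perm (T : finType) (f : T -> T) : {perm T} :=
  insubd (1 : {perm T}) [ffun x : T => f x].

Lemma to_permE (T : finType) (f : T -> T) : injective f -> to_perm f =1 f.
Proof.
move=> injf x; rewrite /to_perm -pvalE [pval _]insubdK ?ffunE //.
by rewrite -topredE /=; apply/injectiveP=> u v; rewrite !ffunE => /injf.
Qed.

Section GraphNotions.

Variables (T : finType) (e : rel T).
Implicit Types (G : {group {perm T}}) (z : T) (y : seq T).

Definition graph_aut : {set {perm T}} :=
  [set p : {perm T} | [forall u, forall v, e (p u) (p v) == e u v]].

Lemma graph_autP (p : {perm T}) :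
  reflect (forall u v, e (p u) (p v) = e u v) (p \in graph_aut).
Proof.
rewrite inE; apply: (iffP forallP) => [h u v|h u].
  by apply/eqP; move/forallP: (h u).
by apply/forallP=> v; rewrite h.
Qed.

Lemma graph_aut_group_set : group_set graph_aut.
Proof.
apply/group_setP; split=> [|p q /graph_autP hp /graph_autP hq].
  by apply/graph_autP=> u v; rewrite !perm1.
by apply/graph_autP=> u v; rewrite !permM hq hp.
Qed.
Canonical graph_aut_group := Group graph_aut_group_set.

Fixpoint nonbacktracking y : bool :=
  if y is a :: ((_ :: c :: _) as y') then (a != c) && nonbacktracking y'
  else true.

(* y lists the s vertices of the arc that come after its origin z.             *)
Definition arc_from (s : nat) z y : bool :=
  [&& size y == s, path e z y & nonbacktracking (z :: y)].

Definition vstab G z : {group {perm T}} := 'C_G[z | 'P]%G.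

Definition arc_transitive_from G (s : nat) z : Prop :=
  forall y y', arc_from s z y -> arc_from s z y' ->
  exists2 g : {perm T}, g \in vstab G z & [seq g v | v <- y] = y'.

Definition locally_arc_transitive G (s : nat) : Prop :=
  forall z, arc_transitive_from G s z.

Definition nbrs z : {set T} := [set v | e z v].

Definition ball (i : nat) z : {set T} :=
  [set v | [exists k : 'I_i.+1, exists p : k.-tuple T,
              path e z p && (last z p == v)]].

(* G_z^[i] *)
Definition vkernel G z (i : nat) : {group {perm T}} :=
  'C_(vstab G z)(ball i z | 'P)%G.

Definition local_characteristic G (p : nat) : Prop :=
  forall z, 'C_(vstab G z)('O_p(vkernel G z 1)) \subset 'O_p(vkernel G z 1).

Definition pushing_up_type G (p : nat) (x1 x2 : T) : Prop :=
  [/\ e x1 x2, local_characteristic G p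
    & 'O_p(vkernel G x1 1) \subset 'O_p(vkernel G x2 1)].

End GraphNotions.

Section CosetGraph.

Variables (gT : finGroupType) (K1 K2 : {group gT}).

Definition cosetg_vertices : {set {set gT}} :=
  rcosets K1 (K1 <*> K2) :|: rcosets K2 (K1 <*> K2).

Definition cosetg_vertex := {v : {set gT} | v \in cosetg_vertices}.

Definition cosetg_adj : rel cosetg_vertex := fun u v =>
  ((val u \in rcosets K1 (K1 <*> K2)) && (val v \in rcosets K2 (K1 <*> K2))
   || (val u \in rcosets K2 (K1 <*> K2)) && (val v \in rcosets K1 (K1 <*> K2)))
  && (val u :&: val v != set0).

Lemma cosetg_x1_subproof : (K1 : {set gT}) \in cosetg_vertices.
Proof.
by rewrite inE; apply/orP; left; apply/rcosetsP; exists 1; rewrite ?mulg1.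
Qed.

Lemma cosetg_x2_subproof : (K2 : {set gT}) \in cosetg_vertices.
Proof.
by rewrite inE; apply/orP; right; apply/rcosetsP; exists 1; rewrite ?mulg1.
Qed.

Definition cosetg_x1 : cosetg_vertex := Sub (K1 : {set gT}) cosetg_x1_subproof.
Definition cosetg_x2 : cosetg_vertex := Sub (K2 : {set gT}) cosetg_x2_subproof.

Definition cosetg_action :=
  subaction cosetg_vertex (@rcoset_action gT).

(* [cosetg_action] is a partial action, but its domain contains K.             *)
Lemma cosetg_acts : K1 <*> K2 \subset act_dom cosetg_action.
Proof.
have actsK (Ki : {group gT}) : K1 <*> K2 \subset 'N(rcosets Ki (K1 <*> K2) | 'Rs).
  exact: actsRs_rcosets.
have -> : act_dom cosetg_action = 'N(cosetg_vertices | 'Rs).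
  by congr 'N(_ | _); apply/setP=> v; rewrite inE.
apply: subset_trans (astabsU _ _ _).
by rewrite subsetI !actsK.
Qed.

Definition cosetg_perm (A : {group gT}) : {group {perm cosetg_vertex}} :=
  (actperm cosetg_action @* A)%G.

End CosetGraph.

Section AffineGroups.

Variable n : nat.

Definition AGL3 : {set {perm 'rV['F_3]_n}} :=
  [set p : {perm 'rV['F_3]_n} |
    [exists M : 'M['F_3]_n, exists b : 'rV['F_3]_n,
      (M \in unitmx) && [forall v, p v == (v *m M + b)%R]]].

Lemma AGL3P (p : {perm 'rV['F_3]_n}) :
  reflect (exists2 M : 'M['F_3]_n, M \in unitmx &
             exists b : 'rV['F_3]_n, forall v, p v = (v *m M + b)%R)
          (p \in AGL3).
Proof.
rewrite inE; apply: (iffP existsP).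
  move=> [M /existsP[b /andP[uM /forallP h]]]; exists M => //; exists b => v.
  exact/eqP.
move=> [M uM [b h]]; exists M; apply/existsP; exists b; rewrite uM /=.
by apply/forallP=> v; rewrite h.
Qed.

Lemma AGL3_group_set : group_set AGL3.
Proof.
apply/group_setP; split=> [|p q /AGL3P[M uM [b hp]] /AGL3P[N uN [c hq]]].
  apply/AGL3P; exists 1%:M%R; rewrite ?unitmx1 //; exists 0%R => v.
  by rewrite perm1 mulmx1 addr0.
apply/AGL3P; exists (M *m N)%R; first by rewrite unitmx_mul uM.
exists (b *m N + c)%R => v.
by rewrite permM hq hp mulmxDl mulmxA addrA.
Qed.
Canonical AGL3_group := Group AGL3_group_set.

End AffineGroups.

Section AffineSylow.

(* S0 stands for a Sylow 3-subgroup of AGL_2(3).                               *)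
Variable S0 : {group {perm 'rV['F_3]_2}}.
Implicit Type X : {group {perm 'rV['F_3]_2}}.

Definition AGL23_U : {group {perm 'rV['F_3]_2}} := 'O_3(AGL3 2)%G.
Definition AGL23_U0 : {group {perm 'rV['F_3]_2}} := 'C_AGL23_U(S0)%G.
Definition AGL23S : {group {perm 'rV['F_3]_2}} := 'N_(AGL3 2)(S0)%G.

(* 'C_X(U / U0 | 'Q) is the centralizer in X of U / U0 under conjugation.      *)
Definition is_AGL23S_sharp X : Prop :=
  [/\ X \subset AGL23S, #|AGL23S : X| = 2,
      'C_X(AGL23_U0) * 'C_X(AGL23_U / AGL23_U0 | 'Q) = X,
      'C_X(AGL23_U / AGL23_U0 | 'Q) = S0
    & 'C_X(AGL23_U0) / S0 \isog 'GL_1(3)].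

Definition is_AGL23S_star X : Prop :=
  [/\ X \subset AGL23S, #|AGL23S : X| = 2,
      'C_X(AGL23_U0) * 'C_X(AGL23_U / AGL23_U0 | 'Q) = X,
      'C_X(AGL23_U / AGL23_U0 | 'Q) / S0 \isog 'GL_1(3)
    & 'C_X(AGL23_U0) = S0].

End AffineSylow.

Definition is_SP2 (gT : finGroupType) (P : {set gT}) : Prop :=
  [/\ extraspecial P, #|P| = 27 & exponent P = 9].

(* The external semidirect product of Z by H / C_H(Z), for Z normal in H.      *)
(* ('J %% C_H(Z)) is the conjugation action of N(C_H(Z)) / C_H(Z) on the       *)
(* centralizer of C_H(Z), which contains Z.                                    *)
Definition sdprod_quo (gT : finGroupType) (Z H : {group gT}) :=
  let to := mod_groupAction (conjg_groupAction gT) 'C_H(Z)%G in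
  (sdpair1 to @* Z) <*> (sdpair2 to @* (H / 'C_H(Z))).

(* Amalgams, given by subgroups H1, H2 of a common group and H12 contained in  *)
(* both.                                                                       *)
Section Amalgams.

Variables (gT : finGroupType) (H1 H2 H12 : {group gT}).

(* gcore H12 Hi is the largest subgroup of H12 normalized by Hi.               *)
Definition amalgam_T1 : {group gT} := gcore_group H12 H1.
Definition amalgam_T2 : {group gT} := gcore_group H12 H2.

Definition amalgam_closed (X : {group gT}) : bool :=
  [&& X \subset H12, amalgam_T1 * amalgam_T2 \subset X,
      X :==: H12 :&: <<class_support X H1>>
    & X :==: H12 :&: <<class_support X H2>>].

Definition amalgam_X (X : {group gT}) : bool :=
  [min X of Y | amalgam_closed Y].

Lemma amalgam_X_uniq (X Y : {group gT}) :
  amalgam_X X -> amalgam_X Y -> X :=: Y.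
Proof.
suff sub (A B : {group gT}) : amalgam_X A -> amalgam_X B -> A \subset B.
  by move=> hX hY; apply/eqP; rewrite eqEsubset !sub.
move=> /mingroupP[cA minA] /mingroupP[cB _].
have/and4P[AH TA /eqP A1 /eqP A2] := cA.
have/and4P[BH TB /eqP B1 /eqP B2] := cB.
suff cAB : amalgam_closed (A :&: B)%G.
  by rewrite -(minA _ cAB) ?subsetIl ?subsetIr.
have clo (H : {group gT}) : A :=: H12 :&: <<class_support A H>> ->
    B :=: H12 :&: <<class_support B H>> ->
    A :&: B == H12 :&: <<class_support (A :&: B) H>>.
  move=> eA eB; rewrite eqEsubset; apply/andP; split.
    rewrite subsetI (subset_trans (subsetIl _ _)) //=.
    exact: subset_trans (sub_class_support _ _) (subset_gen _).
  have cs (C : {set gT}) : A :&: B \subset C ->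
      class_support (A :&: B) H \subset class_support C H.
    by move=> sC; rewrite /class_support; exact: imset2S.
  by rewrite subsetI {2}eA {3}eB !setIS ?genS ?cs ?subsetIl ?subsetIr.
apply/and4P; split; rewrite /= ?clo // ?subsetI ?TA ?TB //.
exact: subset_trans (subsetIl _ _) AH.
Qed.

Variable S0 : {group {perm 'rV['F_3]_2}}.

(* The normality of Z(O_3(X)) in H2 is what gives a meaning to the quotient.   *)
Definition shape_AGL23S_with (X : {group gT}) : Prop :=
  [/\ [/\ H12 \subset H1, H12 \subset H2 & amalgam_X X],
      H12 :=: X,
      amalgam_T2 :=: 'C_X('Z('O_3(X))),
      'Z('O_3(X)) <| H2
    & H2 / 'Z('O_3(X)) \isog AGL23S S0].

(* "O_3(X) . (C_2 x AGL_1(3))" denotes an extension, not assumed split.        *)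
Definition shape_H2 (X : {group gT}) : Prop :=
  'O_3(X) <| H2 /\ H2 / 'O_3(X) \isog setX [set: 'Z_2] (AGL3 1).

Definition shape_D2 : Prop :=
  exists2 X : {group gT}, shape_AGL23S_with X &
  [/\ H1 \isog AGL3 2, H12 \isog AGL23S S0,
      shape_H2 X,
      (exists2 Y, is_AGL23S_sharp S0 Y & amalgam_T2 \isog Y)
    & forall T : {group gT}, T \in 'Syl_2(amalgam_T2) ->
        'C_('O_3(H2))(T) \isog [set: 'Z_9]].

Definition shape_E2 : Prop :=
  exists2 X : {group gT}, shape_AGL23S_with X &
  [/\ H1 \isog setX [set: 'Z_3] (AGL3 2),
      H12 \isog setX [set: 'Z_3] (AGL23S S0),
      shape_H2 X /\
      (exists2 Y, is_AGL23S_sharp S0 Y &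
         amalgam_T2 \isog setX [set: 'Z_3] Y),
      (exists2 Y, is_AGL23S_star S0 Y &
         sdprod_quo 'Z('O_3(X))%G H2 \isog Y)
    & forall T : {group gT}, T \in 'Syl_2(amalgam_T2) ->
        is_SP2 'C_('O_3(H2))(T)].

End Amalgams.

(* Vectors are rows and maps act on the right, so that the product of          *)
(* permutations matches the product of matrices.                               *)
Section Unitary.

Variable F : finFieldType.
Notation V := 'rV[F]_3.
Implicit Types (g : {perm V}) (M : 'M[F]_3).

Definition rho (x : F) : F := (x ^+ 2)%R.
Definition tau (x : F) : F := iter 3 rho x.

Definition herm (x y : V) : F := (\sum_(i < 3) x 0 i * tau (y 0 i))%R.

Definition field_aut (th : {perm F}) : bool :=
  (th 1 == 1)%R &&
  [forall x, forall y, (th (x + y) == th x + th y) && (th (x * y) == th x * th y)]%R.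

Definition semilinear (th : {perm F}) g : bool :=
  [forall c, forall u, forall v, g (c *: u + v) == th c *: g u + g v]%R.

Definition GammaU3 : {set {perm V}} :=
  [set g : {perm V} | [exists th : {perm F},
     [&& field_aut th, semilinear th g
       & [forall u, forall v, herm (g u) (g v) == th (herm u v)]]]].

Definition isometry_mx M : bool :=
  [forall u : V, forall v : V, herm (u *m M) (v *m M) == herm u v]%R.

Definition SU3 : {set {perm V}} :=
  [set g : {perm V} | [exists M : 'M[F]_3,
     [&& (\det M == 1)%R, isometry_mx M & [forall v, g v == (v *m M)%R]]]].

Definition scalars : {set {perm V}} :=
  [set g in GammaU3 | [exists c : F, forall v, g v == (c *: v)%R]].

Lemma GammaU3P g :
  reflect (exists th : {perm F},
    [/\ th 1 = 1, forall x y, th (x + y) = th x + th y,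
        forall x y, th (x * y) = th x * th y,
        forall c u v, g (c *: u + v) = th c *: g u + g v
      & forall u v, herm (g u) (g v) = th (herm u v)])%R
  (g \in GammaU3).
Proof.
rewrite inE; apply: (iffP existsP) => [] [th].
  case/and3P=> /andP[/eqP h1 /'forall_forallP h2] /'forall_'forall_forallP h3.
  move=> /'forall_forallP h4; exists th.
  split=> // [x y|x y|c u v|u v]; try by have /andP[/eqP ? /eqP ?] := h2 x y.
    by apply/eqP/h3.
  by apply/eqP/h4.
case=> h1 h2 h3 h4 h5; exists th; apply/and3P; split.
- rewrite /field_aut h1 eqxx; apply/'forall_forallP=> x y.
  by rewrite h2 h3 !eqxx.
- by apply/'forall_'forall_forallP=> c u v; rewrite h4.
- by apply/'forall_forallP=> u v; rewrite h5.
Qed.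

Lemma GammaU3_group_set : group_set GammaU3.
Proof.
apply/group_setP; split.
  by apply/GammaU3P; exists 1; split=> *; rewrite ?perm1.
move=> g h /GammaU3P[t [t1 tD tM tL tH]] /GammaU3P[s [s1 sD sM sL sH]].
apply/GammaU3P; exists (t * s)%g; split=> *; rewrite !permM.
- by rewrite t1.
- by rewrite tD.
- by rewrite tM.
- by rewrite tL sL.
- by rewrite sH tH.
Qed.
Canonical GammaU3_group := Group GammaU3_group_set.

Lemma SU3P g :
  reflect (exists M, [/\ \det M = 1, forall u v : V,
             herm (u *m M) (v *m M) = herm u v & forall v, g v = v *m M])%R
  (g \in SU3).
Proof.
rewrite inE; apply: (iffP existsP) => [] [M].
  case/and3P=> /eqP h1 /'forall_forallP h2 /forallP h3; exists M.
  by split=> // *; apply/eqP.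
case=> h1 h2 h3; exists M; rewrite h1 eqxx /=; apply/andP; split.
  by apply/'forall_forallP=> u v; apply/eqP.
by apply/forallP=> v; apply/eqP.
Qed.

Lemma SU3_group_set : group_set SU3.
Proof.
apply/group_setP; split.
  apply/SU3P; exists 1%:M%R; rewrite det1; split=> // *.
    by rewrite !mulmx1.
  by rewrite perm1 mulmx1.
move=> g h /SU3P[M [M1 MH Mg]] /SU3P[N [N1 NH Nh]].
apply/SU3P; exists (M *m N)%R; rewrite det_mulmx M1 N1 mulr1; split=> // *.
  by rewrite !mulmxA NH MH.
by rewrite permM Nh Mg mulmxA.
Qed.
Canonical SU3_group := Group SU3_group_set.

Lemma scalars_group_set : group_set scalars.
Proof.
apply/group_setP; split.
  rewrite inE group1; apply/existsP; exists 1%R; apply/forallP=> v.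
  by rewrite perm1 scale1r.
move=> g h /setIdP[Gg /existsP[c /forallP hc]] /setIdP[Gh /existsP[d /forallP hd]].
rewrite inE groupM //=; apply/existsP; exists (d * c)%R; apply/forallP=> v.
by rewrite permM (eqP (hd _)) (eqP (hc _)) scalerA.
Qed.
Canonical scalars_group := Group scalars_group_set.

Lemma scalars_normal : scalars <| GammaU3.
Proof.
apply/andP; split; first by apply/subsetP=> g /setIdP[].
apply/subsetP=> g Gg; rewrite inE; apply/subsetP=> _ /imsetP[s Ss ->].
have /setIdP[Gs /existsP[c /forallP hc]] := Ss; rewrite inE groupJ //=.
have /GammaU3P[th [th1 _ _ gL _]] := Gg.
have g0 : (g 0 = 0)%R.
  have /eqP := gL 1%R 0%R 0%R.
  by rewrite th1 scaler0 addr0 scale1r eq_sym addrC -subr_eq0 addrK => /eqP.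
apply/existsP; exists (th c); apply/forallP=> v.
rewrite !permM (eqP (hc _)) -[(c *: _)%R]addr0 gL g0 addr0.
by rewrite -permM mulVg perm1.
Qed.

(* PGammaU_3(8) is GammaU3 / scalars, a subgroup of the group of cosets of     *)
(* scalars in its normalizer; by [scalars_normal], GammaU3 is in the domain of *)
(* coset scalars.                                                              *)
Notation PT := (coset_of scalars).

Definition PSU3 : {group PT} := (SU3 / scalars)%G.

Definition bar (g : {perm V}) : PT := coset scalars g.

Definition mx_perm M : {perm V} := to_perm (fun v : V => v *m M)%R.

Definition sigma : {perm V} := to_perm (fun v : V => map_mx rho v).

Lemma mx_permE M v : M \in unitmx -> mx_perm M v = (v *m M)%R.
Proof.
by move=> uM; rewrite /mx_perm to_permE //; apply: can_inj (mulmxK uM).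
Qed.

Lemma rho_inj : #|F| = 64 -> injective rho.
Proof.
move=> hF x y h.
have c2 : (2%N \in [pchar F])%R by apply: (@card_finPcharP F 2 6).
by apply: (fmorph_inj (pFrobenius_aut c2)).
Qed.

Lemma sigmaE (v : V) : #|F| = 64 -> sigma v = map_mx rho v.
Proof.
move=> hF; rewrite /sigma to_permE // => u w /matrixP h; apply/matrixP=> i j.
by apply: (rho_inj hF); have := h i j; rewrite !mxE.
Qed.

Definition mx3 (s : seq (seq F)) : 'M[F]_3 :=
  \matrix_(i < 3, j < 3) ((nth [::] s i)`_j)%R.

Definition diag3 (x y z : F) : 'M[F]_3 := mx3 [:: [:: x; 0; 0];
                                                  [:: 0; y; 0];
                                                  [:: 0; 0; z]]%R.

Variable zeta : F.

Definition beta : F := (zeta ^+ 7)%R.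
Definition alpha : F := (beta ^+ 3)%R.

Definition mxA : 'M[F]_3 := mx3 [:: [:: 0; 0; 1];
                                    [:: 1; 0; 0];
                                    [:: 0; 1; 0]]%R.
Definition mxB : 'M[F]_3 := diag3 1%R alpha (alpha^-1)%R.
Definition mxC : 'M[F]_3 := diag3 beta (beta ^+ 4)%R (beta ^+ 4)%R.
Definition mxD : 'M[F]_3 := mx3 [:: [:: 1; 1; 1];
                                    [:: 1; alpha; alpha^-1];
                                    [:: 1; alpha^-1; alpha]]%R.
Definition mxE : 'M[F]_3 := diag3 1%R beta (beta^-1)%R.
Definition mxF : 'M[F]_3 := mx3 [:: [:: 1; 0; 0];
                                    [:: 0; 0; 1];
                                    [:: 0; 1; 0]]%R.

Definition sbar : PT := bar sigma.

Definition grpH1 : {group PT} :=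
  <<[set bar (mx_perm mxA); bar (mx_perm mxB); bar (mx_perm mxC);
         bar (mx_perm mxD); sbar ^+ 3]>>%G.
Definition grpH2 : {group PT} :=
  <<[set bar (mx_perm mxA); bar (mx_perm mxB); bar (mx_perm mxC);
         bar (mx_perm mxE); bar (mx_perm mxF); sbar ^+ 3]>>%G.
Definition grpH : {group PT} := (grpH1 <*> grpH2)%G.
Definition grpK1 : {group PT} := (grpH1 <*> <[sbar ^+ 2]>)%G.
Definition grpK2 : {group PT} := (grpH2 <*> <[sbar ^+ 2]>)%G.
Definition grpK : {group PT} := (grpK1 <*> grpK2)%G.

End Unitary.

(* Main.v *)
Require Import Defs.
From HB Require Import structures.
From mathcomp Require Import all_boot all_order all_algebra.
From mathcomp Require Import all_fingroup all_solvable all_field.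
From mathcomp Require Import mxrepresentation mxabelem.
From mathcomp Require Import ring.

Set Implicit Arguments.
Unset Strict Implicit.
Unset Printing Implicit Defensive.

Import GRing.Theory.
Local Open Scope group_scope.

(** All groups are computed inside PGammaU_3(8), with elements represented by a
3x3 matrix over F_2[b]/(b^6 + b^3 + 1), up to cube roots of unity, and a power of
the Frobenius. The small groups H_1, H_2, K_1, K_2 are enumerated explicitly, and
recognized through the embedding of V x| Q into AGL_n(3) when Q acts faithfully on
an elementary abelian 3-group V of rank n.

PSU_3(8) is contained in H because the linear part of H is transitive on the
nonisotropic points, and the stabilizer of <e_1> on those of its orthogonal; what
remains is diagonal, hence in H_2.

Arc transitivity is witnessed by explicit elements fixing a base arc and permuting
its continuations. For Aut(Delta) = K, the numbers of walks between two vertices are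
invariants that can be computed on the 92 orbits of K_2. They show that an
automorphism fixing an 8-arc that starts at a vertex of the type of x_2 fixes all its
extensions to 10-arcs; moving along the graph it fixes everything. On the other hand
K has two orbits on such 8-arcs, which are also told apart by a walk count, so any
automorphism agrees with an element of K on some 8-arc. *)

(** * The field with 64 elements and its semilinear maps *)

(** The choice of zeta disappears from the computations: beta is a primitive ninth root of unity, so
    a root of the ninth cyclotomic polynomial b^6 + b^3 + 1, and the entries of all generators are 0
    or powers of beta. Scalars of determinant 1 are cube roots of unity, so equality modulo scalars
    is a test against three matrices. Delta has 25536 + 34048 vertices, which is why walks are
    counted on orbits of K_2. The arc lengths come from group orders. There are 3.3.2.3.2.3 = 324 =
    |H_2| arcs of length 6 from x_2, so H_2 is regular on them; the stabilizer of such an arc in K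
    has order 3, fixes both continuations and is transitive on the three that follow, so K_2 has two
    regular orbits on the 1944 arcs of length 8. The theorem is about vertex stabilizers as
    permutation groups, whereas the computations live in PGammaU_3(8). They are therefore carried
    out in an abstract [model], instantiated by classes of semilinear maps and again by permutations
    of the vertices. *)

(* F64 x0 .. x5 stands for the sum of the x_i b^i. *)
Inductive f64 := F64 of bool & bool & bool & bool & bool & bool.

Definition f64_code x :=
  let: F64 x0 x1 x2 x3 x4 x5 := x in (x0, x1, x2, x3, x4, x5).
Definition f64_decode p :=
  let: (x0, x1, x2, x3, x4, x5) := p in F64 x0 x1 x2 x3 x4 x5.
Lemma f64_codeK : cancel f64_code f64_decode. Proof. by case. Qed.
HB.instance Definition _ := Finite.copy f64 (can_type f64_codeK).

Lemma card_f64 : #|{: f64}| = 64.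
Proof.
have h : bijective f64_code.
  by exists f64_decode; [exact: f64_codeK | case=> [[[[[? ?] ?] ?] ?] ?]].
by rewrite (bij_eq_card h) !card_prod !card_bool.
Qed.

Definition f0 := F64 false false false false false false.
Definition f1 := F64 true false false false false false.
Definition fX := F64 false true false false false false.

Definition fadd x y :=
  let: F64 x0 x1 x2 x3 x4 x5 := x in let: F64 y0 y1 y2 y3 y4 y5 := y in
  F64 (xorb x0 y0) (xorb x1 y1) (xorb x2 y2) (xorb x3 y3) (xorb x4 y4)
      (xorb x5 y5).

(** As b^6 = 1 + b^3, the top coefficient re-enters in degrees 0 and 3. *)
Definition fmulX x :=
  let: F64 x0 x1 x2 x3 x4 x5 := x in F64 x5 x0 x1 (xorb x2 x5) x3 x4.
(** Multiplication by a = b^3, which generates the scalars of SU_3(8). *)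
Definition fmulA x := fmulX (fmulX (fmulX x)).

Definition fstep x (b : bool) z := if b then fadd x (fmulX z) else fmulX z.
Definition fmul x y :=
  let: F64 y0 y1 y2 y3 y4 y5 := y in
  fstep x y0 (fstep x y1 (fstep x y2 (fstep x y3 (fstep x y4 (fstep x y5 f0))))).

(** Squaring is additive, with b^6 = 1 + b^3, b^8 = b^2 + b^5 and b^10 = b. *)
Definition fsq x :=
  let: F64 x0 x1 x2 x3 x4 x5 := x in
  F64 (xorb x0 x3) x5 (xorb x1 x4) x3 x2 x4.
Definition fconj x := fsq (fsq (fsq x)).

Definition beq (b c : bool) := if b then c else negb c.
(** Comparison by cases on the coefficients keeps evaluation independent of the encoding behind the
    decidable equality of [f64]. *)
Definition feq x y :=
  let: F64 x0 x1 x2 x3 x4 x5 := x in let: F64 y0 y1 y2 y3 y4 y5 := y in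
  [&& beq x0 y0, beq x1 y1, beq x2 y2, beq x3 y3, beq x4 y4 & beq x5 y5].

Lemma feqE x y : feq x y = (x == y).
Proof.
have beqP b c : beq b c = (b == c) by case: b; case: c.
case: x y => [x0 x1 x2 x3 x4 x5] [y0 y1 y2 y3 y4 y5].
rewrite -(inj_eq (can_inj f64_codeK)) /= !beqP !xpair_eqE.
by rewrite -!andbA.
Qed.

Definition f64_all (q : f64 -> bool) :=
  let s := [:: true; false] in
  all (fun x0 => all (fun x1 => all (fun x2 => all (fun x3 => all (fun x4 =>
  all (fun x5 => q (F64 x0 x1 x2 x3 x4 x5)) s) s) s) s) s) s.

Lemma f64_allP q : f64_all q -> forall x, q x.
Proof.
move=> h [x0 x1 x2 x3 x4 x5].
have inb b : b \in [:: true; false] by case: b.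
move/allP: h => /(_ x0 (inb _)) /allP /(_ x1 (inb _)) /allP /(_ x2 (inb _)).
by move=> /allP /(_ x3 (inb _)) /allP /(_ x4 (inb _)) /allP /(_ x5 (inb _)).
Qed.

(* Rows of a 3x3 matrix, read one after the other. *)
Inductive cmx :=
  M9 of f64 & f64 & f64 & f64 & f64 & f64 & f64 & f64 & f64.

Definition cmx_code M :=
  let: M9 a b c d e f g h i := M in (a, b, c, (d, e, f), (g, h, i)).
Definition cmx_decode p :=
  let: (a, b, c, (d, e, f), (g, h, i)) := p in M9 a b c d e f g h i.
Lemma cmx_codeK : cancel cmx_code cmx_decode. Proof. by case. Qed.
HB.instance Definition _ := Equality.copy cmx (can_type cmx_codeK).

Definition dot3 x y z u v w := fadd (fmul u x) (fadd (fmul v y) (fmul w z)).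

Definition cmmul M N :=
  let: M9 a b c d e f g h i := M in let: M9 a' b' c' d' e' f' g' h' i' := N in
  M9 (dot3 a b c a' d' g') (dot3 a b c b' e' h') (dot3 a b c c' f' i')
     (dot3 d e f a' d' g') (dot3 d e f b' e' h') (dot3 d e f c' f' i')
     (dot3 g h i a' d' g') (dot3 g h i b' e' h') (dot3 g h i c' f' i').

Definition cmmap (q : f64 -> f64) M :=
  let: M9 a b c d e f g h i := M in
  M9 (q a) (q b) (q c) (q d) (q e) (q f) (q g) (q h) (q i).

Definition cmtr M :=
  let: M9 a b c d e f g h i := M in M9 a d g b e h c f i.

Definition cmone := M9 f1 f0 f0 f0 f1 f0 f0 f0 f1.

Definition cmeq M N :=
  let: M9 a b c d e f g h i := M in let: M9 a' b' c' d' e' f' g' h' i' := N in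
  [&& feq a a', feq b b', feq c c', feq d d', feq e e', feq f f', feq g g',
      feq h h' & feq i i'].

(* CR M k stands for the semilinear map v |-> rho^k(v) M. *)
Inductive crep := CR of cmx & nat.

Definition crep_code x := let: CR M k := x in (M, k).
Definition crep_decode p := let: (M, k) := p in CR M k.
Lemma crep_codeK : cancel crep_code crep_decode. Proof. by case. Qed.
HB.instance Definition _ := Equality.copy crep (can_type crep_codeK).

Definition cfrob k M := iter k (cmmap fsq) M.

Definition modsix k := if k < 6 then k else k - 6.

(** Maps act on the right: applying (M, k) and then (N, l) gives v |-> rho^(k+l)(v) rho^l(M) N. *)
Definition cmul x y :=
  let: CR M k := x in let: CR N l := y in
  CR (cmmul (cfrob l M) N) (modsix (k + l)).
Definition cone := CR cmone 0.
(** Meant for unitary M, whose inverse is the conjugate transpose; rho^l appears because the matrix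
    is moved past the inverse power of Frobenius. *)
Definition cinv x :=
  let: CR M k := x in
  let l := modsix (6 - k) in CR (cfrob l (cmtr (cmmap fconj M))) l.

(* Equality up to the scalars of SU_3(8), the cube roots of unity. *)
Definition ceq x y :=
  let: CR M k := x in let: CR N l := y in
  eqn k l && (cmeq M N || (cmeq M (cmmap fmulA N) ||
              cmeq M (cmmap fmulA (cmmap fmulA N)))).

Definition fA := F64 false false false true false false.
Definition fA2 := fmul fA fA.
Definition cdiag x y z := M9 x f0 f0 f0 y f0 f0 f0 z.

(* The names follow the paper; gt and gr stand for sigma^3 and sigma^2. *)
Definition ga := CR (M9 f0 f0 f1 f1 f0 f0 f0 f1 f0) 0.
Definition gb := CR (cdiag f1 fA fA2) 0.
Definition gc := CR (cdiag fX (fmul fA fX) (fmul fA fX)) 0.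
Definition gd := CR (M9 f1 f1 f1 f1 fA fA2 f1 fA2 fA) 0.
Definition ge := CR (cdiag f1 fX (F64 false false true false false true)) 0.
Definition gf := CR (M9 f1 f0 f0 f0 f0 f1 f0 f1 f0) 0.
Definition gt := CR cmone 3.
Definition gr := CR cmone 2.

(** A predicate on representatives: membership is read off from the way a word is written, so
    unitarity is tested on the generators only. *)
Inductive cspan (gs : crep -> Prop) : crep -> Prop :=
| cspan1 : cspan gs cone
| cspan_gen x of gs x : cspan gs x
| cspanM x y of cspan gs x & cspan gs y : cspan gs (cmul x y)
| cspanV x of cspan gs x : cspan gs (cinv x).

Inductive cgen : crep -> Prop :=
| cgen_a : cgen ga | cgen_b : cgen gb | cgen_c : cgen gc | cgen_d : cgen gd
| cgen_e : cgen ge | cgen_f : cgen gf | cgen_t : cgen gt | cgen_r : cgen gr.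

Notation valid := (cspan cgen).

(** * Evaluation of representatives in an arbitrary field of order 64 *)

Section Evaluation.

Variables (F : finFieldType) (hF : #|F| = 64) (zeta : F).
Hypothesis hzeta : (63.-primitive_root zeta)%R.
Local Notation be := (beta zeta).
Local Notation V := 'rV[F]_3.

Let pcharF : (2%N \in [pchar F])%R.
Proof. exact: (@card_finPcharP F 2 6). Qed.

(** beta^9 = 1 while beta^3 <> 1, so beta is a root of (x^9 - 1) / (x^3 - 1). *)
Lemma be6 : (be ^+ 6 = 1 + be ^+ 3)%R.
Proof.
have z9 : (be ^+ 9 = 1)%R by rewrite /beta -exprM (prim_expr_order hzeta).
have z3 : (be ^+ 3 - 1 != 0)%R.
  by rewrite subr_eq0 /beta -exprM -(prim_order_dvd hzeta).
have : ((be ^+ 3 - 1) * (be ^+ 6 + be ^+ 3 + 1) = 0)%R.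
  have -> : ((be ^+ 3 - 1) * (be ^+ 6 + be ^+ 3 + 1) = be ^+ 9 - 1)%R by ring.
  by rewrite z9 subrr.
move/eqP; rewrite mulf_eq0 (negPf z3) /= -addrA addr_eq0.
by rewrite oppr_pchar2 // addrC => /eqP.
Qed.

Lemma add2F (x : F) : (x + x = 0)%R.
Proof. exact: addrr_pchar2 pcharF x. Qed.

Definition fev (x : f64) : F :=
  let: F64 x0 x1 x2 x3 x4 x5 := x in
  (x0%:R + x1%:R * be + x2%:R * be ^+ 2 + x3%:R * be ^+ 3 + x4%:R * be ^+ 4
   + x5%:R * be ^+ 5)%R.

Lemma xorb_natr (b c : bool) : ((xorb b c)%:R = b%:R + c%:R :> F)%R.
Proof. by case: b; case: c; rewrite ?addr0 ?add0r //= add2F. Qed.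

Lemma fev0 : fev f0 = 0%R.
Proof. by rewrite /= !mul0r !addr0. Qed.

Lemma fev1 : fev f1 = 1%R.
Proof. by rewrite /= !mul0r !addr0. Qed.

Lemma fevX : fev fX = be.
Proof. by rewrite /= !mul0r !addr0 mul1r add0r. Qed.

Lemma fevD x y : fev (fadd x y) = (fev x + fev y)%R.
Proof.
case: x y => [x0 x1 x2 x3 x4 x5] [y0 y1 y2 y3 y4 y5] /=.
by rewrite !xorb_natr; ring.
Qed.

Lemma fevMX x : fev (fmulX x) = (be * fev x)%R.
Proof.
case: x => [x0 x1 x2 x3 x4 x5] /=; rewrite !xorb_natr.
transitivity (x0%:R * be + x1%:R * be ^+ 2 + x2%:R * be ^+ 3 + x3%:R * be ^+ 4
  + x4%:R * be ^+ 5 + x5%:R * be ^+ 6)%R; last by ring.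
by rewrite be6; ring.
Qed.

Lemma fevM x y : fev (fmul x y) = (fev x * fev y)%R.
Proof.
have st b z : fev (fstep x b z) = (b%:R * fev x + be * fev z)%R.
  by case: b; rewrite /fstep ?fevD fevMX ?mul1r ?mul0r ?add0r.
by case: y => [y0 y1 y2 y3 y4 y5]; rewrite /fmul !st fev0 /=; ring.
Qed.

Lemma fev_sq x : fev (fsq x) = rho (fev x).
Proof.
rewrite /rho expr2 -fevM; congr fev; apply/eqP; move: x.
by apply: f64_allP; vm_compute.
Qed.

Lemma fev_conj x : fev (fconj x) = tau (fev x).
Proof. by rewrite /fconj !fev_sq. Qed.

Lemma fevMA x : fev (fmulA x) = (alpha zeta * fev x)%R.
Proof. by rewrite /fmulA !fevMX /alpha; ring. Qed.

Lemma fev_inj : injective fev.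
Proof.
have ker x : fev x = 0%R -> x = f0.
  (* This is y^62, the inverse of y when y is nonzero. *)
  pose inv y := iter 61 (fmul y) y.
  have /(_ x) : forall x, (x == f0) || feq (fmul (inv x) x) f1.
    by apply: f64_allP; vm_compute.
  case/orP=> [/eqP//|]; rewrite feqE => /eqP h x0.
  move: (congr1 fev h); rewrite fevM x0 mulr0 fev1 => /eqP.
  by rewrite eq_sym oner_eq0.
move=> x y exy; have/ker h : fev (fadd x y) = 0%R by rewrite fevD exy add2F.
case: x y h {exy} => [x0 x1 x2 x3 x4 x5] [y0 y1 y2 y3 y4 y5] [].
have xb b c : xorb b c = false -> b = c by case: b; case: c.
by do 6!move/xb->.
Qed.

Lemma fev_surj (c : F) : exists x, c = fev x.
Proof.
have [|g _ gK] := inj_card_bij fev_inj; first by rewrite hF card_f64.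
by exists (g c).
Qed.

Local Notation mxE := matrix.mxE.

Definition mev M : 'M[F]_3 :=
  let: M9 a b c d e f g h i := M in
  mx3 [:: [:: fev a; fev b; fev c]; [:: fev d; fev e; fev f];
          [:: fev g; fev h; fev i]].

Lemma mx3P (M N : 'M[F]_3) :
  (forall i j : nat, i < 3 -> j < 3 -> M (inord i) (inord j) = N (inord i) (inord j)) ->
  M = N.
Proof. by move=> h; apply/matrixP=> i j; have:= h i j; rewrite !inord_val; apply. Qed.

Lemma mx3E s i j : i < 3 -> j < 3 ->
  mx3 s (inord i) (inord j) = (nth [::] s i)`_j%R :> F.
Proof. by move=> hi hj; rewrite mxE !inordK. Qed.

Lemma sum3E (f : 'I_3 -> F) :
  (\sum_i f i = f (inord 0) + f (inord 1) + f (inord 2))%R.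
Proof.
rewrite !big_ord_recl big_ord0 addr0 addrA.
by congr (f _ + f _ + f _)%R; apply: val_inj; rewrite /= inordK.
Qed.

Lemma mevM M N : mev (cmmul M N) = (mev M *m mev N)%R.
Proof.
apply: mx3P => i j hi hj; rewrite mxE sum3E.
case: M N => [a b c d e f g h k] [a' b' c' d' e' f' g' h' k'].
have ev x y z u v w : fev (dot3 x y z u v w) =
    (fev x * fev u + fev y * fev v + fev z * fev w)%R.
  by rewrite /dot3 !fevD !fevM; ring.
rewrite !mx3E //; case: i hi => [|[|[|//]]] _; case: j hj => [|[|[|//]]] _ /=.
all: exact: ev.
Qed.

Lemma mev_map (q : f64 -> f64) (q' : F -> F) M :
  (forall x, fev (q x) = q' (fev x)) -> mev (cmmap q M) = map_mx q' (mev M).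
Proof.
move=> qq; apply: mx3P => i j hi hj; rewrite mxE; case: M => *.
rewrite !mx3E //.
by case: i hi => [|[|[|//]]] _; case: j hj => [|[|[|//]]] _ /=.
Qed.

Lemma mev_tr M : mev (cmtr M) = (mev M)^T%R.
Proof.
apply: mx3P => i j hi hj; rewrite mxE; case: M => *; rewrite !mx3E //.
by case: i hi => [|[|[|//]]] _; case: j hj => [|[|[|//]]] _ /=.
Qed.

Lemma mev1 : mev cmone = 1%:M%R.
Proof.
apply: mx3P => i j hi hj; rewrite [RHS]mxE -val_eqE /= !inordK // mx3E //.
by case: i hi => [|[|[|//]]] _; case: j hj => [|[|[|//]]] _; rewrite /= !mul0r !addr0.
Qed.

Lemma mev_inj M N : mev M = mev N -> M = N.
Proof.
case: M N => [a b c d e f g h k] [a' b' c' d' e' f' g' h' k'] /matrixP eMN.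
have ij i j := eMN (inord i) (inord j).
have := (ij 0 0, ij 0 1, ij 0 2, (ij 1 0, ij 1 1, ij 1 2),
         (ij 2 0, ij 2 1, ij 2 2))%N.
rewrite !mx3E //= => -[[[[[h0 h1] h2] [[h3 h4] h5]] [[h6 h7] h8]]].
by congr M9; apply: fev_inj.
Qed.

Lemma cmeqP M N : reflect (M = N) (cmeq M N).
Proof.
case: M N => [a b c d e f g h k] [a' b' c' d' e' f' g' h' k'] /=.
rewrite !feqE; apply: (iffP idP); last by case=> *; subst; rewrite !eqxx.
by case/and5P=> /eqP-> /eqP-> /eqP-> /eqP-> /and5P[/eqP-> /eqP-> /eqP-> /eqP-> /eqP->].
Qed.

Definition cmdet M :=
  let: M9 a b c d e f g h k := M in
  fadd (fmul a (fadd (fmul e k) (fmul f h)))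
    (fadd (fmul b (fadd (fmul d k) (fmul f g)))
          (fmul c (fadd (fmul d h) (fmul e g)))).

Lemma mev_det M : (\det (mev M) = fev (cmdet M))%R.
Proof.
have oN := oppr_pchar2 pcharF.
rewrite (expand_det_row _ ord0) !big_ord_recl big_ord0 /cofactor.
rewrite !(expand_det_row _ ord0) !big_ord_recl !big_ord0 /cofactor !det_mx11.
case: M => [a b c d e f g h k]; rewrite !mxE /= /bump /=.
rewrite !oN !expr1n !fevD !fevM !fevD !fevM; ring.
Qed.

Definition starmx (M : 'M[F]_3) : 'M[F]_3 := ((map_mx (@tau F) M)^T)%R.

Lemma rhoE (x : F) : rho x = pFrobenius_aut pcharF x.
Proof. by []. Qed.

Lemma map_rhoE m n (M : 'M[F]_(m, n)) :
  map_mx (@rho F) M = map_mx (pFrobenius_aut pcharF) M.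
Proof. by apply/matrixP=> i j; rewrite !mxE. Qed.

Lemma tauE m n (M : 'M[F]_(m, n)) :
  map_mx (@tau F) M = map_mx (@rho F) (map_mx (@rho F) (map_mx (@rho F) M)).
Proof. by apply/matrixP=> i j; rewrite !mxE. Qed.

Lemma map_rhoM m n p (M : 'M[F]_(m, n)) (N : 'M[F]_(n, p)) :
  (map_mx (@rho F) (M *m N) = map_mx (@rho F) M *m map_mx (@rho F) N)%R.
Proof. by rewrite !map_rhoE map_mxM. Qed.

Lemma map_rho1 n : (map_mx (@rho F) 1%:M = 1%:M :> 'M_n)%R.
Proof. by rewrite map_rhoE map_mx1. Qed.

Lemma map_tauM m n p (M : 'M[F]_(m, n)) (N : 'M[F]_(n, p)) :
  (map_mx (@tau F) (M *m N) = map_mx (@tau F) M *m map_mx (@tau F) N)%R.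
Proof. by rewrite !tauE !map_rhoM. Qed.

Lemma starmxM M N : (starmx (M *m N) = starmx N *m starmx M)%R.
Proof. by rewrite /starmx map_tauM trmx_mul. Qed.

Lemma map_rho_star M :
  map_mx (@rho F) (starmx M) = starmx (map_mx (@rho F) M).
Proof. by apply/matrixP=> i j; rewrite !mxE. Qed.

Lemma mev_star M : mev (cmtr (cmmap fconj M)) = starmx (mev M).
Proof. by rewrite mev_tr (mev_map _ fev_conj). Qed.

Lemma mev_frob M : mev (cmmap fsq M) = map_mx (@rho F) (mev M).
Proof. exact: mev_map fev_sq. Qed.

Lemma hermE (u v : V) : herm u v = (u *m (map_mx (@tau F) v)^T)%R 0%R 0%R.
Proof. by rewrite mxE; apply: eq_bigr => i _; rewrite !mxE. Qed.

Lemma isometry_star M : (M *m starmx M = 1%:M)%R ->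
  forall u v : V, herm (u *m M)%R (v *m M)%R = herm u v.
Proof.
move=> uM u v; rewrite !hermE map_tauM trmx_mul mulmxA -(mulmxA u).
by rewrite uM mulmx1.
Qed.

(** Basis vectors are fixed by tau, and the values of the form on the images of pairs of basis
    vectors are the entries of M M^*. *)
Lemma star_isometry M : (forall u v : V, herm (u *m M)%R (v *m M)%R = herm u v) ->
  (M *m starmx M = 1%:M)%R.
Proof.
move=> hM; apply/matrixP=> i j.
have := hM (delta_mx 0 i)%R (delta_mx 0 j)%R; rewrite !hermE map_tauM trmx_mul.
have tauD : (map_mx (@tau F) (delta_mx 0 j) = delta_mx 0 j :> V)%R.
  by rewrite tauE !map_rhoE !map_delta_mx.
have e1 (A : 'M[F]_3) :
    (((delta_mx 0 i : V) *m A *m (delta_mx j 0 : 'cV_3)) 0 0 = A i j)%R.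
  by rewrite -rowE -colE !mxE.
rewrite tauD trmx_delta mulmxA -(mulmxA (delta_mx _ _)) e1 => ->.
by rewrite -(e1 1%:M%R) mulmx1.
Qed.

(** The invariant of valid words. Determinant 1 restricts the scalar between two representatives to
    three values; the bound on k lets exponents of Frobenius be compared as numbers. *)
Definition unitary_rep x : Prop :=
  let: CR M k := x in
  [/\ (\det (mev M) = 1)%R, (mev M *m starmx (mev M) = 1%:M)%R & k < 6].

Lemma unitary_rep_gen x : cgen x -> unitary_rep x.
Proof.
pose ok y := let: CR M k := y in
  [&& feq (cmdet M) f1, cmeq (cmmul M (cmtr (cmmap fconj M))) cmone & k < 6].
have okP y : ok y -> unitary_rep y.
  case: y => M k /and3P[]; rewrite feqE => /eqP d1 /cmeqP u k6; split=> //.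
    by rewrite mev_det d1 fev1.
  by rewrite -mev_star -mevM u mev1.
by case; apply: okP; vm_compute.
Qed.

Lemma frob_det k M : (\det (mev (cfrob k M)) = iter k (@rho F) (\det (mev M)))%R.
Proof.
elim: k => //= k <-.
by rewrite mev_frob map_rhoE det_map_mx rhoE.
Qed.

Lemma frob_unitary k M : (mev M *m starmx (mev M) = 1%:M)%R ->
  (mev (cfrob k M) *m starmx (mev (cfrob k M)) = 1%:M)%R.
Proof.
move=> uM; elim: k => //= k IHk.
by rewrite mev_frob -map_rho_star -map_rhoM IHk map_rho1.
Qed.

Lemma iter_rho1 k : iter k (@rho F) 1%R = 1%R.
Proof. by elim: k => //= k ->; rewrite /rho expr1n. Qed.

Lemma modsix_lt k : k < 12 -> modsix k < 6.
Proof.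
by move=> k12; rewrite /modsix; case: (ltnP k 6) => // h; rewrite ltn_subLR.
Qed.

Lemma unitary_repM x y : unitary_rep x -> unitary_rep y -> unitary_rep (cmul x y).
Proof.
case: x y => [M k] [N l] [dM uM k6] [dN uN l6]; split.
- by rewrite mevM det_mulmx frob_det dM iter_rho1 mul1r.
- rewrite mevM starmxM mulmxA -(mulmxA _ (mev N)) uN mulmx1.
  exact: frob_unitary.
- by apply: modsix_lt; rewrite (leq_trans (_ : _ < 6 + l)) ?ltn_add2r ?leq_add2l // ltnW.
Qed.

Lemma starmx_unitary M : (M *m starmx M = 1%:M)%R -> (starmx M *m M = 1%:M)%R.
Proof. exact: mulmx1C. Qed.

Lemma starmxK M : starmx (starmx M) = M.
Proof.
apply/matrixP=> i j; rewrite !mxE.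
have [x ->] := fev_surj (M i j); rewrite -!fev_conj; congr fev; apply/eqP.
by rewrite -feqE; move: x; apply: f64_allP; vm_compute.
Qed.

Lemma unitary_repV x : unitary_rep x -> unitary_rep (cinv x).
Proof.
case: x => [M k] [dM uM k6]; split.
- have : (\det (mev M *m starmx (mev M)) = 1)%R by rewrite uM det1.
  rewrite det_mulmx dM mul1r => h.
  by rewrite frob_det mev_star h iter_rho1.
- apply: frob_unitary; rewrite mev_star starmxK.
  exact: starmx_unitary.
- by apply: modsix_lt; rewrite (leq_ltn_trans (leq_subr _ _)).
Qed.

Lemma unitary_rep1 : unitary_rep cone.
Proof.
split=> //; first by rewrite mev1 det1.
by rewrite mev1 /starmx tauE !map_rho1 trmx1 mulmx1.
Qed.

Lemma valid_unitary x : valid x -> unitary_rep x.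
Proof.
elim=> {x} [|x|x y _ hx _ hy|x _ hx].
- exact: unitary_rep1.
- exact: unitary_rep_gen.
- exact: unitary_repM.
- exact: unitary_repV.
Qed.

Definition cperm x : {perm V} :=
  let: CR M k := x in sigma F ^+ k * mx_perm (mev M).

Lemma unitary_unit M : (M *m starmx M = 1%:M)%R -> M \in unitmx.
Proof. by case/mulmx1_unit. Qed.

Lemma mx_permM (M N : 'M[F]_3) : M \in unitmx -> N \in unitmx ->
  mx_perm (M *m N)%R = mx_perm M * mx_perm N.
Proof.
move=> uM uN; apply/permP=> v.
by rewrite permM !mx_permE ?unitmx_mul ?uM // mulmxA.
Qed.

Lemma sigmaXE k (v : V) : (sigma F ^+ k) v = iter k (map_mx (@rho F)) v.
Proof.
by elim: k v => [|k IHk] v; rewrite ?perm1 // expgSr permM IHk sigmaE.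
Qed.

Lemma sigma6 : sigma F ^+ 6 = 1.
Proof.
apply/permP=> v; rewrite perm1 sigmaXE; apply/matrixP=> i j; rewrite !mxE.
have [x ->] := fev_surj (v i j); rewrite -!fev_sq; congr fev; apply/eqP.
by rewrite -feqE; move: x; apply: f64_allP; vm_compute.
Qed.

Lemma frob_unit k M : mev M \in unitmx -> mev (cfrob k M) \in unitmx.
Proof.
by move=> uM; elim: k => //= k IHk; rewrite mev_frob map_rhoE map_unitmx.
Qed.

Lemma mx_perm_sigma M l : mev M \in unitmx ->
  mx_perm (mev M) * sigma F ^+ l = sigma F ^+ l * mx_perm (mev (cfrob l M)).
Proof.
move=> uM; apply/permP=> v; rewrite !permM sigmaXE !mx_permE ?frob_unit //.
rewrite sigmaXE; elim: l => //= l ->.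
by rewrite mev_frob map_rhoM.
Qed.

Lemma sigma_modsix k : sigma F ^+ modsix k = sigma F ^+ k.
Proof.
rewrite /modsix; case: ltnP => // h.
by rewrite -{2}(subnK h) expgD sigma6 mulg1.
Qed.

Lemma cpermM x y : unitary_rep x -> unitary_rep y ->
  cperm (cmul x y) = cperm x * cperm y.
Proof.
case: x y => [M k] [N l] [_ /unitary_unit uM _] [_ /unitary_unit uN _] /=.
rewrite sigma_modsix expgD mevM mx_permM ?frob_unit // -!mulgA; congr (_ * _).
by rewrite !mulgA mx_perm_sigma.
Qed.

Lemma mx_perm1 : mx_perm (1%:M : 'M[F]_3)%R = 1.
Proof. by apply/permP=> v; rewrite mx_permE ?unitmx1 // mulmx1 perm1. Qed.

Lemma cperm1 : cperm cone = 1.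
Proof. by rewrite /cperm /cone mev1 mx_perm1 mulg1. Qed.

Lemma cpermV x : unitary_rep x -> cperm (cinv x) = (cperm x)^-1.
Proof.
move=> ux; have uV := unitary_repV ux.
apply/eqP; rewrite eq_sym eq_invg_mul -cpermM // -cperm1; apply/eqP.
case: x ux uV => [M k] [_ uM k6] _.
rewrite /cinv /cmul /cone /cperm.
have -> : modsix (k + modsix (6 - k)) = 0.
  by move: k6; do 6?[case: k => [|k] //].
congr (_ * mx_perm _); rewrite mev1 mevM; set l := modsix _.
elim: l => [|l IHl]; first by rewrite mev_star.
by rewrite /= !mev_frob -map_rhoM IHl map_rho1.
Qed.

Lemma rho_bij : {th : {perm F} | th =1 @rho F}.
Proof. by exists (perm (rho_inj hF)); exact: permE. Qed.

Lemma sigma_GammaU3 : sigma F \in GammaU3 F.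
Proof.
have [th thE] := rho_bij; apply/GammaU3P; exists th.
split=> [|x y|x y|c u v|u v]; rewrite !thE.
- by rewrite rhoE rmorph1.
- by rewrite !rhoE rmorphD.
- by rewrite !rhoE rmorphM.
- rewrite !sigmaE //; apply/matrixP=> i j.
  by rewrite !mxE !rhoE rmorphD rmorphM.
- rewrite !sigmaE // /herm rhoE rmorph_sum; apply: eq_bigr => i _.
  by rewrite rmorphM !mxE.
Qed.

Lemma mx_perm_GammaU3 M : (M *m starmx M = 1%:M)%R -> mx_perm M \in GammaU3 F.
Proof.
move=> uM; have unM := unitary_unit uM.
apply/GammaU3P; exists 1; split=> *; rewrite !(perm1, mx_permE) //.
  by rewrite mulmxDl scalemxAl.
exact: isometry_star.
Qed.

Lemma cperm_GammaU3 x : unitary_rep x -> cperm x \in GammaU3 F.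
Proof.
by case: x => M k [_ uM _]; rewrite groupM ?groupX ?sigma_GammaU3 ?mx_perm_GammaU3.
Qed.

Lemma GammaU3_norm : GammaU3 F \subset 'N(scalars F).
Proof. exact: normal_norm (scalars_normal F). Qed.

Definition pgl x : coset_of (scalars F) := bar (cperm x).

Lemma pgl1 : pgl cone = 1.
Proof. by rewrite /pgl cperm1 /bar morph1. Qed.

Lemma pglM x y : valid x -> valid y -> pgl (cmul x y) = pgl x * pgl y.
Proof.
move=> /valid_unitary ux /valid_unitary uy; rewrite /pgl cpermM // /bar morphM //.
  exact: subsetP GammaU3_norm _ (cperm_GammaU3 ux).
exact: subsetP GammaU3_norm _ (cperm_GammaU3 uy).
Qed.

Lemma pglV x : valid x -> pgl (cinv x) = (pgl x)^-1.
Proof.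
move=> /valid_unitary ux; rewrite /pgl cpermV // /bar morphV //.
exact: subsetP GammaU3_norm _ (cperm_GammaU3 ux).
Qed.

Lemma scalar_scalars (c : F) : (c * tau c = 1)%R ->
  exists2 s : {perm V}, s \in scalars F & forall v, s v = (c *: v)%R.
Proof.
move=> cc; have u : (c%:M *m starmx c%:M = 1%:M :> 'M[F]_3)%R.
  rewrite /starmx mul_scalar_mx; apply/matrixP=> i j; rewrite !mxE eq_sym.
  case: (i == j); rewrite ?mulr1n ?mulr0n //.
  by rewrite /tau /= /rho !expr0n mulr0.
have sE v : mx_perm (c%:M : 'M[F]_3)%R v = (c *: v)%R.
  by rewrite mx_permE ?mul_mx_scalar // unitary_unit.
exists (mx_perm c%:M%R); last exact: sE.
by rewrite inE mx_perm_GammaU3 //; apply/existsP; exists c; apply/forallP=> v; rewrite sE.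
Qed.

Lemma bar_scale (g h : {perm V}) (c : F) : (c * tau c = 1)%R ->
  g \in GammaU3 F -> h \in GammaU3 F ->
  (forall v, g v = c *: h v)%R -> bar g = bar h.
Proof.
move=> cc Gg Gh gh; have [s Ss sE] := scalar_scalars cc.
have -> : g = h * s by apply/permP=> v; rewrite gh permM sE.
have nG := subsetP GammaU3_norm.
by rewrite /bar morphM ?nG //= ?(coset_id Ss) ?mulg1 //; case/setIdP: Ss.
Qed.

Lemma alpha_tau (c : F) : (c ^+ 3 = 1 -> c * tau c = 1)%R.
Proof.
move=> c3; have -> : (c * tau c = (c ^+ 3) ^+ 3)%R by rewrite /tau /= /rho; ring.
by rewrite c3 expr1n.
Qed.

Lemma alpha3 : (alpha zeta ^+ 3 = 1)%R.
Proof.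
by rewrite /alpha /beta -!exprM (prim_expr_order hzeta).
Qed.

(** If the classes agree, the maps differ by a scalar. Basis vectors are fixed by Frobenius, so the
    matrices are proportional; evaluation at b e_1 then equates rho^k(b) and rho^l(b), which differ
    for distinct k, l < 6; finally the determinants show that the factor is a cube root of unity. *)
Lemma pgl_eq x y : valid x -> valid y -> (pgl x == pgl y) = ceq x y.
Proof.
move=> /valid_unitary ux /valid_unitary uy.
have gx := cperm_GammaU3 ux; have gy := cperm_GammaU3 uy.
case: x y ux uy gx gy => [M k] [N l] [dM uM k6] [dN uN l6] gx gy.
have unM := unitary_unit uM; have unN := unitary_unit uN.
apply/eqP/idP.
  have nG := subsetP GammaU3_norm.
  rewrite /pgl /bar => /(rcoset_kercosetP (nG _ gx) (nG _ gy)) /rcosetP[s].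
  case/setIdP=> _ /existsP[c /forallP sc] e.
  have [c' ec] : exists c' : F, forall v : V, (iter k (map_mx (@rho F)) v *m mev M
      = c' *: (iter l (map_mx (@rho F)) v *m mev N))%R.
    (* The scalar acts before the second map, so it comes out twisted by rho^l. *)
    exists (iter l (@rho F) c) => v.
    have := congr1 (fun p : {perm V} => p v) e.
    rewrite !permM !mx_permE // !sigmaXE (eqP (sc v)) => ->.
    rewrite scalemxAl; congr (_ *m _)%R; elim: l {l6 gy e} => //= l ->.
    by apply/matrixP=> i j; rewrite !mxE !rhoE rmorphM.
  have itd i m : iter m (map_mx (@rho F)) (delta_mx 0 i : V)%R = (delta_mx 0 i)%R.
    by elim: m => //= m ->; rewrite map_rhoE map_delta_mx.
  have MN : (mev M = c' *: mev N)%R.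
    by apply/row_matrixP=> i; rewrite rowE -(itd i k) ec itd scalemxAr -rowE.
  have nz0 : (row 0 (mev M) != 0)%R.
    apply/eqP=> r0; move: (row_mul 0 (mev M) (invmx (mev M)))%R.
    rewrite mulmxV // r0 mul0mx => /rowP/(_ 0%R) /eqP.
    by rewrite !mxE eqxx oner_eq0.
  have kl : k = l.
    have itb m : (iter m (map_mx (@rho F)) (be *: delta_mx 0 0 : V)
        = fev (iter m fsq fX) *: delta_mx 0 0)%R.
      elim: m => [|m IHm]; first by rewrite -[in LHS]fevX.
      rewrite !iterS IHm.
      rewrite fev_sq; apply/matrixP=> i j; rewrite !mxE !rhoE rmorphM.
      by rewrite rmorph_nat.
    have := ec (be *: delta_mx 0 0)%R; rewrite !itb -!scalemxAl -!rowE.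
    rewrite scalerA mulrC -scalerA.
    have <- : (row 0 (mev M) = c' *: row 0 (mev N))%R.
      by rewrite MN; apply/rowP=> j; rewrite !mxE.
    move/eqP; rewrite -subr_eq0 -scalerBl scaler_eq0 (negPf nz0) orbF subr_eq0.
    move/eqP/fev_inj => {itb ec}; move: k6 l6; clear.
    by do 6?[case: k => [|k] //]; do 6?[case: l => [|l] //].
  have [x xE] := fev_surj c'.
  have x3 : feq (fmul x (fmul x x)) f1.
    rewrite feqE; apply/eqP/fev_inj; rewrite !fevM fev1 -xE -[RHS]dM MN detZ dN.
    by rewrite mulr1 !exprS expr0 mulr1.
  have : [|| feq x f1, feq x fA | feq x fA2].
    move: x3; apply/implyP; move: x {xE}; apply: f64_allP; by vm_compute.
  rewrite !feqE => h; rewrite /ceq kl (introT eqnP) //=.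
  have MN' : M = cmmap (fmul x) N.
    apply: mev_inj; rewrite MN xE; apply/esym.
    rewrite (mev_map _ (fun y => fevM x y)).
    by apply/matrixP=> i j; rewrite !mxE.
  have cmmap_ext q q' L : q =1 q' -> cmmap q L = cmmap q' L.
    by case: L => * /=; congr M9.
  have cmmap_comp q q' L : cmmap q (cmmap q' L) = cmmap (q \o q') L by case: L.
  have e1 y : fmul f1 y = y.
    by apply/eqP; rewrite -feqE; move: y; apply: f64_allP; vm_compute.
  have eA y : fmul fA y = fmulA y.
    by apply/eqP; rewrite -feqE; move: y; apply: f64_allP; vm_compute.
  have eA2 y : fmul fA2 y = fmulA (fmulA y).
    by apply/eqP; rewrite -feqE; move: y; apply: f64_allP; vm_compute.
  have cmeq_refl L : cmeq L L by apply/cmeqP.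
  rewrite MN' cmmap_comp; case/or3P: h => /eqP->.
  - rewrite (cmmap_ext _ id) //.
    by have -> : cmmap id N = N; [case: (N) | rewrite cmeq_refl].
  - by rewrite (cmmap_ext _ _ _ eA) cmeq_refl orbT.
  - by rewrite (cmmap_ext _ (fmulA \o fmulA)) // cmeq_refl !orbT.
case/andP=> /eqnP kl h.
have [c c3 MN] : exists2 c : F, (c ^+ 3 = 1)%R & (mev M = c *: mev N)%R.
  have mA L : (mev (cmmap fmulA L) = alpha zeta *: mev L)%R.
    by rewrite (mev_map _ fevMA); apply/matrixP=> i j; rewrite !mxE.
  case/or3P: h => /cmeqP->.
  - by exists 1%R; rewrite ?expr1n ?scale1r.
  - by exists (alpha zeta); rewrite ?alpha3 ?mA.
  - by exists (alpha zeta ^+ 2)%R; rewrite ?mA ?scalerA // -exprM mulnC exprM alpha3 expr1n.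
apply: (bar_scale (alpha_tau c3)) => // v.
by rewrite !permM !mx_permE // kl MN scalemxAr.
Qed.

Lemma pgl_mx M N : mev M = N -> pgl (CR M 0) = bar (mx_perm N).
Proof. by move=> <-; rewrite /pgl /= mul1g. Qed.

Lemma mx3_ev a b c d e f g h i :
  mev (M9 a b c d e f g h i) =
  mx3 [:: [:: fev a; fev b; fev c]; [:: fev d; fev e; fev f];
          [:: fev g; fev h; fev i]].
Proof. by []. Qed.

Lemma fevA : fev fA = alpha zeta.
Proof. by rewrite /= !mul0r !add0r !addr0 mul1r. Qed.

Lemma fevA2 : fev fA2 = ((alpha zeta)^-1)%R.
Proof.
have a3 := alpha3; rewrite /fA2 fevM fevA; apply: (mulIf (x := alpha zeta)).
  by apply: contra_eq_neq a3 => ->; rewrite expr0n eq_sym oner_eq0.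
rewrite mulVf; first by rewrite -a3; ring.
by apply: contra_eq_neq a3 => ->; rewrite expr0n eq_sym oner_eq0.
Qed.

Lemma fevXV : fev (F64 false false true false false true) = (be^-1)%R.
Proof.
have b9 : (be ^+ 9 = 1)%R by rewrite /beta -exprM (prim_expr_order hzeta).
have nz : be != 0%R.
  by apply: contra_eq_neq b9 => ->; rewrite expr0n eq_sym oner_eq0.
apply: (mulIf nz); rewrite mulVf // -fevX -fevM -fev1; congr fev; exact/eqP.
Qed.

Lemma pgl_a : pgl ga = bar (mx_perm (mxA F)).
Proof. by apply: pgl_mx; rewrite mx3_ev fev0 fev1. Qed.
Lemma pgl_b : pgl gb = bar (mx_perm (mxB zeta)).
Proof. by apply: pgl_mx; rewrite mx3_ev fev0 fev1 fevA fevA2. Qed.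
Lemma pgl_c : pgl gc = bar (mx_perm (mxC zeta)).
Proof.
apply: pgl_mx; rewrite mx3_ev fev0 fevM fevA fevX /mxC /diag3.
by have -> : (alpha zeta * be = be ^+ 4)%R by rewrite /alpha; ring.
Qed.
Lemma pgl_d : pgl gd = bar (mx_perm (mxD zeta)).
Proof. by apply: pgl_mx; rewrite mx3_ev fev1 fevA fevA2. Qed.
Lemma pgl_e : pgl ge = bar (mx_perm (Defs.mxE zeta)).
Proof. by apply: pgl_mx; rewrite mx3_ev fev0 fev1 fevX fevXV. Qed.
Lemma pgl_f : pgl gf = bar (mx_perm (mxF F)).
Proof. by apply: pgl_mx; rewrite mx3_ev fev0 fev1. Qed.

Lemma sigma_norm : sigma F \in 'N(scalars F).
Proof. exact: subsetP GammaU3_norm _ sigma_GammaU3. Qed.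

Lemma pgl_sigma k : pgl (CR cmone k) = sbar F ^+ k.
Proof. by rewrite /pgl /cperm mev1 mx_perm1 mulg1 /bar morphX ?sigma_norm. Qed.

End Evaluation.

(** * Affine groups over F_3 *)

Definition transl3 n : {set {perm 'rV['F_3]_n}} :=
  [set p : {perm 'rV['F_3]_n} |
    [exists b : 'rV['F_3]_n, [forall v, p v == (v + b)%R]]].

Lemma transl3P n (p : {perm 'rV['F_3]_n}) :
  reflect (exists b, forall v, p v = (v + b)%R) (p \in transl3 n).
Proof.
rewrite inE; apply: (iffP existsP) => -[b h]; exists b.
  by move=> v; apply/eqP/(forallP h).
by apply/forallP=> v; rewrite h.
Qed.

Lemma isog_Zn (gT : finGroupType) (G : {group gT}) n :
  1 < n -> cyclic G -> #|G| = n -> G \isog [set: 'Z_n].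
Proof.
move=> n1 cG oG; rewrite isog_cyclic_card // cardsT card_ord Zp_cast // oG eqxx.
by rewrite andbT; apply/cyclicP; exists Zp1; exact: Zp_cycle.
Qed.

(** Write g = x q with x in V and q in Q, and let g act on row vectors by v |-> (v + x) q. This is
    the action of G on the right cosets of Q, and it is faithful because Q is faithful on V. *)
Lemma affine_embed (gT : finGroupType) (G V Q : {group gT}) n :
    V ><| Q = G -> 3.-abelem V -> #|V| = (3 ^ n.+1)%N -> 'C_Q(V) = 1 ->
  exists f : {morphism G >-> {perm 'rV['F_3]_n.+1}},
    [/\ 'injm f, f @* G \subset AGL3 n.+1 & f @* V = transl3 n.+1].
Proof.
move=> defG abV oV cQV.
have ntV : V :!=: 1 by rewrite -cardG_gt1 oV (ltn_exp2l 0).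
have dimV : (abelem_dim' V).+1 = n.+1 by rewrite (dim_abelemE abV ntV) oV pfactorK.
case: dimV oV => <- {n} _; set n := abelem_dim' V.
have [_ defVQ nVQ tiVQ] := sdprodP defG.
pose rV := abelem_rV abV ntV; pose rG := abelem_repr abV ntV nVQ.
pose A g (v : 'rV['F_3]_n.+1) := ((v + rV (divgr V Q g)) *m rG (remgr V Q g))%R.
have rem g : g \in G -> remgr V Q g \in Q by rewrite -defVQ; exact: mem_remgr.
have div g : g \in G -> divgr V Q g \in V by rewrite -defVQ; exact: mem_divgr.
have fE g : g \in G -> to_perm (A g) =1 A g.
  move=> gG; apply: to_permE => u v /(can_inj (mulmxK (repr_mx_unit rG (rem _ gG)))).
  exact: addIr.
have fM : {in G &, {morph (fun g => to_perm (A g)) : x y / x * y}}.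
  move=> x y xG yG; apply/permP=> v; rewrite permM !fE ?groupM //.
  have [x1 q1] := (div _ xG, rem _ xG); have [x2 q2] := (div _ yG, rem _ yG).
  have xyE : x * y = (divgr V Q x * divgr V Q y ^ (remgr V Q x)^-1)
                     * (remgr V Q x * remgr V Q y).
    by rewrite conjgE invgK !mulgA mulgKV -(divgr_eq V Q x) mulgKV.
  have x2' : divgr V Q y ^ (remgr V Q x)^-1 \in V.
    by rewrite memJ_norm // groupV (subsetP nVQ).
  have e1 : divgr V Q (x * y) = divgr V Q x * divgr V Q y ^ (remgr V Q x)^-1.
    rewrite [in LHS]xyE; apply: (divgrMid tiVQ); exact: groupM.
  have e2 : remgr V Q (x * y) = remgr V Q x * remgr V Q y.
    rewrite [in LHS]xyE; apply: (remgrMid tiVQ); exact: groupM.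
  rewrite /A e1 e2 repr_mxM // mulmxA.
  congr (_ *m _)%R; rewrite /rV abelem_rV_M // addrA mulmxDl; congr (_ + _)%R.
  rewrite (abelem_rV_J _ _ nVQ) ?groupV // -mulmxA -repr_mxM ?groupV // mulVg.
  by rewrite repr_mx1 mulmx1.
exists (Morphism fM); split.
- apply/subsetP=> g /morphpreP[gG /set1P fg1].
  have Ag v : A g v = v by rewrite -fE // [to_perm _]fg1 perm1.
  (* The image of 0 determines the translation part. *)
  have d1 : divgr V Q g = 1.
    have := Ag 0%R; rewrite /A add0r => /eqP.
    rewrite -(mul0mx _ (rG (remgr V Q g))) (inj_eq (can_inj (mulmxK (repr_mx_unit rG (rem _ gG))))).
    rewrite -(abelem_rV_1 abV ntV) => /eqP; apply: abelem_rV_inj; rewrite ?div //.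
  rewrite (divgr_eq V Q g) d1 mul1g -cQV inE rem //=.
  apply/centP=> x xV; apply: commute_sym; apply/commgP/conjg_fixP.
  apply: (@abelem_rV_inj 3 gT V abV ntV); rewrite ?memJ_norm ?(subsetP nVQ) ?rem //.
  rewrite (abelem_rV_J _ _ nVQ) ?rem //.
  have := Ag (rV x); rewrite /A d1.
  by rewrite /rV abelem_rV_1 addr0.
- apply/subsetP=> _ /morphimP[g gG _ ->]; apply/AGL3P.
  exists (rG (remgr V Q g)); first exact: repr_mx_unit (rem _ gG).
  by exists (rV (divgr V Q g) *m rG (remgr V Q g))%R => v /=; rewrite fE // /A mulmxDl.
- have tE g v : g \in V -> to_perm (A g) v = (v + rV g)%R.
    move=> gV; rewrite fE; last by rewrite -defVQ (subsetP (mulG_subl _ _)).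
    by rewrite /A divgr_id // remgr1 // repr_mx1 mulmx1.
  have sVG : V \subset G by rewrite -defVQ mulG_subl.
  apply/setP=> p; apply/morphimP/transl3P => [[g gG gV ->]|[b pb]].
    by exists (rV g) => v; rewrite -tE.
  have gV := mem_rVabelem abV ntV b.
  exists (rVabelem abV ntV b); rewrite ?(subsetP sVG) //.
  by apply/permP=> v; rewrite /= tE // /rV rVabelemK pb.
Qed.

(** Faithfulness in a quotient, put in a form that can be tested on commutators of elements. *)
Lemma quo_cent1 (gT : finGroupType) (A B N : {group gT}) :
    A \subset 'N(N) -> B \subset 'N(N) ->
    (forall x, x \in B -> {in A, forall y, [~ x, y] \in N} -> x \in N) ->
  'C_(B / N)(A / N) = 1.
Proof.
move=> nA nB h; apply/trivgP/subsetP=> _ /setIP[/morphimP[x nx xB ->] /centP cx].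
apply/set1P; apply: coset_id; apply: h => // y yA.
have ny := subsetP nA _ yA; apply: coset_idr; rewrite ?groupR //.
by rewrite morphR //; apply/eqP/commgP/cx; rewrite mem_quotient.
Qed.

(** The intersection of A and B has to vanish modulo N only, so factors that are not complements in
    G can become complements. *)
Lemma quo_sdprod (gT : finGroupType) (G A B N : {group gT}) :
    A * B = G -> G \subset 'N(A) -> G \subset 'N(N) -> N \subset A ->
    A :&: B \subset N ->
  (A / N) ><| (B / N) = G / N.
Proof.
move=> defG nA nN sNA sN.
have [sAG sBG] : A \subset G /\ B \subset G by rewrite -defG mulG_subl mulG_subr.
rewrite sdprodE /=.
- by rewrite -quotientMl ?defG // (subset_trans sAG).
- by rewrite quotient_norms // (subset_trans sBG).
- by rewrite -quotientGI //; apply: quotientS1.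
Qed.

(** An upper bound is enough: an embedded group whose order attains it is the whole affine group,
    and thereby yields the exact order. *)
Lemma card_AGL3_le n : #|AGL3 n.+1| <= #|'GL_n.+1['F_3]| * 3 ^ n.+1.
Proof.
pose h (Mb : 'M['F_3]_n.+1 * 'rV['F_3]_n.+1) :=
  to_perm (fun v : 'rV_n.+1 => (v *m Mb.1 + Mb.2)%R).
have sub : AGL3 n.+1 \subset h @: setX [set M | M \in unitmx] setT.
  apply/subsetP=> p /AGL3P[M uM [b pE]]; apply/imsetP.
  exists (M, b); first by rewrite !inE uM.
  apply/permP=> v; rewrite to_permE /= ?pE // => u w /addIr.
  exact: can_inj (mulmxK uM) _ _.
apply: leq_trans (subset_leq_card sub) (leq_trans (leq_imset_card _ _) _).
rewrite cardsX cardsT card_mx mul1n card_Fp // leq_mul2r; apply/orP; right.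
rewrite -[X in _ <= X](card_imset _ val_inj); apply: subset_leq_card; apply/subsetP=> M.
rewrite inE => uM; apply/imsetP; exists (FinRing.unit 'M['F_3]_n.+1 uM) => //.
Qed.

Lemma card_AGL32 : #|AGL3 2| <= 432.
Proof. by apply: leq_trans (card_AGL3_le 1) _; rewrite card_GL_2 card_Fp. Qed.

Lemma card_AGL31 : #|AGL3 1| <= 6.
Proof. by apply: leq_trans (card_AGL3_le 0) _; rewrite card_GL_1 card_Fp. Qed.

Lemma transl3_norm n g : g \in AGL3 n -> transl3 n :^ g = transl3 n.
Proof.
move=> gA; have sub h : h \in AGL3 n -> transl3 n :^ h \subset transl3 n.
  case/AGL3P=> M uM [b hE]; apply/subsetP=> _ /imsetP[p /transl3P[c pE] ->].
  apply/transl3P; exists (c *m M)%R => v; rewrite !permM.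
  rewrite -{2}[v](permKV h); move: (h^-1 v) => w.
  by rewrite pE !hE mulmxDl addrAC.
by apply/eqP; rewrite eqEcard sub //= cardJg.
Qed.

Lemma isog_AGL31 (gT : finGroupType) (G V Q : {group gT}) :
  V ><| Q = G -> #|V| = 3 -> 'C_Q(V) = 1 -> #|G| = 6 -> G \isog AGL3 1.
Proof.
move=> defG oV cQV oG; have abV : 3.-abelem V by rewrite prime_abelem ?oV.
have [f [injf sf _]] := affine_embed (n := 0) defG abV oV cQV.
apply/isogP; exists f => //; apply/eqP; rewrite eqEcard sf /=.
by rewrite card_injm // oG card_AGL31.
Qed.

Lemma isog_AGL32 (gT : finGroupType) (G V Q : {group gT}) :
    V ><| Q = G -> 3.-abelem V -> #|V| = 9 -> 'C_Q(V) = 1 -> #|G| = 432 ->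
  exists f : {morphism G >-> {perm 'rV['F_3]_2}},
    [/\ 'injm f, f @* G = AGL3 2 & f @* V = transl3 2].
Proof.
move=> defG abV oV cQV oG.
have [f [injf sf fV]] := affine_embed (n := 1) defG abV oV cQV.
exists f; split=> //; apply/eqP; rewrite eqEcard sf /=.
by rewrite card_injm // oG card_AGL32.
Qed.

(* The order of AGL_2(3) is taken as a hypothesis: it is provided by any group *)
(* of order 432 to which isog_AGL32 applies. *)
Section SylowAGL.

Hypothesis oAGL : #|AGL3 2| = 432.
Hypothesis AGL_U : 'O_3(AGL3 2) = transl3 2.
Variable S0 : {group {perm 'rV['F_3]_2}}.
Hypothesis hS0 : S0 \in 'Syl_3(AGL3 2).

Lemma card_S0 : #|S0| = 27.
Proof. by move: hS0; rewrite inE => /card_Hall->; rewrite oAGL p_part. Qed.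

(** By Sylow, the embedding can be followed by a conjugation in AGL_2(3), which preserves the
    translations. This copes with an arbitrary choice of [S0]. *)
Lemma affine_embed_S0 (gT : finGroupType) (G V Q S : {group gT}) :
    V ><| Q = G -> 3.-abelem V -> #|V| = 9 -> 'C_Q(V) = 1 ->
    S \subset G -> #|S| = 27 ->
  exists f : {morphism G >-> {perm 'rV['F_3]_2}},
    [/\ 'injm f, f @* G \subset AGL3 2, f @* V = AGL23_U & f @* S = S0].
Proof.
move=> defG abV oV cQV sSG oS.
have [f [injf sf fV]] := affine_embed (n := 1) defG abV oV cQV.
have sylS : (f @* S)%G \in 'Syl_3(AGL3 2).
  rewrite inE pHallE /= (subset_trans (morphimS f sSG) sf) card_injm //= oS oAGL.
  by rewrite p_part.
move: sylS hS0; rewrite !inE => /Sylow_trans h /h[g gA eS].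
have fM : {in G &, {morph (fun x => f x ^ g) : x y / x * y}}.
  by move=> x y xG yG; rewrite morphM // conjMg.
have im (A : {set gT}) : A \subset G -> Morphism fM @* A = (f @* A) :^ g.
  move=> sA; apply/setP=> y; apply/morphimP/imsetP.
    case=> x _ xA ->; exists (f x) => //; rewrite mem_morphim //.
    exact: (subsetP sA).
  by case=> _ /morphimP[x xG xA ->] ->; exists x.
exists (Morphism fM); split.
- apply/injmP=> x y xG yG /conjg_inj; exact: (injmP injf).
- by rewrite im // -(conjGid gA) conjSg.
- have [_ defVQ _ _] := sdprodP defG.
  rewrite im; last by rewrite -defVQ mulG_subl.
  by rewrite fV transl3_norm //= AGL_U.
- by rewrite im.
Qed.

Hypothesis oAGLS : #|AGL23S S0| = 108.

Lemma isog_AGL23S (gT : finGroupType) (G V Q S : {group gT}) :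
    V ><| Q = G -> 3.-abelem V -> #|V| = 9 -> 'C_Q(V) = 1 ->
    S <| G -> #|S| = 27 -> #|G| = 108 ->
  G \isog AGL23S S0.
Proof.
move=> defG abV oV cQV nSG oS oG.
have [f [injf sf fV fS]] := affine_embed_S0 defG abV oV cQV (normal_sub nSG) oS.
apply/isogP; exists f => //; apply/eqP; rewrite eqEcard oAGLS card_injm // oG leqnn.
by rewrite andbT subsetI sf -fS morphim_norms // normal_norm.
Qed.

Lemma card2_GL1 (gT : finGroupType) (G : {group gT}) : #|G| = 2 -> G \isog 'GL_1(3).
Proof.
move=> oG; have o2 : #|'GL_1(3)| = 2 by rewrite card_GL_1 card_Fp.
by rewrite isog_cyclic_card ?oG ?o2 // prime_cyclic ?oG ?o2.
Qed.

(** * The two distinguished index-2 subgroups of AGL_2(3,S) *)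

Section Index2.

Variables (gT : finGroupType) (G V S T : {group gT}).
Variable f : {morphism G >-> {perm 'rV['F_3]_2}}.
Hypotheses (injf : 'injm f) (sf : f @* G \subset AGL3 2).
Hypotheses (fV : f @* V = AGL23_U) (fS : f @* S = S0).
Hypotheses (sVG : V \subset G) (sTG : T \subset G) (sST : S \subset T).
Hypotheses (abV : abelian V) (oT : #|T| = 54).
Local Notation Z0 := 'C_V(S).

Let oS : #|S| = 27.
Proof. by rewrite -card_S0 -fS card_injm // (subset_trans sST). Qed.

Let sSG : S \subset G. Proof. exact: subset_trans sST sTG. Qed.

Let nST : S <| T.
Proof. by apply: index2_normal => //; rewrite -divgS // oT oS. Qed.

Let fT_sub : f @* T \subset AGL23S S0.
Proof.
rewrite subsetI (subset_trans (morphimS f sTG) sf) -fS morphim_norms //.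
exact: normal_norm.
Qed.

Let index_fT : #|AGL23S S0 : f @* T| = 2.
Proof. by rewrite -divgS // oAGLS card_injm // oT. Qed.

Let fZ0 : f @* Z0 = AGL23_U0 S0.
Proof. by rewrite /= injm_subcent // fV fS. Qed.

Let sZ0G : Z0 \subset G. Proof. exact: subset_trans (subsetIl _ _) sVG. Qed.

Let quo2 : f @* T / S0 \isog 'GL_1(3).
Proof.
apply: card2_GL1; rewrite card_quotient; last first.
  by rewrite -fS morphim_norms // normal_norm.
by rewrite -divgS ?card_injm ?oT ?card_S0 // -fS morphimS.
Qed.

Let UnU0 : AGL23_U \subset 'N(AGL23_U0 S0).
Proof.
apply: sub_abelian_norm; last exact: subsetIl.
by rewrite /= -[X in abelian X]fV morphim_abelian.
Qed.

(** Injectivity of f carries the condition of acting trivially on U / U_0 back to G. *)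
Let comm_f t : t \in G ->
  ([~: [set f t], AGL23_U] \subset AGL23_U0 S0) = ([~: [set t], V] \subset Z0).
Proof.
move=> tG; rewrite -fZ0 -fV -morphim_set1 // -morphimR ?sub1set //.
by rewrite injmSK // comm_subG ?sub1set.
Qed.

(** Here T centralizes U_0, so the first centralizer is everything and the second one is to be
    identified with S_0. *)
Lemma is_sharp_morphim : T \subset 'C(Z0) -> [~: S, V] \subset Z0 ->
    {in T, forall t, [~: [set t], V] \subset Z0 -> t \in S} ->
  is_AGL23S_sharp S0 (f @* T)%G.
Proof.
move=> cT cS hT.
have C1 : 'C_(f @* T)(AGL23_U0 S0) = f @* T.
  by apply/setIidPl; rewrite -fZ0 morphim_cents.
have C2 : 'C_(f @* T)(AGL23_U / AGL23_U0 S0 | 'Q) = S0.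
  rewrite astabQR //; apply/eqP; rewrite eqEsubset; apply/andP; split.
    apply/subsetP=> _ /setIP[/morphimP[t tG tT ->]]; rewrite inE comm_f //.
    by case/andP=> _ /hT tS; rewrite -fS mem_morphim ?tS.
  rewrite -fS; apply/subsetP=> _ /morphimP[t tG tS ->].
  rewrite inE mem_morphim ?(subsetP sST) //= inE comm_f //.
  rewrite (subset_trans (commSg _ _) cS) ?sub1set // andbT.
  rewrite -fZ0 (subsetP (morphim_norms f (cents_norm (_ : T \subset _)))) //.
  by rewrite mem_morphim // (subsetP sST).
split=> //=; rewrite ?C1 ?C2 //.
by apply/mulGidPl; rewrite -fS morphimS.
Qed.

(** The mirror case: T acts trivially on U / U_0, and the centralizer of U_0 is S_0. *)
Lemma is_star_morphim : T \subset 'N(Z0) -> [~: T, V] \subset Z0 ->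
  'C_T(Z0) = S -> is_AGL23S_star S0 (f @* T)%G.
Proof.
move=> nT cT cS.
have C1 : 'C_(f @* T)(AGL23_U0 S0) = S0 by rewrite -fZ0 -injm_subcent // cS fS.
have C2 : 'C_(f @* T)(AGL23_U / AGL23_U0 S0 | 'Q) = f @* T.
  rewrite astabQR //; apply/setIidPl/subsetP=> _ /morphimP[t tG tT ->].
  rewrite inE comm_f // (subset_trans (commSg _ _) cT) ?sub1set // andbT.
  by rewrite -fZ0 (subsetP (morphim_norms f nT)) // mem_morphim.
split=> //=; rewrite ?C1 ?C2 //.
by apply/mulSGid; rewrite -fS morphimS.
Qed.

End Index2.

(** * The semidirect product of Z by H / C_H(Z) *)

Section StarQuotient.

Variables (gT : finGroupType) (Z W0 H : {group gT}).
Hypotheses (nZH : H \subset 'N(Z)) (abZ : 3.-abelem Z) (oZ : #|Z| = 9).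
Hypotheses (sW0 : W0 \subset Z) (nW0 : H \subset 'N(W0)) (oW0 : #|W0| = 3).
Hypotheses (oQ : #|H : 'C_H(Z)| = 6) (cHZ : [~: H, Z] \subset W0).
Hypothesis nc0 : ~~ (H \subset 'C(W0)).

Local Notation C := 'C_H(Z)%G.
Local Notation to := (mod_groupAction (conjg_groupAction gT) C).

Let nCH : H \subset 'N(C).
Proof. by rewrite normsI ?normG // norms_cent. Qed.

Let sZR : Z \subset gacent (conjg_groupAction gT) C.
Proof.
apply/subsetP=> x xZ; rewrite inE in_setT /=; apply/afixP=> y.
case/setIP=> _ /setIP[_ /centP cy] /=.
by apply/conjg_fixP/commgP/commute_sym/cy.
Qed.

Let sQD : H / C \subset act_dom (mod_action (conjg_action gT) C).
Proof. by rewrite quotientS // subsetT. Qed.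

Let V := (sdpair1 to @* Z)%G.
Let Q := (sdpair2 to @* (H / C))%G.
Let W := (sdpair1 to @* W0)%G.
Let T := (V <*> Q)%G.

Let sd_conj x h : x \in Z -> h \in H ->
  sdpair1 to x ^ sdpair2 to (coset C h) = sdpair1 to (x ^ h).
Proof.
move=> xZ hH; have hQ : coset C h \in H / C by rewrite mem_quotient.
rewrite -sdpair_act ?(subsetP sZR) ?(subsetP sQD) //; congr (sdpair1 to _).
apply: modactE; [exact: in_setT | exact: (subsetP nCH) |].
by have /setIP[_] := subsetP sZR _ xZ.
Qed.

Let nVQ : Q \subset 'N(V).
Proof.
apply/subsetP=> _ /morphimP[_ _ /morphimP[h nh hH ->] ->]; rewrite inE.
apply/subsetP=> _ /imsetP[_ /morphimP[x xR xZ ->] ->].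
by rewrite sd_conj // mem_morphim ?(subsetP sZR) // memJ_norm // (subsetP nZH).
Qed.

Let nWQ : Q \subset 'N(W).
Proof.
apply/subsetP=> _ /morphimP[_ _ /morphimP[h nh hH ->] ->]; rewrite inE.
apply/subsetP=> _ /imsetP[_ /morphimP[x xR xW ->] ->].
have xW' : x ^ h \in W0 by rewrite memJ_norm // (subsetP nW0).
by rewrite sd_conj ?(subsetP sW0) // mem_morphim // (subsetP sZR) // (subsetP sW0).
Qed.

Let tiVQ : V :&: Q = 1.
Proof.
apply/trivgP; rewrite -(im_sdpair_TI to); apply: setISS; exact: morphimS.
Qed.

Let defT : V ><| Q = T. Proof. exact: sdprodEY. Qed.

Let oV : #|V| = 9. Proof. by rewrite card_injm ?injm_sdpair1. Qed.
Let oW : #|W| = 3.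
Proof. by rewrite card_injm ?injm_sdpair1 // (subset_trans sW0). Qed.

Let oT : #|T| = 54.
Proof.
rewrite -(sdprod_card defT) oV card_injm ?injm_sdpair2 // card_quotient //.
by rewrite oQ.
Qed.

Let abV : 3.-abelem V. Proof. exact: morphim_abelem. Qed.
Let cVV : abelian V. Proof. exact: abelem_abelian abV. Qed.
Let sWV : W \subset V. Proof. exact: morphimS. Qed.

Let cQV : 'C_Q(V) = 1.
Proof.
apply/trivgP/subsetP=> _ /setIP[/morphimP[_ _ /morphimP[h nh hH ->] ->] /centP cV].
apply/set1P => /=; rewrite coset_id ?morph1 // inE hH /=; apply/centP=> x xZ.
apply: commute_sym; apply/commgP/conjg_fixP.
apply: (injmP (injm_sdpair1 to)); rewrite ?(subsetP sZR) ?memJ_norm ?(subsetP nZH) //=.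
rewrite -sd_conj //; apply/conjg_fixP/commgP/commute_sym/cV.
by rewrite mem_morphim // (subsetP sZR).
Qed.

Let nWT : T \subset 'N(W).
Proof. by rewrite join_subG nWQ andbT sub_abelian_norm. Qed.

Let cTV : [~: T, V] \subset W.
Proof.
rewrite gen_subG; apply/subsetP=> _ /imset2P[t v tT vV ->].
move: tT; rewrite -[T : {set _}](sdprodW defT) => /mulsgP[v' q v'V qQ ->].
have -> : [~ v' * q, v] = [~ q, v].
  rewrite commMgJ; have /commgP/eqP-> : commute v' v by apply: (centsP cVV).
  by rewrite conj1g mul1g.
case/morphimP: qQ => _ _ /morphimP[h nh hH ->] -> {q}.
case/morphimP: vV => x xR xZ -> {v}.
have xhZ : x ^ h \in Z by rewrite memJ_norm // (subsetP nZH).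
have xhR := subsetP sZR _ xhZ.
have xhV : x^-1 ^ h \in Z by rewrite memJ_norm ?groupV // (subsetP nZH).
rewrite /= commgEr -morphV // sd_conj ?groupV // -morphM ?(subsetP sZR) //.
rewrite -commgEr mem_morphim ?(subsetP cHZ) ?mem_commg //.
by rewrite (subsetP sZR) // commgEr groupM.
Qed.

Let cTVV : 'C_T(V) = V.
Proof.
have e : V * 'C_Q(V) = V * Q :&: 'C(V) by rewrite group_modl.
by move: e; rewrite cQV mulg1 (sdprodW defT).
Qed.

Let ncT : ~~ (T \subset 'C(W)).
Proof.
apply: contra nc0 => cT; apply/subsetP=> h hH; apply/centP=> x xW.
apply: commute_sym; apply/commgP/conjg_fixP; have xZ := subsetP sW0 _ xW.
have xhZ : x ^ h \in Z by rewrite memJ_norm // (subsetP nZH).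
apply: (injmP (injm_sdpair1 to)); rewrite ?(subsetP sZR) //=.
rewrite -sd_conj //; apply/conjg_fixP/commgP/commute_sym/(centsP cT).
  apply: (subsetP (joing_subr _ _)); by rewrite mem_morphim ?mem_quotient.
by rewrite mem_morphim // (subsetP sZR).
Qed.

(** The semidirect product T has order 54. A Sylow 3-subgroup P contains Z, and C_Z(P) = W_0: it
    contains W_0, a normal subgroup of order 3 of a 3-group, and it is not Z because C_T(Z) = Z.
    Since T is trivial on Z / W_0 but not on W_0, the centralizer of W_0 is P, which has index 2. *)
Lemma sdprod_quo_star :
  exists2 Y, is_AGL23S_star S0 Y & sdprod_quo Z H \isog Y.
Proof.
have [P sylP] := Sylow_exists 3 T.
have [sPT pP _] := and3P sylP.
have oP : #|P| = 27 by rewrite (card_Hall sylP) oT p_part.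
have [f [injf sf fV fP]] := affine_embed_S0 defT abV oV cQV sPT oP.
have sVT : V \subset T by exact: joing_subl.
have nPT : P <| T by apply: index2_normal => //; rewrite -divgS // oT oP.
have sVP : V \subset P.
  by rewrite (sub_normal_Hall sylP) // (abelem_pgroup abV).
have cWP : W \subset 'C_V(P).
  rewrite subsetI sWV.
  have nWP : W <| P.
    by rewrite /normal (subset_trans sWV sVP) (subset_trans sPT nWT).
  have ntW : W :!=: 1 by rewrite -cardG_gt1 oW.
  have := meet_center_nil (pgroup_nil pP) nWP ntW.
  apply: contraR => ncW; rewrite setIC; apply/eqP.
  rewrite setIC; apply: prime_TIg; rewrite ?oW //.
  by apply: contra ncW => /subset_trans; apply; exact: subsetIr.
have eZ0 : 'C_V(P) = W.
  apply/eqP; rewrite eq_sym eqEcard cWP oW /= leqNgt; apply/negP=> lt3.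
  have d9 : #|'C_V(P)| %| 3 ^ 2 by rewrite -[(3 ^ 2)%N]oV cardSg ?subsetIl.
  have /(dvdn_pfactor _ _ (isT : prime 3))[m m2 om] := d9.
  have m2' : m = 2 by apply/eqP; rewrite eqn_leq m2 -(ltn_exp2l 1 m (isT : 1 < 3)) -om.
  have cPV : P \subset 'C(V).
    rewrite centsC; apply/setIidPl/eqP; rewrite eqEcard subsetIl oV om m2' //.
  have : P \subset V by rewrite -cTVV subsetI sPT cPV.
  by move/subset_leq_card; rewrite oP oV.
exists (f @* T)%G; last by apply: sub_isog.
apply: (is_star_morphim injf sf fV fP); rewrite ?eZ0 //;
  try first [exact: cVV | exact: oT | exact: nWT | exact: cTV].
apply/eqP; rewrite eq_sym eqEsubset subsetI sPT centsC.
have cPW : W \subset 'C(P) by rewrite (subset_trans cWP) ?subsetIr.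
rewrite cPW /=.
have sPC : P \subset 'C_T(W) by rewrite subsetI sPT centsC.
have oC : #|'C_T(W) : P| %| 2.
  rewrite -[2%N]/(54 %/ 27)%N -{1}oT -oP divgS // -(Lagrange_index (subsetIl T 'C(W)) sPC).
  exact: dvdn_mull.
rewrite -indexg_eq1; move: oC; rewrite dvdn_divisors // !inE => /orP[//|/eqP o2].
case/negP: ncT; apply/setIidPl/eqP; rewrite eqEcard subsetIl oT.
by rewrite -(Lagrange sPC) o2 oP.
Qed.

End StarQuotient.

End SylowAGL.

(** * The groups H_i and K_i *)

Definition memb L x := has (ceq x) L.
Definition lprod L1 L2 := [seq cmul x y | x <- L1, y <- L2].
Definition pows x n := traject (cmul x) cone n.
(** The normal forms x_1^i_1 ... x_m^i_m with i_j < n_j, for a list of pairs (x_j, n_j). *)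
Definition pcseq s := foldr (fun xn L => lprod (pows xn.1 xn.2) L) [:: cone] s.
Fixpoint ceq_uniq L :=
  if L is x :: L' then ~~ memb L' x && ceq_uniq L' else true.
(** In a finite group, stability under right multiplication by generators suffices for containing
    the generated subgroup. *)
Definition closedb L gs :=
  memb L cone && all (fun x => all (fun g => memb L (cmul x g)) gs) L.
Definition cconj x y := cmul (cinv y) (cmul x y).
Definition normb L xs gs :=
  all (fun x => all (fun g => memb L (cconj x g)) gs) xs.
Definition comb x y := ceq (cmul x y) (cmul y x).
(** Each coset L t g is again one of the listed cosets; this finite check shows that the list of
    cosets is complete. *)
Definition cosetb L ts gs :=
  all (fun t => all (fun g =>
    has (fun t' => memb L (cmul (cmul t g) (cinv t'))) ts) gs) ts.
Fixpoint coset_uniq L ts :=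
  if ts is t :: ts' then
    all (fun t' => ~~ memb L (cmul t (cinv t'))) ts' && coset_uniq L ts'
  else true.

Lemma cspan_sub (gs hs : crep -> Prop) x :
  (forall y, gs y -> cspan hs y) -> cspan gs x -> cspan hs x.
Proof.
move=> sgh; elim=> {x} [|x gx|x y _ hx _ hy|x _ hx].
- exact: cspan1.
- exact: sgh.
- exact: cspanM.
- exact: cspanV.
Qed.

Lemma cspan_pcseq s : {in pcseq s, forall x, cspan (fun y => y \in unzip1 s) x}.
Proof.
elim: s => [|[x n] s IHs] y; first by rewrite inE => /eqP->; exact: cspan1.
case/allpairsP=> -[u v] [/= /trajectP[i _ ->] /IHs hv ->]; apply: cspanM.
  elim: i => [|i IHi]; first exact: cspan1.
  by apply: cspanM => //; apply: cspan_gen; rewrite mem_head.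
by apply: cspan_sub hv => z zs; apply: cspan_gen; rewrite inE zs orbT.
Qed.

Lemma gen_sub_closed (gT : finGroupType) (A B : {set gT}) :
  1 \in B -> (forall x y, x \in B -> y \in A -> x * y \in B) ->
  <<A>> \subset B.
Proof.
move=> B1 BA; apply/subsetP=> x /gen_prodgP[n [c Ac ->]].
elim: n c Ac => [|n IHn] c Ac; first by rewrite big_ord0.
by rewrite big_ord_recr BA ?IHn.
Qed.

(** * The subgroups of the amalgam, by generators and normal forms *)

Definition gens12 := [:: ga; gb; gc; gf; gt].
Definition gens1 := [:: ga; gb; gc; gd; gt].
Definition gens2 := [:: ga; gb; gc; ge; gf; gt].
(** The involution F sigma^3 generates a Sylow 2-subgroup of T_2. *)
Definition gft := cmul gf gt.

(** [pcV], [pcS] and [pcR] give O_3 of H_1, H_12 and H_2, of orders 9, 27 and 81; [pcT1] and [pcT2]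
    the largest subgroups of H_12 that are normal in H_1 and in H_2; [pcb] the centre <B> of
    O_3(H_12). *)
Definition pcV := [:: (ga, 3); (gb, 3)].
Definition pcS := [:: (ga, 3); (gb, 3); (gc, 3)].
Definition pc12 := [:: (ga, 3); (gb, 3); (gc, 3); (gf, 2); (gt, 2)].
Definition pcT1 := [:: (ga, 3); (gb, 3); (gf, 2)].
Definition pcT2 := [:: (ga, 3); (gb, 3); (gc, 3); (gft, 2)].
Definition pcR := [:: (ga, 3); (gc, 3); (ge, 9)].
Definition pcb := [:: (gb, 3)].

Definition LV := pcseq pcV.
Definition LS := pcseq pcS.
Definition L12 := pcseq pc12.
Definition LT1 := pcseq pcT1.
Definition LT2 := pcseq pcT2.
Definition LR := pcseq pcR.
Definition Lb := pcseq pcb.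
Definition gdc := cmul gd gc.
Definition gdcc := cmul gdc gc.
Definition gee := cmul ge ge.
(** The identity is listed first: along an arc, it is the representative that leads back to the
    previous vertex. *)
Definition ts1 := [:: cone; gd; gdc; gdcc].
Definition ts2 := [:: cone; ge; gee].

Lemma vlistP (gs : crep -> Prop) L :
  foldr (fun x Q => cspan gs x /\ Q) True L -> {in L, forall x, cspan gs x}.
Proof.
elim: L => //= x L IHL [hx hL] y; rewrite inE => /orP[/eqP->//|].
exact: IHL.
Qed.

Ltac valid_tac := repeat match goal with
  | |- cspan _ cone => exact: cspan1
  | |- cspan _ (fst _) => cbn [fst]
  | |- cspan _ (cmul _ _) => apply: cspanM
  | |- cspan _ (cinv _) => apply: cspanV
  | |- cspan _ ?x => first
     [ assumption | apply: cspan_gen; solve [constructor | by rewrite !inE eqxx ?orbT]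
     | progress unfold x ]
  end.
Ltac vlist_tac := apply: vlistP; repeat split; valid_tac.

(** Material for the quotients of H_2: <C, E> is elementary abelian of order 9 modulo <B>, with
    complement generated by A, F and sigma^3; modulo O_3(H_12), the group [pcR] has order 3 and is
    inverted by F. *)
Definition pcVc := [:: (gc, 3); (ge, 9)].
Definition pcQa := [:: (ga, 3); (gf, 2); (gt, 2)].
Definition pcRf := [:: (ga, 3); (gc, 3); (ge, 9); (gf, 2)].
Definition pcF := [:: (gf, 2)].
Definition LVc := pcseq pcVc.
Definition LQa := pcseq pcQa.
Definition LRf := pcseq pcRf.
Definition LF := pcseq pcF.
Definition ccomm x y := cmul (cinv x) (cconj x y).
Definition ccommb L xs ys :=
  all (fun x => all (fun y => memb L (ccomm x y)) ys) xs.
Definition cube x := cmul x (cmul x x).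

(** The last field makes the interpretation faithful up to scalars, which turns boolean tests on
    words into facts about group elements in both directions. *)
Record model (gT : finGroupType) (P : crep -> gT) : Prop := Model {
  model1 : P cone = 1;
  modelM : forall x y, valid x -> valid y -> P (cmul x y) = P x * P y;
  modelV : forall x, valid x -> P (cinv x) = (P x)^-1;
  modelE : forall x y, valid x -> valid y -> (P x == P y) = ceq x y }.

(** * Verified enumeration of subgroups in a model *)

Section Model.

Variables (gT : finGroupType) (P : crep -> gT).
Hypothesis mP : model P.
Let P1 := model1 mP.
Let PM := modelM mP.
Let PV := modelV mP.
Let PE := modelE mP.

Definition pset L : {set gT} := [set y in map P L].
Definition grp L : {group gT} := <<pset L>>%G.
Local Notation vlist L := {in L, forall x, valid x}.

Lemma psetP L y : reflect (exists2 x, x \in L & y = P x) (y \in pset L).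
Proof. by rewrite inE; apply: mapP. Qed.

Lemma mem_pset L x : x \in L -> P x \in pset L.
Proof. by move=> Lx; apply/psetP; exists x. Qed.

Lemma mem_grp L x : x \in L -> P x \in grp L.
Proof. by move=> Lx; rewrite mem_gen ?mem_pset. Qed.

Lemma membE L x : vlist L -> valid x -> (P x \in pset L) = memb L x.
Proof.
move=> vL vx; apply/psetP/hasP=> -[y Ly e]; exists y => //.
  by rewrite -PE; [rewrite e | | exact: vL].
by apply/eqP; rewrite PE //; exact: vL.
Qed.

Lemma valid_span (gs : seq crep) x : vlist gs -> cspan (fun y => y \in gs) x -> valid x.
Proof. by move=> vg; apply: cspan_sub => y /vg. Qed.

Lemma mem_span (gs : seq crep) x : vlist gs -> cspan (fun y => y \in gs) x -> P x \in grp gs.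
Proof.
move=> vg; elim=> {x} [|x gx|x y sx hx sy hy|x sx hx].
- by rewrite P1 group1.
- exact: mem_grp.
- by rewrite PM; [rewrite groupM | exact: valid_span vg _ | exact: valid_span vg _].
- by rewrite PV; [rewrite groupV | exact: valid_span vg _].
Qed.

Lemma vlist_pcseq s : vlist (unzip1 s) -> vlist (pcseq s).
Proof. by move=> vs x /cspan_pcseq; apply: valid_span. Qed.

(** The normal forms contain 1 and are stable under the generators, so they exhaust the group they
    generate. *)
Lemma grp_pcseq s : vlist (unzip1 s) -> closedb (pcseq s) (unzip1 s) ->
  grp (unzip1 s) = pset (pcseq s) :> {set gT}.
Proof.
move=> vs /andP[c1 /allP cM]; have vp := vlist_pcseq vs.
apply/eqP; rewrite eqEsubset gen_sub_closed /=.
- by apply/subsetP=> _ /psetP[x /cspan_pcseq sx ->]; apply: mem_span.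
- by rewrite -P1 membE //; exact: cspan1.
- move=> _ _ /psetP[x px ->] /psetP[y py ->].
  have [vx vy] := (vp _ px, vs _ py); rewrite -PM // membE //; last exact: cspanM.
  exact: allP (cM _ px) _ py.
Qed.

Lemma card_pset L : vlist L -> ceq_uniq L -> #|pset L| = size L.
Proof.
move=> vL uL; rewrite cardsE -(size_map P); apply/card_uniqP.
elim: L vL uL => //= x L IHL vL /andP[nx uL].
have vL' : vlist L by move=> y Ly; apply: vL; rewrite inE Ly orbT.
rewrite IHL // andbT; have := membE vL' (vL x (mem_head _ _)).
by rewrite inE (negPf nx) => ->.
Qed.

Lemma norm_grp L xs gs : vlist L -> vlist xs -> vlist gs ->
  grp xs = pset L :> {set gT} -> normb L xs gs -> grp gs \subset 'N(grp xs).
Proof.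
move=> vL vx vg eL /allP nb; rewrite gen_subG; apply/subsetP=> _ /psetP[g gg ->].
rewrite inE -genJ gen_subG; apply/subsetP=> _ /imsetP[_ /psetP[x xx ->] ->].
have [vx' vg'] := (vx _ xx, vg _ gg).
have -> : P x ^ P g = P (cconj x g).
  by rewrite /cconj PM; [rewrite PM // PV | exact: cspanV | exact: cspanM].
rewrite eL membE //; first exact: allP (nb _ xx) _ gg.
by apply: cspanM; [exact: cspanV | exact: cspanM].
Qed.

Lemma comP x y : valid x -> valid y -> reflect (commute (P x) (P y)) (comb x y).
Proof.
move=> vx vy; rewrite /comb -PE; [|exact: cspanM|exact: cspanM].
by rewrite !PM //; exact: eqP.
Qed.

Lemma coset_cover L ts gs (A : {group gT}) : vlist L -> vlist ts -> vlist gs ->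
    A = pset L :> {set gT} -> cone \in ts -> cosetb L ts gs ->
  forall x, x \in grp gs -> exists2 t, t \in ts & x * (P t)^-1 \in A.
Proof.
move=> vL vt vg eA t1 /allP cb x.
pose B := [set x | has (fun t => x * (P t)^-1 \in A) ts].
suff /subsetP h : grp gs \subset B by move/h; rewrite inE => /hasP[t]; exists t.
apply: gen_sub_closed => [|y g']; rewrite inE.
  by apply/hasP; exists cone; rewrite // P1 invg1 mulg1 group1.
case/hasP=> t tt yt /psetP[g gg ->] {g'}; rewrite inE; apply/hasP.
have /hasP[t' tt' h] := allP (cb _ tt) _ gg; exists t' => //.
have [[v1 v2] v3] := (vt _ tt, vg _ gg, vt _ tt').
have v12 : valid (cmul t g) by exact: cspanM.
have v3' := cspanV v3.
have : P (cmul (cmul t g) (cinv t')) \in A.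
  by rewrite eA membE //; exact: cspanM.
rewrite !PM // PV // => h'; have := groupM yt h'.
by rewrite !mulgA mulgKV.
Qed.

Lemma coset_index L ts (A G : {group gT}) : vlist L -> vlist ts ->
    A = pset L :> {set gT} -> A \subset G ->
    {in ts, forall t, P t \in G} -> coset_uniq L ts ->
    (forall x, x \in G -> exists2 t, t \in ts & x * (P t)^-1 \in A) ->
  #|G : A| = size ts.
Proof.
move=> vL vt eA sAG tG cu cov.
have -> : #|G : A| = #|[set y in [seq A :* P t | t <- ts]]|.
  apply: eq_card => B; rewrite inE; apply/rcosetsP/mapP=> -[x xG ->].
    have [t tt h] := cov x xG; exists t => //; apply/esym/rcoset_eqP.
    by rewrite mem_rcoset -groupV invMg invgK.
  by exists (P x); rewrite ?tG.
rewrite cardsE -(size_map (fun t => A :* P t)); apply/card_uniqP.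
elim: ts vt cu {tG cov} => //= t ts IHt vt /andP[/allP nt ut].
have vt' : vlist ts by move=> y Ly; apply: vt; rewrite inE Ly orbT.
rewrite IHt // andbT; apply/mapP=> -[t' tt' /rcoset_eqP].
have [v1 v2] := (vt t (mem_head _ _), vt' _ tt').
rewrite mem_rcoset -PV // -PM //; last exact: cspanV.
rewrite eA membE //; last by apply: cspanM => //; exact: cspanV.
by move=> h; have := nt _ tt'; rewrite h.
Qed.

Definition V := grp (unzip1 pcV).
Definition S := grp (unzip1 pcS).
Definition T1 := grp (unzip1 pcT1).
Definition T2 := grp (unzip1 pcT2).
Definition R := grp (unzip1 pcR).
Definition Zb := grp (unzip1 pcb).
Definition H12 := grp gens12.
Definition H1 := grp gens1.
Definition H2 := grp gens2.

Lemma V_E : V = pset LV :> {set gT}.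
Proof. by apply: grp_pcseq; [vlist_tac | vm_compute]. Qed.
Lemma S_E : S = pset LS :> {set gT}.
Proof. by apply: grp_pcseq; [vlist_tac | vm_compute]. Qed.
Lemma H12_E : H12 = pset L12 :> {set gT}.
Proof. by apply: (@grp_pcseq pc12); [vlist_tac | vm_compute]. Qed.
Lemma T1_E : T1 = pset LT1 :> {set gT}.
Proof. by apply: grp_pcseq; [vlist_tac | vm_compute]. Qed.
Lemma T2_E : T2 = pset LT2 :> {set gT}.
Proof. by apply: grp_pcseq; [vlist_tac | vm_compute]. Qed.
Lemma R_E : R = pset LR :> {set gT}.
Proof. by apply: grp_pcseq; [vlist_tac | vm_compute]. Qed.
Lemma Zb_E : Zb = pset Lb :> {set gT}.
Proof. by apply: grp_pcseq; [vlist_tac | vm_compute]. Qed.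

Lemma vLV : vlist LV. Proof. by apply: vlist_pcseq; vlist_tac. Qed.
Lemma vLS : vlist LS. Proof. by apply: vlist_pcseq; vlist_tac. Qed.
Lemma vL12 : vlist L12. Proof. by apply: vlist_pcseq; vlist_tac. Qed.
Lemma vLT1 : vlist LT1. Proof. by apply: vlist_pcseq; vlist_tac. Qed.
Lemma vLT2 : vlist LT2. Proof. by apply: vlist_pcseq; vlist_tac. Qed.
Lemma vLR : vlist LR. Proof. by apply: vlist_pcseq; vlist_tac. Qed.
Lemma vLb : vlist Lb. Proof. by apply: vlist_pcseq; vlist_tac. Qed.
Lemma vts1 : vlist ts1. Proof. vlist_tac. Qed.
Lemma vts2 : vlist ts2. Proof. vlist_tac. Qed.
Lemma vgens1 : vlist gens1. Proof. vlist_tac. Qed.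
Lemma vgens2 : vlist gens2. Proof. vlist_tac. Qed.

Lemma card_V : #|V| = 9.
Proof. by rewrite V_E card_pset; [vm_compute | exact: vLV | vm_compute]. Qed.
Lemma card_S : #|S| = 27.
Proof. by rewrite S_E card_pset; [vm_compute | exact: vLS | vm_compute]. Qed.
Lemma card_H12 : #|H12| = 108.
Proof. by rewrite H12_E card_pset; [vm_compute | exact: vL12 | vm_compute]. Qed.
Lemma card_T1 : #|T1| = 18.
Proof. by rewrite T1_E card_pset; [vm_compute | exact: vLT1 | vm_compute]. Qed.
Lemma card_T2 : #|T2| = 54.
Proof. by rewrite T2_E card_pset; [vm_compute | exact: vLT2 | vm_compute]. Qed.
Lemma card_R : #|R| = 81.
Proof. by rewrite R_E card_pset; [vm_compute | exact: vLR | vm_compute]. Qed.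
Lemma card_Zb : #|Zb| = 3.
Proof. by rewrite Zb_E card_pset; [vm_compute | exact: vLb | vm_compute]. Qed.

Lemma grpS L M : {subset L <= M} -> grp L \subset grp M.
Proof.
move=> sLM; apply: genS; apply/subsetP=> _ /psetP[x Lx ->].
by rewrite mem_pset ?sLM.
Qed.

Lemma sub_grp L xs (A : {group gT}) : vlist L -> vlist xs ->
  A = pset L :> {set gT} -> all (memb L) xs -> grp xs \subset A.
Proof.
move=> vL vx eA /allP h; rewrite gen_subG; apply/subsetP=> _ /psetP[x xx ->].
by rewrite eA membE ?h //; exact: vx.
Qed.

(** D is the Fourier matrix of Z/3; its square is 3 = 1 times the permutation matrix of x |-> -x,
    which is F. *)
Lemma gf_gd : P gf = P gd * P gd.
Proof. by rewrite -PM; [apply/eqP; rewrite PE; [vm_compute | |] | |]; valid_tac. Qed.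

Lemma sH12_1 : H12 \subset H1.
Proof.
rewrite gen_subG; apply/subsetP=> _ /psetP[x xx ->].
move: xx; rewrite !inE => /or4P[/eqP->|/eqP->|/eqP->|/orP[]/eqP->];
  rewrite ?gf_gd ?groupM // mem_grp // !inE eqxx ?orbT //.
Qed.

Lemma sH12_2 : H12 \subset H2.
Proof. by apply: grpS; apply/allP. Qed.

Lemma H1_cover x : x \in H1 -> exists2 t, t \in ts1 & x * (P t)^-1 \in H12.
Proof.
by apply: (coset_cover vL12 vts1 vgens1 H12_E); rewrite ?mem_head //; vm_compute.
Qed.

Lemma H2_cover x : x \in H2 -> exists2 t, t \in ts2 & x * (P t)^-1 \in H12.
Proof.
by apply: (coset_cover vL12 vts2 vgens2 H12_E); rewrite ?mem_head //; vm_compute.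
Qed.

Lemma ts1_H1 : {in ts1, forall t, P t \in H1}.
Proof. move=> t tt; apply: (mem_span vgens1); move: t tt; vlist_tac. Qed.

Lemma ts2_H2 : {in ts2, forall t, P t \in H2}.
Proof. move=> t tt; apply: (mem_span vgens2); move: t tt; vlist_tac. Qed.

Lemma index_H1 : #|H1 : H12| = 4.
Proof.
by apply: (coset_index vL12 vts1 H12_E sH12_1 ts1_H1 _ H1_cover); vm_compute.
Qed.

Lemma index_H2 : #|H2 : H12| = 3.
Proof.
by apply: (coset_index vL12 vts2 H12_E sH12_2 ts2_H2 _ H2_cover); vm_compute.
Qed.

Lemma card_H1 : #|H1| = 432.
Proof. by rewrite -(Lagrange sH12_1) index_H1 card_H12. Qed.

Lemma card_H2 : #|H2| = 324.
Proof. by rewrite -(Lagrange sH12_2) index_H2 card_H12. Qed.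

Lemma vlist_lprod L M : vlist L -> vlist M -> vlist (lprod L M).
Proof.
by move=> vL vM _ /allpairsP[[x y] [/= /vL hx /vM hy ->]]; apply: cspanM.
Qed.

Lemma list_cover L ts (A G : {group gT}) : vlist L -> vlist ts ->
    A = pset L :> {set gT} ->
    (forall x, x \in G -> exists2 t, t \in ts & x * (P t)^-1 \in A) ->
  forall x, x \in G -> exists2 y, y \in lprod L ts & x = P y.
Proof.
move=> vL vt eA cov x /cov[t tt]; rewrite eA => /psetP[y Ly e].
exists (cmul y t); first by apply/allpairsP; exists (y, t).
by rewrite PM; [rewrite -e mulgKV | exact: vL | exact: vt].
Qed.

Lemma H1_list x : x \in H1 -> exists2 y, y \in lprod L12 ts1 & x = P y.
Proof. exact: list_cover vL12 vts1 H12_E H1_cover x. Qed.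
Lemma H2_list x : x \in H2 -> exists2 y, y \in lprod L12 ts2 & x = P y.
Proof. exact: list_cover vL12 vts2 H12_E H2_cover x. Qed.
Definition vLH1 := vlist_lprod vL12 vts1.
Definition vLH2 := vlist_lprod vL12 vts2.

Lemma cent_gens (G : {group gT}) Lx gs L (B : {set gT}) :
    vlist Lx -> vlist gs -> vlist L -> B = pset L ->
    (forall x, x \in G -> exists2 y, y \in Lx & x = P y) ->
    all (fun x => all (comb x) gs ==> memb L x) Lx ->
  'C_G(pset gs) \subset B.
Proof.
move=> vx vg vL -> cov /allP h; apply/subsetP=> _ /setIP[/cov[x xL ->] /centP cx].
have vx' := vx _ xL; rewrite membE //; apply: (implyP (h _ xL)).
apply/allP=> g gg; apply/comP => //; first exact: vg.
by apply: cx; rewrite mem_pset.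
Qed.

Lemma pset_list L (A : {group gT}) : A = pset L :> {set gT} ->
  forall x, x \in A -> exists2 y, y \in L & x = P y.
Proof. by move=> -> x /psetP. Qed.

Lemma cent_V_H1 : 'C_H1(V) \subset V.
Proof.
rewrite cent_gen.
apply: (cent_gens vLH1 _ vLV V_E H1_list); first by vlist_tac.
by vm_compute.
Qed.

Lemma cent_S_H2 : 'C_H2(S) \subset S.
Proof.
rewrite cent_gen.
apply: (cent_gens vLH2 _ vLS S_E H2_list); first by vlist_tac.
by vm_compute.
Qed.

Lemma cent_Zb_H12 : 'C_H12(Zb) \subset T2.
Proof.
rewrite cent_gen.
apply: (cent_gens vL12 _ vLT2 T2_E (pset_list H12_E)); first by vlist_tac.
by vm_compute.
Qed.

Lemma center_S_sub : 'Z(S) \subset Zb.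
Proof.
rewrite /center {2}[S]/grp /= cent_gen.
apply: (cent_gens vLS _ vLb Zb_E (pset_list S_E)); first by vlist_tac.
by vm_compute.
Qed.

Lemma cent_grp x gs : valid x -> vlist gs -> all (comb x) gs ->
  P x \in 'C(grp gs).
Proof.
move=> vx vg /allP h; rewrite cent_gen; apply/centP=> _ /psetP[g gg ->].
by apply/comP; [exact: vx | exact: vg | exact: h].
Qed.

Lemma cents_grp xs gs : vlist xs -> vlist gs ->
  all (fun x => all (comb x) gs) xs -> grp xs \subset 'C(grp gs).
Proof.
move=> vx vg /allP h; rewrite gen_subG; apply/subsetP=> _ /psetP[x xx ->].
by apply: cent_grp; [exact: vx | exact: vg | exact: h].
Qed.

Lemma S_cent_Zb : S \subset 'C(Zb).
Proof. by apply: cents_grp; [vlist_tac | vlist_tac | vm_compute]. Qed.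
Lemma T2_cent_Zb : T2 \subset 'C(Zb).
Proof. by apply: cents_grp; [vlist_tac | vlist_tac | vm_compute]. Qed.
Lemma V_abelian : abelian V.
Proof. by apply: cents_grp; [vlist_tac | vlist_tac | vm_compute]. Qed.

Lemma sVS : V \subset S.
Proof. by apply: grpS; apply/allP. Qed.
Lemma sZV : Zb \subset V.
Proof. by apply: grpS; apply/allP. Qed.
Lemma sZS : Zb \subset S. Proof. exact: subset_trans sZV sVS. Qed.
Lemma sSH : S \subset H12.
Proof. by apply: grpS; apply/allP. Qed.
Lemma sST2 : S \subset T2.
Proof. by apply: grpS; apply/allP. Qed.
Lemma sVT1 : V \subset T1.
Proof. by apply: grpS; apply/allP. Qed.
Lemma sT1H : T1 \subset H12.
Proof. by apply: grpS; apply/allP. Qed.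
Lemma sT2H : T2 \subset H12.
Proof. by apply: (sub_grp vL12 _ H12_E); [vlist_tac | vm_compute]. Qed.
Lemma sSR : S \subset R.
Proof. by apply: (sub_grp vLR _ R_E); [vlist_tac | vm_compute]. Qed.
Lemma sRH2 : R \subset H2.
Proof. by apply: grpS; apply/allP. Qed.

Lemma sSH1 : S \subset H1. Proof. exact: subset_trans sSH sH12_1. Qed.
Lemma sVH1 : V \subset H1. Proof. exact: subset_trans sVS sSH1. Qed.
Lemma sZH1 : Zb \subset H1. Proof. exact: subset_trans sZS sSH1. Qed.
Lemma sT1H1 : T1 \subset H1. Proof. exact: subset_trans sT1H sH12_1. Qed.
Lemma sT2H1 : T2 \subset H1. Proof. exact: subset_trans sT2H sH12_1. Qed.

Lemma center_S : 'Z(S) = Zb.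
Proof.
apply/eqP; rewrite eqEsubset center_S_sub subsetI centsC S_cent_Zb andbT.
exact: subset_trans sZV sVS.
Qed.

Lemma H1_norm_V : H1 \subset 'N(V).
Proof. by apply: (norm_grp vLV _ vgens1 V_E); [vlist_tac | vm_compute]. Qed.
Lemma H1_norm_T1 : H1 \subset 'N(T1).
Proof. by apply: (norm_grp vLT1 _ vgens1 T1_E); [vlist_tac | vm_compute]. Qed.
Lemma H2_norm_S : H2 \subset 'N(S).
Proof. by apply: (norm_grp vLS _ vgens2 S_E); [vlist_tac | vm_compute]. Qed.
Lemma H2_norm_T2 : H2 \subset 'N(T2).
Proof. by apply: (norm_grp vLT2 _ vgens2 T2_E); [vlist_tac | vm_compute]. Qed.
Lemma H2_norm_R : H2 \subset 'N(R).
Proof. by apply: (norm_grp vLR _ vgens2 R_E); [vlist_tac | vm_compute]. Qed.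
Lemma H2_norm_Zb : H2 \subset 'N(Zb).
Proof. by apply: (norm_grp vLb _ vgens2 Zb_E); [vlist_tac | vm_compute]. Qed.

(** Elements of the core keep their conjugates by a transversal inside H_12. Testing this on the
    list of H_12 bounds the core from above. *)
Lemma core_list ts LT x (A B : {group gT}) : vlist ts -> vlist LT ->
    A = pset LT :> {set gT} -> B = pset L12 :> {set gT} ->
    all (fun x => all (fun t => memb L12 (cmul (cmul t x) (cinv t))) ts
                  ==> memb LT x) L12 ->
  x \in B -> {in ts, forall t, P t * x * (P t)^-1 \in B} -> x \in A.
Proof.
move=> vt vT eA eB /allP h; rewrite eA eB => /psetP[y Ly ->] ht.
have vy := vL12 Ly; rewrite membE //; apply: (implyP (h _ Ly)).
apply/allP=> t tt; have vt' := vt _ tt; have := ht _ tt.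
have vty : valid (cmul t y) by exact: cspanM.
rewrite -PM // -PV // -PM //; last exact: cspanV.
by rewrite membE //; [exact: vL12 | apply: cspanM => //; exact: cspanV].
Qed.

Lemma core_T1 x : x \in H12 -> {in ts1, forall t, P t * x * (P t)^-1 \in H12} ->
  x \in T1.
Proof. by apply: (core_list vts1 vLT1 T1_E H12_E); vm_compute. Qed.

Lemma core_T2 x : x \in H12 -> {in ts2, forall t, P t * x * (P t)^-1 \in H12} ->
  x \in T2.
Proof. by apply: (core_list vts2 vLT2 T2_E H12_E); vm_compute. Qed.

(** * The field automorphism sigma^2 *)

Local Notation r := (P gr).

(** rho^2 is trivial on F_4, so it fixes A, B and D; it multiplies C by the scalar a. *)
Lemma r_cent_H1 : r \in 'C(H1).
Proof. by apply: cent_grp; [valid_tac | exact: vgens1 | vm_compute]. Qed.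

Lemma r_notin_H1 : r \notin H1.
Proof.
apply/negP=> /H1_cover[t tt]; have vt := vts1 tt.
rewrite -PV // -PM; [| by valid_tac | by valid_tac].
rewrite H12_E membE; [| exact: vL12 | by valid_tac].
apply/negP; move: t tt {vt}; apply/allP; by vm_compute.
Qed.

Lemma r_notin_H2 : r \notin H2.
Proof.
apply/negP=> /H2_cover[t tt]; have vt := vts2 tt.
rewrite -PV // -PM; [| by valid_tac | by valid_tac].
rewrite H12_E membE; [| exact: vL12 | by valid_tac].
apply/negP; move: t tt {vt}; apply/allP; by vm_compute.
Qed.

Lemma order_r : #[r] = 3.
Proof.
apply: nt_prime_order => //.
  rewrite !expgS expg0 mulg1 -PM; [rewrite -PM; [|by valid_tac|by valid_tac]|by valid_tac|by valid_tac].
  by rewrite -P1; apply/eqP; rewrite PE; [vm_compute | by valid_tac | by valid_tac].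
by rewrite -P1 PE; [vm_compute | by valid_tac | by valid_tac].
Qed.

(** rho^2 maps beta to beta^4, and E^3 = B. Thus sigma^2 normalizes H_2 without centralizing it,
    which is where the amalgams of H and K diverge. *)
Lemma e_r : P ge ^ r = P ge * P gb.
Proof.
rewrite /conjg -PV; last by valid_tac.
rewrite -!PM; [|by valid_tac..].
by apply/eqP; rewrite PE; [vm_compute | by valid_tac | by valid_tac].
Qed.

Lemma r_conj y : y \in H1 -> y ^ r = y.
Proof.
move=> yH; apply/conjg_fixP/commgP; apply: commute_sym.
exact: (centP r_cent_H1).
Qed.

Lemma r_norm_H2 : r \in 'N(H2).
Proof.
rewrite inE -genJ gen_subG; apply/subsetP=> _ /imsetP[_ /psetP[x xx ->] ->].
have cr y : y \in gens1 -> P y ^ r = P y by move=> yy; rewrite r_conj ?mem_grp.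
have: x \in ge :: gf :: gens1 by move: x xx; apply/allP.
rewrite 2!inE => /or3P[/eqP->|/eqP->|hx].
- by rewrite e_r groupM ?mem_grp.
- by rewrite gf_gd conjMg !cr // -gf_gd mem_grp.
- by rewrite cr // mem_grp.
Qed.

Lemma r_norm_R : r \in 'N(R).
Proof.
rewrite inE -genJ gen_subG; apply/subsetP=> _ /imsetP[_ /psetP[x xx ->] ->].
have cr y : y \in gens1 -> P y ^ r = P y by move=> yy; rewrite r_conj ?mem_grp.
have sR := subsetP sSR; have: x \in [:: ga; gc; ge] by [].
rewrite !inE => /or3P[] /eqP->; rewrite ?e_r ?cr //; try exact: mem_grp.
by apply: groupM; [exact: mem_grp | apply: sR; exact: mem_grp].
Qed.

Lemma P_comm x y : valid x -> valid y -> P (ccomm x y) = [~ P x, P y].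
Proof.
move=> vx vy; have vc : valid (cconj x y) by rewrite /cconj; valid_tac.
rewrite /ccomm PM ?PV //; last exact: cspanV.
by rewrite /cconj !PM ?PV //; valid_tac.
Qed.

Lemma v_comm x y : valid x -> valid y -> valid (ccomm x y).
Proof. by move=> vx vy; rewrite /ccomm /cconj; valid_tac. Qed.

(** Both groups normalize N, so modulo N it suffices that generators commute. *)
Lemma commg_grp L xs ys (N : {group gT}) : vlist L -> vlist xs -> vlist ys ->
    N = pset L :> {set gT} -> grp xs \subset 'N(N) -> grp ys \subset 'N(N) ->
    ccommb L xs ys -> [~: grp xs, grp ys] \subset N.
Proof.
move=> vL vx vy eN nx ny /allP h; rewrite -quotient_cents2 //.
rewrite /grp /= !quotient_gen; [|exact: subset_trans (subset_gen _) ny|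
  exact: subset_trans (subset_gen _) nx].
rewrite cent_gen gen_subG quotient_cents2r //.
rewrite gen_subG; apply/subsetP=> _ /imset2P[_ _ /psetP[x xx ->] /psetP[y yy ->] ->].
have [vx' vy'] := (vx _ xx, vy _ yy).
rewrite -P_comm // eN membE //; [exact: allP (h _ xx) _ yy | exact: v_comm].
Qed.

(** * Recognition of H_1, H_12 and of the quotients of H_2 as affine groups *)

Definition Vc := grp (unzip1 pcVc).
Definition Qa := grp (unzip1 pcQa).
Definition Rf := grp (unzip1 pcRf).
Definition Ff := grp (unzip1 pcF).
Definition Q1 := grp [:: gc; gd; gt].
Lemma Vc_E : Vc = pset LVc :> {set gT}.
Proof. by apply: grp_pcseq; [vlist_tac | vm_compute]. Qed.
Lemma Qa_E : Qa = pset LQa :> {set gT}.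
Proof. by apply: grp_pcseq; [vlist_tac | vm_compute]. Qed.
Lemma Rf_E : Rf = pset LRf :> {set gT}.
Proof. by apply: grp_pcseq; [vlist_tac | vm_compute]. Qed.
Lemma Ff_E : Ff = pset LF :> {set gT}.
Proof. by apply: grp_pcseq; [vlist_tac | vm_compute]. Qed.
Lemma vLVc : vlist LVc. Proof. by apply: vlist_pcseq; vlist_tac. Qed.
Lemma vLQa : vlist LQa. Proof. by apply: vlist_pcseq; vlist_tac. Qed.
Lemma vLRf : vlist LRf. Proof. by apply: vlist_pcseq; vlist_tac. Qed.
Lemma vLF : vlist LF. Proof. by apply: vlist_pcseq; vlist_tac. Qed.
Lemma card_Vc : #|Vc| = 27.
Proof. by rewrite Vc_E card_pset; [vm_compute | exact: vLVc | vm_compute]. Qed.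
Lemma card_Rf : #|Rf| = 162.
Proof. by rewrite Rf_E card_pset; [vm_compute | exact: vLRf | vm_compute]. Qed.

Lemma V_abelem : 3.-abelem V.
Proof.
rewrite abelemE // V_abelian; apply/exponentP=> x; rewrite V_E => /psetP[y Ly ->].
have vy := vLV Ly; rewrite !expgS expg0 mulg1 -!PM; [|by valid_tac..].
apply/eqP; rewrite -P1 PE; [|by valid_tac..].
by move: y Ly {vy}; apply/allP; vm_compute.
Qed.

Lemma meet_list L M N (A B C : {group gT}) : vlist L -> vlist M -> vlist N ->
    A = pset L :> {set gT} -> B = pset M :> {set gT} -> C = pset N :> {set gT} ->
    all (fun x => memb M x ==> memb N x) L ->
  A :&: B \subset C.
Proof.
move=> vL vM vN -> -> -> /allP h; apply/subsetP=> _ /setIP[/psetP[x Lx ->]].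
have vx := vL _ Lx; rewrite !membE //; exact: (implyP (h _ Lx)).
Qed.

(** F = D^2 centralizes C, D and sigma^3, but no nontrivial element of V. *)
Lemma V_Q1 : V :&: Q1 = 1.
Proof.
have cf : Q1 \subset 'C[P gf].
  rewrite -cent_set1 centsC sub1set; apply: cent_grp; [by valid_tac| by vlist_tac|].
  by vm_compute.
apply/trivgP; apply: subset_trans (setIS _ cf) _.
apply/subsetP=> x /setIP[]; rewrite V_E => /psetP[y Ly ->] /cent1P cy.
have vy := vLV Ly; have vf : valid gf by valid_tac.
apply/set1P/eqP; rewrite -P1 PE; [| by valid_tac..].
move/commute_sym/(introT (comP vf vy)): cy; apply/implyP; move: y Ly {vy}; apply/allP; by vm_compute.
Qed.

Lemma sdprod_H1 : V ><| Q1 = H1.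
Proof.
have sQ : Q1 \subset H1 by apply: grpS; apply/allP.
rewrite sdprodEY ?V_Q1 //; last exact: subset_trans sQ H1_norm_V.
apply/eqP; rewrite eqEsubset join_subG sQ.
have -> /= : V \subset H1 by apply: grpS; apply/allP.
rewrite gen_subG; apply/subsetP=> _ /psetP[x xx ->].
have: (x \in [:: ga; gb]) || (x \in [:: gc; gd; gt]) by move: x xx; apply/allP.
case/orP=> hx; first by apply: (subsetP (joing_subl _ _)); exact: mem_grp.
by apply: (subsetP (joing_subr _ _)); exact: mem_grp.
Qed.

Lemma cent_Q1_V : 'C_Q1(V) = 1.
Proof.
apply/trivgP; rewrite -V_Q1 subsetI subsetIl andbT.
apply: subset_trans cent_V_H1; apply: setSI.
by apply: grpS; apply/allP.
Qed.

(** Of the four representatives of H_12 in H_1, only the identity normalizes S. *)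
Lemma norm_S_H1 : 'N_H1(S) = H12.
Proof.
apply/eqP; rewrite eqEsubset subsetI sH12_1 (subset_trans sH12_2 H2_norm_S) !andbT.
apply/subsetP=> x /setIP[/H1_cover[t tt h] nx].
have nh := subsetP (subset_trans sH12_2 H2_norm_S) _ h.
have nt : P t \in 'N(S).
  have -> : P t = (x * (P t)^-1)^-1 * x by rewrite invMg invgK mulgKV.
  by rewrite groupM ?groupV.
suff/eqP t1 : t == cone by move: h; rewrite t1 P1 invg1 mulg1.
have vt := vts1 tt.
have: all (fun s => memb LS (cconj s t)) [:: ga; gb; gc].
  apply/allP=> s ss; have vs : valid s by move: s ss; vlist_tac.
  have vc : valid (cconj s t) by rewrite /cconj; valid_tac.
  rewrite -(membE vLS vc) -S_E.
  have -> : P (cconj s t) = P s ^ P t.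
    by rewrite /cconj !PM ?PV //; valid_tac.
  by rewrite memJ_norm // mem_grp.
by apply/implyP; move: t tt {h nt vt nh}; apply/allP; vm_compute.
Qed.

(** O_3(H_1) lies in the Sylow subgroup S and is invariant under D, while an element of S that D
    conjugates back into S lies in V. *)
Lemma pcore_H1 : 'O_3(H1) = V.
Proof.
apply/eqP; rewrite eqEsubset; apply/andP; split; last first.
  rewrite pcore_max //; first by rewrite /pgroup card_V.
  by rewrite /normal H1_norm_V andbT; apply: grpS; apply/allP.
have sylS : 3.-Sylow(H1) S.
  rewrite pHallE (subset_trans sSH sH12_1) card_S card_H1 p_part //.
have sOS : 'O_3(H1) \subset S by rewrite pcore_sub_Hall.
apply/subsetP=> x xO; have := subsetP sOS _ xO; rewrite S_E => /psetP[y Ly ex].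
have vy := vLS Ly; have vd : valid gd by valid_tac.
have vc : valid (cconj y gd) by rewrite /cconj; valid_tac.
have : P (cconj y gd) \in S.
  have -> : P (cconj y gd) = x ^ P gd by rewrite ex /cconj !PM ?PV //; valid_tac.
  rewrite (subsetP sOS) // memJ_norm // (subsetP (normal_norm (pcore_normal _ _))) //.
  exact: mem_grp.
rewrite S_E membE //; last exact: vLS.
rewrite ex V_E membE //; last exact: vLV.
by apply/implyP; move: y Ly {ex vy vc}; apply/allP; vm_compute.
Qed.

(** H_1 attains the upper bound 432, so its embedding is onto; the structure of AGL_2(3) is then
    read off from H_1. *)
Lemma AGL32_facts : #|AGL3 2| = 432 /\ 'O_3(AGL3 2) = transl3 2.
Proof.
have [f [injf fH fV]] :=
  isog_AGL32 sdprod_H1 V_abelem card_V cent_Q1_V card_H1.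
by rewrite -fH -injm_pcore // pcore_H1 fV card_injm // card_H1.
Qed.

Lemma cent_V_S : 'C_V(S) = Zb.
Proof.
apply/eqP; rewrite eqEsubset subsetI sZV centsC S_cent_Zb andbT.
by rewrite (subset_trans _ center_S_sub) // setSI ?sVS.
Qed.

Section AffineShape.

Variable S0 : {group {perm 'rV['F_3]_2}}.
Hypothesis hS0 : S0 \in 'Syl_3(AGL3 2).

Lemma H1_affine : exists f : {morphism H1 >-> {perm 'rV['F_3]_2}},
  [/\ 'injm f, f @* H1 = AGL3 2, f @* V = AGL23_U & f @* S = S0].
Proof.
have [oA UA] := AGL32_facts.
have [f [injf sf fV fS]] := affine_embed_S0 oA UA hS0 sdprod_H1 V_abelem card_V
  cent_Q1_V (subset_trans sSH sH12_1) card_S.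
exists f; split=> //; apply/eqP; rewrite eqEcard sf /= oA card_injm ?card_H1 //.
Qed.

Lemma H12_affine (f : {morphism H1 >-> {perm 'rV['F_3]_2}}) :
  'injm f -> f @* H1 = AGL3 2 -> f @* S = S0 -> f @* H12 = AGL23S S0.
Proof.
move=> injf fH fS; rewrite -norm_S_H1 injm_subnorm ?fH ?fS //.
exact: subset_trans sSH sH12_1.
Qed.

Lemma card_AGL23S : #|AGL23S S0| = 108.
Proof.
have [f [injf fH fV fS]] := H1_affine.
by rewrite -(H12_affine injf fH fS) card_injm ?sH12_1 // card_H12.
Qed.

Lemma isog_H1 : H1 \isog AGL3 2.
Proof. by have [f [injf fH _ _]] := H1_affine; apply/isogP; exists f. Qed.

Lemma isog_H12 : H12 \isog AGL23S S0.
Proof.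
have [f [injf fH fV fS]] := H1_affine.
by rewrite -[gval (AGL23S S0)](H12_affine injf fH fS) sub_isog ?sH12_1.
Qed.

Lemma T2_sharp : exists2 Y, is_AGL23S_sharp S0 Y & T2 \isog Y.
Proof.
have [oA _] := AGL32_facts; have [f [injf fH fV fS]] := H1_affine.
have sT : T2 \subset H1 := subset_trans sT2H sH12_1.
exists (f @* T2)%G; last exact: sub_isog.
apply: (is_sharp_morphim oA hS0 card_AGL23S injf _ fV fS).
- by rewrite fH.
- exact: subset_trans sVS (subset_trans sSH sH12_1).
- exact: sT.
- exact: sST2.
- exact: V_abelian.
- exact: card_T2.
- by rewrite cent_V_S T2_cent_Zb.
- rewrite cent_V_S; apply: (commg_grp vLb _ _ Zb_E).
  + by vlist_tac.
  + by vlist_tac.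
  + exact: cents_norm S_cent_Zb.
  + exact: subset_trans sVS (cents_norm S_cent_Zb).
  + by vm_compute.
(* The commutator with A suffices as a test: an element t of T_2 with [t, A] in <B> already lies in
   S. *)
- rewrite cent_V_S => t; rewrite T2_E => /psetP[y Ly ->] cy.
  have vy := vLT2 Ly; have va : valid ga by valid_tac.
  have : P (ccomm y ga) \in Zb.
    rewrite P_comm // (subsetP cy) // mem_commg ?set11 //; exact: mem_grp.
  rewrite Zb_E membE; [|exact: vLb | exact: v_comm].
  rewrite S_E membE //; last exact: vLS.
  by apply/implyP; move: y Ly {cy vy}; apply/allP; vm_compute.
Qed.

(** The translations are the image of <C, E>, with <A, F, sigma^3> acting faithfully on them modulo
    <B>; the Sylow subgroup is R / <B>. *)
Lemma isog_H2_Zb : H2 / Zb \isog AGL23S S0.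
Proof.
have [oA UA] := AGL32_facts.
have nZ := H2_norm_Zb.
have sVcH : Vc \subset H2 by apply: grpS; apply/allP.
have sQaH : Qa \subset H2 by apply: grpS; apply/allP.
have sZVc : Zb \subset Vc.
  by apply: (sub_grp vLVc _ Vc_E); [vlist_tac | vm_compute].
have nVc : H2 \subset 'N(Vc).
  by apply: (norm_grp vLVc _ vgens2 Vc_E); [vlist_tac | vm_compute].
have defH : Vc * Qa = H2.
  rewrite -norm_joinEr ?(subset_trans sQaH) //; apply/eqP.
  rewrite eqEsubset join_subG sVcH sQaH /= gen_subG.
  apply/subsetP=> _ /psetP[x xx ->].
  have: [|| x \in unzip1 pcVc, x \in unzip1 pcQa | x == gb] by move: x xx; apply/allP.
  case/or3P=> [hx|hx|/eqP->].
  - by apply: (subsetP (joing_subl _ _)); exact: mem_grp.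
  - by apply: (subsetP (joing_subr _ _)); exact: mem_grp.
  - by apply: (subsetP (joing_subl _ _)); apply: (subsetP sZVc); exact: mem_grp.
have tiVQ : Vc :&: Qa \subset Zb.
  by apply: (meet_list vLVc vLQa vLb Vc_E Qa_E Zb_E); vm_compute.
apply: (@isog_AGL23S oA UA S0 hS0 card_AGL23S _ _ (Vc / Zb)%G (Qa / Zb)%G (R / Zb)%G).
- exact: (quo_sdprod defH nVc nZ sZVc tiVQ).
- rewrite abelemE //; apply/andP; split.
    apply: quotient_abelian; apply: cents_grp; [by vlist_tac | by vlist_tac |].
    by vm_compute.
  apply/exponentP=> _ /morphimP[x nx xV ->]; rewrite -morphX //; apply: coset_id.
  move: xV; rewrite Vc_E => /psetP[y Ly ->]; have vy := vLVc Ly.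
  rewrite !expgS expg0 mulg1 -!PM; [|by valid_tac..].
  rewrite Zb_E membE; [| exact: vLb | by valid_tac].
  by move: y Ly {vy nx}; apply/allP; vm_compute.
- rewrite card_quotient ?(subset_trans sVcH) // -divgS // card_Vc card_Zb //.
- apply: quo_cent1; [exact: subset_trans sVcH nZ | exact: subset_trans sQaH nZ |].
  move=> x; rewrite Qa_E => /psetP[y Ly ->] cy; have vy := vLQa Ly.
  have vc : valid gc by valid_tac.
  have ve : valid ge by valid_tac.
  have := cy (P gc) (mem_grp (isT : gc \in unzip1 pcVc)).
  have := cy (P ge) (mem_grp (isT : ge \in unzip1 pcVc)).
  rewrite -!P_comm // Zb_E (membE vLb (v_comm vy ve)) (membE vLb (v_comm vy vc)).
  rewrite (membE vLb vy).
  move=> h1 h2; move: (conj h1 h2) => /andP; apply/implyP.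
  by move: y Ly {cy vy h1 h2}; apply/allP; vm_compute.
- by rewrite quotient_normal // /normal sRH2 H2_norm_R.
- rewrite card_quotient ?(subset_trans sRH2) // -divgS ?card_R ?card_Zb //.
  exact: subset_trans sZS sSR.
- rewrite card_quotient // -divgS ?card_H2 ?card_Zb //.
  exact: subset_trans sZVc sVcH.
Qed.

End AffineShape.

(** The factor of order 2 is T_2 / S, generated by F sigma^3; the other one is R <F> / S, where F
    inverts R / S of order 3. The remaining generator sigma^3 is a product of F and F sigma^3. *)
Lemma isog_H2_S : H2 / S \isog setX [set: 'Z_2] (AGL3 1).
Proof.
have nS := H2_norm_S; have sSRf : S \subset Rf.
  by apply: (sub_grp vLRf _ Rf_E); [vlist_tac | vm_compute].
have sRfH : Rf \subset H2 by apply: grpS; apply/allP.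
have sFfH : Ff \subset H2 by apply: grpS; apply/allP.
have sT2H2 : T2 \subset H2 := subset_trans sT2H sH12_2.
have defH : T2 <*> Rf = H2.
  apply/eqP; rewrite eqEsubset join_subG sT2H2 sRfH /= gen_subG.
  apply/subsetP=> _ /psetP[x xx ->].
  have: [|| x \in unzip1 pcT2, x \in unzip1 pcRf | x == gt] by move: x xx; apply/allP.
  case/or3P=> [hx|hx|/eqP->].
  - by apply: (subsetP (joing_subl _ _)); exact: mem_grp.
  - by apply: (subsetP (joing_subr _ _)); exact: mem_grp.
  have -> : P gt = (P gf)^-1 * P gft by rewrite PM ?mulKg //; valid_tac.
  rewrite groupM ?groupV //.
    by apply: (subsetP (joing_subr _ _)); exact: mem_grp.
  by apply: (subsetP (joing_subl _ _)); exact: mem_grp.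
have ti : T2 :&: Rf \subset S.
  by apply: (meet_list vLT2 vLRf vLS T2_E Rf_E S_E); vm_compute.
have com : [~: T2, Rf] \subset S.
  apply: (commg_grp vLS _ _ S_E (subset_trans sT2H2 nS) (subset_trans sRfH nS)).
  - by vlist_tac.
  - by vlist_tac.
  - by vm_compute.
have dp : (T2 / S) \x (Rf / S) = H2 / S.
  rewrite dprodEY /=.
  - by rewrite -quotientY ?defH // (subset_trans _ nS).
  - by rewrite centsC quotient_cents2r.
  - by rewrite -quotientGI ?sST2 //; apply: quotientS1.
apply: (isog_dprod dp (setX_dprod _ _)).
  apply: isog_trans (isog_setX1 _ _).
  have o2 : #|T2 / S| = 2.
    by rewrite card_quotient ?(subset_trans sT2H2) // -divgS ?sST2 // card_T2 card_S.
  by apply: (@isog_Zn _ _ 2) => //; rewrite prime_cyclic ?o2.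
apply: isog_trans (isog_set1X _ _).
have sSR' := sSR; have sRRf : R \subset Rf by apply: grpS; apply/allP.
have defRf : R * Ff = Rf.
  rewrite -norm_joinEr ?(subset_trans sFfH) ?H2_norm_R //; apply/eqP.
  rewrite eqEsubset join_subG sRRf /=.
  have -> /= : Ff \subset Rf by apply: grpS; apply/allP.
  rewrite gen_subG; apply/subsetP=> _ /psetP[x xx ->].
  have: (x \in unzip1 pcR) || (x \in unzip1 pcF) by move: x xx; apply/allP.
  case/orP=> hx; first by apply: (subsetP (joing_subl _ _)); exact: mem_grp.
  by apply: (subsetP (joing_subr _ _)); exact: mem_grp.
apply: (@isog_AGL31 _ _ (R / S)%G (Ff / S)%G).
- apply: (quo_sdprod defRf _ _ sSR).
  + exact: subset_trans sRfH H2_norm_R.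
  + exact: subset_trans sRfH nS.
  + by apply: (meet_list vLR vLF vLS R_E Ff_E S_E); vm_compute.
- by rewrite card_quotient ?(subset_trans sRH2) // -divgS // card_R card_S.
- apply: quo_cent1; [exact: subset_trans sRH2 nS | exact: subset_trans sFfH nS |].
  move=> x; rewrite Ff_E => /psetP[y Ly ->] cy; have vy := vLF Ly.
  have ve : valid ge by valid_tac.
  have := cy (P ge) (mem_grp (isT : ge \in unzip1 pcR)).
  rewrite -P_comm // S_E (membE vLS (v_comm vy ve)) (membE vLS vy).
  by apply/implyP; move: y Ly {cy vy}; apply/allP; vm_compute.
- by rewrite card_quotient ?(subset_trans sRfH) // -divgS // card_Rf card_S.
Qed.

(** F and sigma^3 both invert E, so their product centralizes it. *)
Lemma cent_gft_R : 'C_R(<[P gft]>) = <[P ge]>.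
Proof.
have ve : valid ge by valid_tac.
have vft : valid gft by valid_tac.
rewrite cent_cycle; apply/eqP; rewrite eqEsubset; apply/andP; split.
  apply/subsetP=> x /setIP[]; rewrite R_E => /psetP[y Ly ->] /cent1P cy.
  have vy := vLR Ly.
  have vp : vlist (pcseq [:: (ge, 9)]) by apply: vlist_pcseq; vlist_tac.
  suff : P y \in pset (pcseq [:: (ge, 9)]).
    case/psetP=> z /cspan_pcseq sz ->.
    have vge : vlist [:: ge] by vlist_tac.
    have := mem_span vge sz.
    by rewrite /grp /pset /= set_cons set_nil setU0.
  rewrite membE //; move/commute_sym/(introT (comP vft vy)): cy; apply/implyP.
  by move: y Ly {vy}; apply/allP; vm_compute.
rewrite cycle_subG inE (mem_grp (isT : ge \in unzip1 pcR)) /=; apply/cent1P.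
by apply/(comP ve vft); vm_compute.
Qed.

Lemma order_ge : #[P ge] = 9.
Proof.
have vge : vlist [:: ge] by vlist_tac.
have e9 : grp [:: ge] = pset (pcseq [:: (ge, 9)]) :> {set gT}.
  by apply: (@grp_pcseq [:: (ge, 9)]) => //; vm_compute.
have -> : #[P ge] = #|grp [:: ge]| by rewrite /grp /pset /= set_cons set_nil setU0.
by rewrite e9 card_pset; [vm_compute | exact: (@vlist_pcseq [:: (ge, 9)]) | vm_compute].
Qed.

Lemma order_gft : #[P gft] = 2.
Proof.
have vft : valid gft by valid_tac.
apply: nt_prime_order => //; last by rewrite -P1 PE; [vm_compute | by valid_tac..].
by rewrite !expgS expg0 mulg1 -PM // -P1.
Qed.

(* Subgroups of H (k = false) and of K (k = true) are treated at once. *)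
Definition Xr (k : bool) : {group gT} := if k then <[r]>%G else 1%G.

(** * The groups A X, for X trivial or generated by sigma^2 *)

Section Extended.
Variable k : bool.
Local Notation X := (Xr k).

Definition G12 : {group gT} := (H12 <*> X)%G.
Definition G1 : {group gT} := (H1 <*> X)%G.
Definition G2 : {group gT} := (H2 <*> X)%G.

Lemma X_cent_H1 : X \subset 'C(H1).
Proof. by rewrite /Xr; case: k; rewrite ?sub1G // cycle_subG r_cent_H1. Qed.

Lemma X_norm_H2 : X \subset 'N(H2).
Proof. by rewrite /Xr; case: k; rewrite ?sub1G // cycle_subG r_norm_H2. Qed.

Lemma X_norm_R : X \subset 'N(R).
Proof. by rewrite /Xr; case: k; rewrite ?sub1G // cycle_subG r_norm_R. Qed.

Lemma X_TI (A : {group gT}) : r \notin A -> A :&: X = 1.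
Proof.
rewrite /Xr; case: k => rA; last by apply/setIidPr; rewrite sub1G.
by rewrite setIC prime_TIg ?cycle_subG // -orderE order_r.
Qed.

Lemma H1_X : H1 :&: X = 1. Proof. exact: X_TI r_notin_H1. Qed.
Lemma H2_X : H2 :&: X = 1. Proof. exact: X_TI r_notin_H2. Qed.

Lemma sub_TI (A B : {group gT}) : A \subset B -> B :&: X = 1 -> A :&: X = 1.
Proof. by move=> sAB BX; apply/trivgP; rewrite -BX setSI. Qed.

Lemma X_dprod (A : {group gT}) : A \subset H1 -> A \x X = A <*> X.
Proof.
move=> sA; rewrite dprodEY ?(sub_TI sA H1_X) //.
exact: subset_trans X_cent_H1 (centS sA).
Qed.

Lemma X_mul (A : {group gT}) : A \subset H1 -> A <*> X = A * X.
Proof.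
move=> sA; rewrite joingC cent_joinEl ?[LHS]cent_joinEl //; last first.
  exact: subset_trans X_cent_H1 (centS sA).
by apply: normC; apply: cents_norm; apply: subset_trans X_cent_H1 (centS sA).
Qed.

Lemma G2_mul : G2 = H2 * X :> {set gT}.
Proof. by rewrite /= norm_joinEr ?X_norm_H2. Qed.

Lemma sG12_1 : G12 \subset G1. Proof. by rewrite genS ?setSU ?sH12_1. Qed.
Lemma sG12_2 : G12 \subset G2. Proof. by rewrite genS ?setSU ?sH12_2. Qed.

Lemma meet_G12_H1 : G12 :&: H1 = H12.
Proof.
by rewrite /= X_mul ?sH12_1 // -group_modl ?sH12_1 // [X :&: _]setIC H1_X mulg1.
Qed.

Lemma meet_G12_H2 : G12 :&: H2 = H12.
Proof.
by rewrite /= X_mul ?sH12_1 // -group_modl ?sH12_2 // [X :&: _]setIC H2_X mulg1.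
Qed.

Lemma card_G12 : #|G12| = (108 * #|X|)%N.
Proof. by rewrite /= X_mul ?sH12_1 // TI_cardMg ?card_H12 // (sub_TI sH12_1 H1_X). Qed.
Lemma card_G1 : #|G1| = (432 * #|X|)%N.
Proof. by rewrite /= X_mul // TI_cardMg ?card_H1 // H1_X. Qed.
Lemma card_G2 : #|G2| = (324 * #|X|)%N.
Proof. by rewrite G2_mul TI_cardMg ?card_H2 // H2_X. Qed.

Lemma index_G1 : #|G1 : G12| = 4.
Proof. by rewrite -divgS ?sG12_1 // card_G1 card_G12 divnMr ?cardG_gt0. Qed.
Lemma index_G2 : #|G2 : G12| = 3.
Proof. by rewrite -divgS ?sG12_2 // card_G2 card_G12 divnMr ?cardG_gt0. Qed.

(** The index of G_12 in the intersection divides both 4 and 3. *)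
Lemma meet_G1_G2 : G1 :&: G2 = G12.
Proof.
have s12 : G12 \subset G1 :&: G2 by rewrite subsetI sG12_1 sG12_2.
apply/eqP; rewrite eq_sym eqEsubset s12 /= -indexg_eq1 -dvdn1.
rewrite -[1%N]/(gcdn 4 3) dvdn_gcd -{1}index_G1 -index_G2.
rewrite -(Lagrange_index (subsetIl G1 G2) s12) dvdn_mull //.
by rewrite -(Lagrange_index (subsetIr G1 G2) s12) dvdn_mull.
Qed.

Lemma G1_cover x : x \in G1 -> exists2 t, t \in ts1 & x * (P t)^-1 \in G12.
Proof.
rewrite /= X_mul // => /mulsgP[h y /H1_cover[t tt ht] yX ->]; exists t => //.
have cy : commute y (P t)^-1.
  by apply: (centsP X_cent_H1); rewrite ?groupV ?ts1_H1.
by rewrite -mulgA cy mulgA groupM //= mem_gen // inE ?ht ?yX ?orbT.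
Qed.

Lemma G2_cover x : x \in G2 -> exists2 t, t \in ts2 & x * (P t)^-1 \in G12.
Proof.
rewrite G2_mul -(normC X_norm_H2) => /mulsgP[y h yX /H2_cover[t tt ht] ->].
by exists t; rewrite // -mulgA groupM //= mem_gen // inE ?ht ?yX ?orbT.
Qed.

Lemma X_pgroup : 3.-group X.
Proof. by rewrite /Xr; case: k; rewrite ?pgroup1 // /pgroup -orderE order_r. Qed.

Lemma X_conj x y : x \in X -> y \in H1 -> x ^ y = x.
Proof.
move=> xX yH; apply/conjg_fixP/commgP; exact: (centsP X_cent_H1).
Qed.

Lemma G1_norm (A : {group gT}) : A \subset H1 -> H1 \subset 'N(A) ->
  G1 \subset 'N(A <*> X).
Proof.
move=> sA nA; have c1 : X \subset 'C(A) by apply: subset_trans X_cent_H1 (centS sA).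
have c2 : H1 \subset 'C(X) by rewrite centsC X_cent_H1.
by rewrite join_subG !normsY ?normG ?(cents_norm c1) ?(cents_norm c2).
Qed.

(** Since E^r = E B, conjugation by E multiplies r by B^-1. *)
Lemma X_conj_e x : x \in X -> x ^ P ge \in Zb <*> X.
Proof.
have re : r ^ P ge = r * (P gb)^-1.
  have := e_r; rewrite /conjg => h.
  apply: (mulgI (P ge)); apply: (mulIg (P gb)).
  by rewrite mulKVg -mulgA -h mulKVg !mulgA mulgKV.
rewrite /Xr; case: k => [/cycleP[i ->]|/set1P->]; last by rewrite conj1g group1.
rewrite conjXg re groupX //= groupM ?groupV ?mem_gen // inE ?cycle_id ?orbT //.
by rewrite mem_grp.
Qed.

(** E is the only generator of H_2 outside H_12, and it moves X by elements of <B>. Hence A X is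
    normalized as soon as A contains <B>. *)
Lemma G2_norm (A : {group gT}) : Zb \subset A -> H2 \subset 'N(A) ->
  X \subset 'N(A) -> G2 \subset 'N(A <*> X).
Proof.
move=> sZ nA nX; have sAX : Zb <*> X \subset A <*> X by rewrite genS ?setSU.
rewrite join_subG (subset_trans (joing_subr A X) (normG _)) andbT.
rewrite gen_subG; apply/subsetP=> _ /psetP[x xx ->].
have xH : P x \in H2 by exact: mem_grp.
rewrite inE -genJ gen_subG conjUg (normsP nA _ xH) subUset joing_subl /=.
apply/subsetP=> _ /imsetP[y yX ->].
have: (x == ge) || (x \in gens12) by move: x xx {xH}; apply/allP.
case/orP=> [/eqP->|x12]; first by rewrite (subsetP sAX) ?X_conj_e.
by rewrite X_conj // ?(subsetP sH12_1) ?mem_grp // (subsetP (joing_subr A X)).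
Qed.

Lemma X_norm (A : {group gT}) : A \subset H1 -> X \subset 'N(A).
Proof. by move=> sA; apply/cents_norm/(subset_trans X_cent_H1)/centS. Qed.

Lemma G1_norm_VX : G1 \subset 'N(V <*> X).
Proof. exact: G1_norm sVH1 H1_norm_V. Qed.
Lemma G1_norm_T1X : G1 \subset 'N(T1 <*> X).
Proof. exact: G1_norm sT1H1 H1_norm_T1. Qed.
Lemma G2_norm_ZX : G2 \subset 'N(Zb <*> X).
Proof. by rewrite G2_norm ?H2_norm_Zb ?X_norm ?sZH1. Qed.
Lemma G2_norm_SX : G2 \subset 'N(S <*> X).
Proof. by rewrite G2_norm ?H2_norm_S ?X_norm ?sSH1 ?sZS. Qed.
Lemma G2_norm_T2X : G2 \subset 'N(T2 <*> X).
Proof. by rewrite G2_norm ?H2_norm_T2 ?X_norm ?sT2H1 // (subset_trans sZS sST2). Qed.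
Lemma G2_norm_RX : G2 \subset 'N(R <*> X).
Proof. by rewrite G2_norm ?H2_norm_R ?X_norm_R // (subset_trans sZS sSR). Qed.

Lemma G12_mul : G12 = H12 * X :> {set gT}.
Proof. exact: X_mul sH12_1. Qed.

(** X is central in G_1, so conjugating h y by a representative affects h only, and the question
    reduces to H_1. *)
Lemma gcore_G1 : gcore G12 G1 = T1 <*> X.
Proof.
apply/eqP; rewrite eqEsubset; apply/andP; split; last first.
  by apply: gcore_max G1_norm_T1X; rewrite genS ?setSU ?sT1H.
have nc := gcore_norm G12 G1; have sc := gcore_sub G12 G1.
apply/subsetP=> x xc; have := subsetP sc _ xc.
rewrite G12_mul => /mulsgP[h y hH yX ex].
rewrite ex groupM ?mem_gen // inE ?yX ?orbT // (core_T1 hH) // => t tt.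
have tH := ts1_H1 tt.
have -> : P t * h * (P t)^-1 = h ^ (P t)^-1 by rewrite conjgE invgK mulgA.
rewrite -meet_G12_H1; apply/setIP; split; last first.
  by rewrite groupJ ?groupV // (subsetP sH12_1).
have : x ^ (P t)^-1 \in gcore G12 G1.
  by rewrite memJ_norm // groupV (subsetP nc) // mem_gen // inE tH.
move/(subsetP sc); rewrite ex conjMg (X_conj yX) ?groupV // => h'.
by rewrite -[h ^ _](mulgK y) groupM // groupV mem_gen // inE yX orbT.
Qed.

(** X need not be central in G_2, but conjugates of its elements stay in <B> X, hence in G_12; they
    can be divided out, and the question reduces to H_2. *)
Lemma gcore_G2 : gcore G12 G2 = T2 <*> X.
Proof.
apply/eqP; rewrite eqEsubset; apply/andP; split; last first.
  by apply: gcore_max G2_norm_T2X; rewrite genS ?setSU ?sT2H.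
have nc := gcore_norm G12 G2; have sc := gcore_sub G12 G2.
apply/subsetP=> x xc; have := subsetP sc _ xc.
rewrite G12_mul => /mulsgP[h y hH yX ex].
rewrite ex groupM ?mem_gen // inE ?yX ?orbT // (core_T2 hH) // => t tt.
have tH := ts2_H2 tt.
have -> : P t * h * (P t)^-1 = h ^ (P t)^-1 by rewrite conjgE invgK mulgA.
rewrite -meet_G12_H2; apply/setIP; split; last first.
  by rewrite groupJ ?groupV // (subsetP sH12_2).
have tG : (P t)^-1 \in G2 by rewrite groupV mem_gen // inE tH.
have : x ^ (P t)^-1 \in gcore G12 G2 by rewrite memJ_norm // (subsetP nc).
move/(subsetP sc); rewrite ex conjMg => h'.
have yt : y ^ (P t)^-1 \in G12.
  apply: (subsetP (_ : Zb <*> X \subset G12)).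
    by rewrite genS // setSU // (subset_trans sZS sSH).
  by rewrite memJ_norm ?(subsetP G2_norm_ZX) // mem_gen // inE yX orbT.
by rewrite -[h ^ _](mulgK (y ^ (P t)^-1)) groupM // groupV.
Qed.

Lemma card_AX (A : {group gT}) : A \subset H1 -> #|A <*> X| = (#|A| * #|X|)%N.
Proof. by move=> sA; rewrite X_mul // TI_cardMg // (sub_TI sA H1_X). Qed.

Lemma card_RX : #|R <*> X| = (81 * #|X|)%N.
Proof.
by rewrite norm_joinEr ?X_norm_R // TI_cardMg ?card_R // (sub_TI sRH2 H2_X).
Qed.

Lemma pcore_max_index (A G : {group gT}) m : A <| G -> 3.-group A ->
  #|G| = (m * #|A|)%N -> 3^'.-nat m -> 'O_3(G) = A.
Proof.
move=> nA pA cG m3; apply: normal_Hall_pcore (nA).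
rewrite /pHall normal_sub // pA /= -divgS ?normal_sub // cG mulnK ?cardG_gt0 //.
Qed.

Lemma pgroup_AX (A : {group gT}) : A \subset H1 -> 3.-group A -> 3.-group (A <*> X).
Proof.
move=> sA pA; rewrite /pgroup card_AX // pnatM; apply/andP; split=> //.
exact: X_pgroup.
Qed.

Lemma pS : 3.-group S. Proof. by rewrite /pgroup card_S. Qed.
Lemma pV : 3.-group V. Proof. by rewrite /pgroup card_V. Qed.

Lemma pcore_T1X : 'O_3(T1 <*> X) = V <*> X.
Proof.
apply: (@pcore_max_index _ _ 2); rewrite ?pgroup_AX ?pV ?sVH1 //.
  rewrite /normal genS ?setSU ?sVT1 //=.
  apply: subset_trans G1_norm_VX; by rewrite genS ?setSU ?sT1H1.
by rewrite !card_AX ?sT1H1 ?sVH1 // card_T1 card_V mulnA.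
Qed.

Lemma pcore_T2X : 'O_3(T2 <*> X) = S <*> X.
Proof.
apply: (@pcore_max_index _ _ 2); rewrite ?pgroup_AX ?pS ?sSH1 //.
  rewrite /normal genS ?setSU ?sST2 //=.
  apply: subset_trans G2_norm_SX; by rewrite genS ?setSU // (subset_trans sT2H sH12_2).
by rewrite !card_AX ?sT2H1 ?sSH1 // card_T2 card_S mulnA.
Qed.

Lemma pcore_G12 : 'O_3(G12) = S <*> X.
Proof.
apply: (@pcore_max_index _ _ 4); rewrite ?pgroup_AX ?pS ?sSH1 //.
  rewrite /normal genS ?setSU ?sSH //=.
  exact: subset_trans sG12_2 G2_norm_SX.
by rewrite card_G12 !card_AX ?sSH1 // card_S mulnA.
Qed.

Lemma pcore_G2 : 'O_3(G2) = R <*> X.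
Proof.
apply: (@pcore_max_index _ _ 4).
- rewrite /normal genS ?setSU ?sRH2 //=; exact: G2_norm_RX.
- by rewrite /pgroup card_RX pnatM; exact: X_pgroup.
- by rewrite card_G2 card_RX mulnA.
- by [].
Qed.

Lemma cent_VX : 'C_G1(V <*> X) \subset V <*> X.
Proof.
rewrite /= centY; apply/subsetP=> x /setIP[].
rewrite X_mul // => /mulsgP[h y hH yX ->] /setIP[cV _].
rewrite groupM ?mem_gen // inE ?yX ?orbT // (subsetP cent_V_H1) // inE hH /=.
rewrite -(groupMr _ (_ : y \in 'C(V))) //.
by apply: subsetP yX; apply: subset_trans X_cent_H1 (centS sVH1).
Qed.

Lemma cent_SX : 'C_G2(S <*> X) \subset S <*> X.
Proof.
rewrite /= centY; apply/subsetP=> x /setIP[].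
rewrite G2_mul => /mulsgP[h y hH yX ->] /setIP[cV _].
rewrite groupM ?mem_gen // inE ?yX ?orbT // (subsetP cent_S_H2) // inE hH /=.
rewrite -(groupMr _ (_ : y \in 'C(S))) //.
by apply: subsetP yX; apply: subset_trans X_cent_H1 (centS sSH1).
Qed.

Lemma X_abelian : abelian X.
Proof. by rewrite /Xr; case: k; rewrite ?abelian1 ?cycle_abelian. Qed.

Lemma center_SX : 'Z(S <*> X) = Zb <*> X.
Proof.
have := center_dprod (X_dprod sSH1).
rewrite center_S (center_idP X_abelian) => <-.
by rewrite X_dprod ?sZH1.
Qed.

Lemma cent_ZX : 'C_G12(Zb <*> X) = T2 <*> X.
Proof.
apply/eqP; rewrite eqEsubset; apply/andP; split.
  rewrite centY; apply/subsetP=> x /setIP[].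
  rewrite G12_mul => /mulsgP[h y hH yX ->] /setIP[cV _].
  rewrite groupM ?mem_gen // inE ?yX ?orbT // (subsetP cent_Zb_H12) // inE hH /=.
  rewrite -(groupMr _ (_ : y \in 'C(Zb))) //.
  by apply: subsetP yX; apply: subset_trans X_cent_H1 (centS sZH1).
rewrite subsetI genS ?setSU ?sT2H //= centY subsetI !join_subG T2_cent_Zb.
rewrite (subset_trans X_cent_H1 (centS sZH1)) /= -[X \subset _]/(abelian X) X_abelian andbT.
by rewrite centsC (subset_trans X_cent_H1 (centS sT2H1)).
Qed.

(** sigma^3 is the product of F in T_1 and of F sigma^3 in T_2; every other generator of H_12 lies
    in T_1 or in T_2. *)
Lemma mul_T1X_T2X : (T1 <*> X) * (T2 <*> X) = G12.
Proof.
rewrite -norm_joinEl; last first.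
  apply: subset_trans G2_norm_T2X; rewrite genS ?setSU //.
  exact: subset_trans sT1H sH12_2.
have sub (A : {group gT}) : A \subset H12 -> A <*> X \subset G12.
  by move=> sA; rewrite genS ?setSU.
apply/eqP; rewrite eqEsubset join_subG !sub ?sT1H ?sT2H //=.
have sX : X \subset (T1 <*> X) <*> (T2 <*> X).
  exact: subset_trans (joing_subr _ _) (joing_subr _ _).
rewrite join_subG sX andbT gen_subG; apply/subsetP=> _ /psetP[x xx ->].
have s1 z : z \in unzip1 pcT1 -> P z \in (T1 <*> X) <*> (T2 <*> X).
  move=> zz; apply: (subsetP (joing_subl _ _)); apply: (subsetP (joing_subl _ _)).
  exact: mem_grp.
have s2 z : z \in unzip1 pcT2 -> P z \in (T1 <*> X) <*> (T2 <*> X).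
  move=> zz; apply: (subsetP (joing_subr _ _)); apply: (subsetP (joing_subl _ _)).
  exact: mem_grp.
have: [|| x \in unzip1 pcT1, x \in unzip1 pcT2 | x == gt].
  by move: x xx; apply/allP.
case/or3P=> [/s1//|/s2//|/eqP->].
have -> : P gt = (P gf)^-1 * P gft.
  by rewrite PM ?mulKg //; valid_tac.
by apply: groupM; [rewrite groupV; exact: s1 | exact: s2].
Qed.

(** X is absorbed by the normal subgroup, so the quotients for K are those already known for H. *)
Lemma quo_X (A : {group gT}) : A \subset H12 -> G2 \subset 'N(A <*> X) ->
  H2 / A \isog G2 / (A <*> X).
Proof.
move=> sA nA; have sA1 := subset_trans sA sH12_1.
have sA2 := subset_trans sA sH12_2.
have sH2 : H2 \subset G2 by exact: joing_subl.
have eG : (G2 : {set gT}) = H2 <*> (A <*> X).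
  apply/eqP; rewrite eqEsubset !join_subG !joing_subl joing_subr /=.
  rewrite (subset_trans (joing_subr A X) (joing_subr _ _)) /=.
  by rewrite (subset_trans sA2 (joing_subl _ _)).
rewrite eG (quotientYidr (subset_trans sH2 nA)).
have eA : (A <*> X) :&: H2 = A.
  by rewrite X_mul // -group_modl // [X :&: _]setIC H2_X mulg1.
by have := second_isog (subset_trans sH2 nA); rewrite eA.
Qed.

(** T_1 T_2 is all of G_12, which leaves no other closed subgroup. *)
Lemma amalgam_X_G12 : amalgam_X G1 G2 G12 G12.
Proof.
have T1E : amalgam_T1 G1 G12 = (T1 <*> X)%G by apply: val_inj; exact: gcore_G1.
have T2E : amalgam_T2 G2 G12 = (T2 <*> X)%G by apply: val_inj; exact: gcore_G2.
have cs (A B : {group gT}) : A \subset <<class_support A B>>.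
  exact: subset_trans (sub_class_support _ _) (subset_gen _).
apply/mingroupP; split=> [|Y /and4P[_]]; rewrite /amalgam_closed T1E T2E /=.
  rewrite subxx (mul_T1X_T2X : _ * _ = _) subxx /=.
  by rewrite !eqEsubset !subsetI !subxx !subsetIl !cs.
rewrite (mul_T1X_T2X : _ * _ = _) => sG _ _ sY; apply/eqP.
by rewrite eqEsubset sY.
Qed.

Lemma center_pcore_G12 : 'Z('O_3(G12)) = Zb <*> X.
Proof. by rewrite pcore_G12 center_SX. Qed.

Lemma T2X_G : amalgam_T2 G2 G12 = (T2 <*> X)%G.
Proof. by apply: val_inj; exact: gcore_G2. Qed.

Lemma shape_with_G12 S0 : S0 \in 'Syl_3(AGL3 2) ->
  shape_AGL23S_with G1 G2 G12 S0 G12.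
Proof.
move=> hS0; have sZ : Zb \subset H12 := subset_trans sZS sSH.
split=> //.
- by split; [exact: sG12_1 | exact: sG12_2 | exact: amalgam_X_G12].
- by rewrite center_pcore_G12 cent_ZX T2X_G.
- rewrite center_pcore_G12 /normal G2_norm_ZX andbT.
  by apply: subset_trans sG12_2; rewrite genS ?setSU.
- rewrite center_pcore_G12 isog_sym.
  apply: isog_trans (quo_X sZ G2_norm_ZX); rewrite isog_sym.
  exact: isog_H2_Zb.
Qed.

Lemma shape_H2_G2 : shape_H2 G2 G12.
Proof.
rewrite /shape_H2 pcore_G12; split.
  rewrite /normal G2_norm_SX andbT.
  by apply: subset_trans sG12_2; rewrite genS ?setSU ?sSH.
rewrite isog_sym; apply: isog_trans (quo_X sSH G2_norm_SX); rewrite isog_sym.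
exact: isog_H2_S.
Qed.

Lemma cent_gft_RX : 'C_(R <*> X)(<[P gft]>) = <[P ge]> <*> X.
Proof.
have ftH : P gft \in H1.
  by apply: (subsetP sT2H1); exact: mem_grp.
have cX : X \subset 'C(<[P gft]>).
  by apply: subset_trans X_cent_H1 (centS _); rewrite cycle_subG.
have eR : P ge \in R by exact: mem_grp.
apply/eqP; rewrite eqEsubset; apply/andP; split; last first.
  rewrite join_subG !subsetI cX joing_subr -cent_gft_R.
  by rewrite (subset_trans (subsetIl _ _) (joing_subl _ _)) subsetIr.
apply/subsetP=> x /setIP[]; rewrite norm_joinEr ?X_norm_R //.
case/mulsgP=> y z yR zX -> cyz.
rewrite groupM //; last by apply: (subsetP (joing_subr _ _)).
apply: (subsetP (joing_subl _ _)); rewrite -cent_gft_R inE yR.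
by rewrite -(groupMr _ (subsetP cX _ zX)).
Qed.

(** X is a 3-group, so <F sigma^3> is a Sylow 2-subgroup of T_2 X; the others are conjugate to it by
    elements that normalize O_3(G_2). *)
Lemma cent_Syl2 (T : {group gT}) : T \in 'Syl_2(amalgam_T2 G2 G12) ->
  exists g, 'C_('O_3(G2))(T) = (<[P ge]> <*> X) :^ g.
Proof.
rewrite T2X_G pcore_G2 inE => sylT.
have oT2 : #|T2 <*> X| = (54 * #|X|)%N by rewrite card_AX ?sT2H1 // card_T2.
have oX2 : logn 2 #|X| = 0.
  apply/eqP; rewrite -leqn0 leqNgt logn_gt0 mem_primes; apply/negP=> /and3P[_ _].
  by apply/negP; rewrite -prime_coprime // coprime_sym (pnat_coprime X_pgroup).
have syl0 : 2.-Sylow(T2 <*> X) <[P gft]>.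
  rewrite pHallE cycle_subG oT2 p_part lognM ?cardG_gt0 // oX2.
  rewrite (subsetP (joing_subl _ _)) ?mem_grp //=.
  by rewrite -orderE order_gft.
have [g gT' ->] := Sylow_trans syl0 sylT.
exists g; rewrite -cent_gft_RX conjIg -centJ; congr (_ :&: _).
have gG : g \in G2.
  by apply: subsetP gT'; rewrite genS ?setSU // (subset_trans sT2H sH12_2).
by rewrite (normP (subsetP G2_norm_RX _ gG)).
Qed.

End Extended.

Lemma G_false (A : {group gT}) : (A <*> Xr false)%G = A.
Proof. by apply: val_inj; rewrite /= joingG1. Qed.

Lemma shape_D2_model S0 : S0 \in 'Syl_3(AGL3 2) ->
  shape_D2 (G1 false) (G2 false) (G12 false) S0.
Proof.
move=> hS0; exists (G12 false); first exact: shape_with_G12.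
split.
- by rewrite /G1 G_false; apply: isog_H1 hS0.
- by rewrite /G12 G_false; apply: isog_H12.
- exact: shape_H2_G2.
- by rewrite T2X_G G_false; apply: T2_sharp.
- move=> T /cent_Syl2[g ->]; rewrite /Xr joingG1 isog_sym.
  apply: isog_trans (conj_isog _ g); rewrite isog_sym.
  by apply: (@isog_Zn _ _ 9) => //; [exact: cycle_cyclic | exact: order_ge].
Qed.

Lemma isog_dprod_r (gT' : finGroupType) (A : {group gT}) (B : {group gT'}) :
  A \subset H1 -> A \isog B -> A <*> Xr true \isog setX [set: 'Z_3] B.
Proof.
move=> sA iAB; apply: (isog_dprod _ (setX_dprod _ _)) (isog_trans _ (isog_setX1 _ _))
  (isog_trans iAB (isog_set1X _ _)).
  by rewrite dprodC; exact: X_dprod.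
by apply: (@isog_Zn _ _ 3) => //; [exact: cycle_cyclic | exact: order_r].
Qed.

(** Among 1, E and E^2 only 1 commutes with sigma^2, so an element of G_2 that centralizes sigma^2
    lies in G_12. *)
Lemma cent_r_G2 : 'C_(G2 true)(Zb <*> Xr true) = T2 <*> Xr true.
Proof.
rewrite -cent_ZX; apply/eqP; rewrite eqEsubset; apply/andP; split; last first.
  by rewrite setSI ?sG12_2.
rewrite subsetI subsetIr andbT; apply/subsetP=> x /setIP[/G2_cover[t tt h] cx].
suff/eqP t1 : t == cone by move: h; rewrite t1 P1 invg1 mulg1.
have vt := vts2 tt; have vr : valid gr by valid_tac.
have cr : r \in 'C(G12 true).
  rewrite centY inE (subsetP (centS sH12_1)) ?r_cent_H1 //=.
  by apply/centP=> y /cycleP[i ->]; exact: commuteX.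
have: commute r (P t).
  have -> : P t = (x * (P t)^-1)^-1 * x by rewrite invMg invgK mulgKV.
  apply: commuteM; first by apply: (centP cr); rewrite groupV.
  apply: commute_sym; apply: (centP cx); apply: (subsetP (joing_subr _ _)).
  exact: cycle_id.
move/(introT (comP vr vt)); apply/implyP.
by move: t tt {h vt}; apply/allP; vm_compute.
Qed.

Lemma pset1 x : pset [:: x] = [set P x].
Proof. by apply/setP=> y; rewrite !inE. Qed.

(** Here Z = <B, sigma^2> and W_0 = <B>. The group acting on Z has order 972 / 162 = 6; it moves
    sigma^2 by powers of B only, and F does not centralize B. *)
Lemma star_ZX S0 : S0 \in 'Syl_3(AGL3 2) ->
  exists2 Y, is_AGL23S_star S0 Y
           & sdprod_quo 'Z('O_3(G12 true))%G (G2 true) \isog Y.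
Proof.
move=> hS0; have [oA UA] := AGL32_facts.
have -> : 'Z('O_3(G12 true))%G = (Zb <*> Xr true)%G.
  by apply: val_inj; exact: center_pcore_G12.
have oZX : #|Zb <*> Xr true| = 9.
  by have := card_AX true sZH1; rewrite card_Zb -orderE order_r.
have cG2 : #|G2 true| = 972 by rewrite card_G2 -orderE order_r.
apply: (sdprod_quo_star oA UA hS0 (card_AGL23S hS0) (W0 := Zb)).
- exact: G2_norm_ZX.
- rewrite (dprod_abelem _ (X_dprod true sZH1)).
  by rewrite !prime_abelem ?card_Zb // -orderE order_r.
- exact: oZX.
- exact: joing_subl.
- rewrite join_subG H2_norm_Zb /=; exact: (X_norm true sZH1).
- exact: card_Zb.
- rewrite -divgS ?subsetIl //= cent_r_G2 cG2 (card_AX true sT2H1).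
  by rewrite card_T2 -orderE order_r.
- have eG : G2 true = grp (gens2 ++ [:: gr]).
    apply: val_inj => /=; rewrite joing_idl joing_idr; congr <<_>>.
    by apply/setP=> y; rewrite /pset /= !inE -!orbA.
  have eZ : (Zb <*> Xr true)%G = grp [:: gb; gr].
    apply: val_inj => /=; rewrite joing_idl joing_idr; congr <<_>>.
    by apply/setP=> y; rewrite !inE.
  have nG : G2 true \subset 'N(Zb).
    by rewrite join_subG H2_norm_Zb /=; exact: (X_norm true sZH1).
  have nZ : Zb <*> Xr true \subset 'N(Zb).
    by apply: subset_trans nG; rewrite genS ?setSU // (subset_trans sZS (subset_trans sSR sRH2)).
  have := commg_grp vLb _ _ Zb_E; move=> /(_ (gens2 ++ [:: gr]) [:: gb; gr]).
  rewrite -eG -eZ; apply.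
  + by vlist_tac.
  + by vlist_tac.
  + exact: nG.
  + exact: nZ.
  + by vm_compute.
- apply/negP=> /centsP /(_ (P gf) _ (P gb) _).
  have vf : valid gf by valid_tac.
  have vb : valid gb by valid_tac.
  move=> h; have /(introT (comP vf vb)) : commute (P gf) (P gb).
    by apply: h; [apply: (subsetP (joing_subl _ _)) |]; exact: mem_grp.
  by vm_compute.
Qed.

(** As E^3 = B, sigma^2 normalizes <E>. A nonabelian group of order 27 is extraspecial; E forces the
    exponent to be at least 9, and 27 would make the group cyclic. *)
Lemma SP2_er g : is_SP2 ((<[P ge]> <*> Xr true) :^ g).
Proof.
set E := (<[P ge]> <*> Xr true)%G.
have sE : <[P ge]> \subset R by rewrite cycle_subG mem_grp.
have nE : Xr true \subset 'N(<[P ge]>).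
  rewrite cycle_subG inE -cycleJ cycle_subG e_r.
  have <- : P (cube ge) = P gb.
    by apply/eqP; rewrite PE; [vm_compute | by rewrite /cube; valid_tac | by valid_tac].
  rewrite /cube !PM; [|by valid_tac..].
  by rewrite !groupM ?cycle_id.
have oE : #|E| = 27.
  rewrite /= norm_joinEr // TI_cardMg -?orderE ?order_ge ?order_r //.
  apply: sub_TI (H2_X true); apply: subset_trans sE sRH2.
have pE : 3.-group E by rewrite /pgroup oE.
have abE : ~~ abelian E.
  apply/negP=> /centsP /(_ (P ge) _ r _) h.
  have ve : valid ge by valid_tac.
  have vr : valid gr by valid_tac.
  have /(introT (comP ve vr)) : commute (P ge) r.
    apply: h; [apply: (subsetP (joing_subl _ _)) | apply: (subsetP (joing_subr _ _))];
    exact: cycle_id.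
  by vm_compute.
have exE : extraspecial E by apply: (p3group_extraspecial pE abE); rewrite oE.
have ex9 : exponent E = 9.
  apply/eqP; rewrite eqn_dvd; apply/andP; split; last first.
    rewrite -order_ge dvdn_exponent //; apply: (subsetP (joing_subl _ _)).
    exact: cycle_id.
  apply/exponentP=> x xE; apply/eqP; rewrite -order_dvdn.
  have : #[x] %| 3 ^ 3 by rewrite -[(3 ^ 3)%N]oE order_dvdG.
  case/(dvdn_pfactor _ _ (isT : prime 3)) => m; rewrite leq_eqVlt => /orP[/eqP->|m2] o.
    case/negP: abE; apply: cyclic_abelian; apply/cyclicP; exists x; apply/esym/eqP.
    by rewrite eqEcard cycle_subG xE /= oE -orderE o.
  by rewrite o (dvdn_exp2l 3 (m2 : m <= 2)).
split; rewrite ?cardJg ?exponentJ //.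
exact: (@isog_extraspecial _ _ E (E :^ g)%G (conj_isog E g)).
Qed.

Lemma shape_E2_model S0 : S0 \in 'Syl_3(AGL3 2) ->
  shape_E2 (G1 true) (G2 true) (G12 true) S0.
Proof.
move=> hS0; exists (G12 true); first exact: shape_with_G12.
split.
- by apply: isog_dprod_r => //; exact: isog_H1 hS0.
- by apply: isog_dprod_r; [exact: sH12_1 | exact: isog_H12].
- split; first exact: shape_H2_G2.
  have [Y sY iY] := T2_sharp hS0; exists Y => //.
  by rewrite T2X_G; apply: isog_dprod_r iY; exact: sT2H1.
- exact: star_ZX.
- by move=> T /cent_Syl2[g ->]; exact: SP2_er.
Qed.

End Model.

(** * Coset graphs *)

Section GraphGeneral.

Variables (T : finType) (e : rel T).

(** Counts walks from v to x by their first edge. The recursion is linear in the counts at the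
    neighbours, so it descends to orbits of a group fixing x. *)
Fixpoint walks n (x v : T) : nat :=
  if n is m.+1 then (\sum_(u | e v u) walks m x u)%N else (x == v).

Lemma walks_aut n p x v : p \in graph_aut e -> walks n (p x) (p v) = walks n x v.
Proof.
move/graph_autP=> hp; elim: n v => [|n IHn] v /=; first by rewrite (inj_eq perm_inj).
rewrite (reindex_inj (@perm_inj _ p)) /=; apply: eq_big => [u|u _]; first exact: hp.
exact: IHn.
Qed.

Lemma ball1P z v : (v \in ball e 1 z) = (v == z) || e z v.
Proof.
rewrite inE; apply/existsP/orP.
  case=> [[[|[|//]] hk] /existsP[p /andP[pp /eqP <-]]].
    by left; case: p {pp} => [[|//]].
  by right; case: p pp => [[|w [|//]]] //= _; rewrite andbT.
case=> [/eqP->|zv].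
  by exists ord0; apply/existsP; exists [tuple]; rewrite /= eqxx.
by exists (inord 1); rewrite inordK //; apply/existsP; exists [tuple v]; rewrite /= zv eqxx.
Qed.

Lemma graph_aut_nbrs p z : p \in graph_aut e -> #|nbrs e (p z)| = #|nbrs e z|.
Proof.
move/graph_autP=> hp; rewrite -[RHS](card_imset _ (@perm_inj _ p)); apply: eq_card => v.
rewrite inE; apply/idP/imsetP => [zv|[u]].
  by exists (p^-1 v); [rewrite inE -hp permKV | rewrite permKV].
by rewrite inE => zu ->; rewrite hp.
Qed.

(** p z is again a neighbour of y, with the same count from u; when the count singles out z, it is
    fixed. *)
Lemma sep_fix p y u z n : p \in graph_aut e -> p y = y -> p u = u -> e y z ->
  (forall z', e y z' -> walks n u z' = walks n u z -> z' = z) -> p z = z.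
Proof.
move=> hp py pu yz h; apply: h; first by rewrite -{1}py (graph_autP _ _ hp).
by rewrite -{1}pu walks_aut.
Qed.

End GraphGeneral.

(** * Vertices, stabilizers and kernels in a coset graph *)

Section CosetGeneral.

Variables (gT : finGroupType) (K1 K2 : {group gT}).
Hypothesis oK : #|K1| != #|K2|.
Local Notation K := (K1 <*> K2)%G.
Local Notation vertex := (cosetg_vertex K1 K2).
Local Notation adj := (@cosetg_adj gT K1 K2).
Local Notation to := (cosetg_action K1 K2).

Definition side (j : bool) : {group gT} := if j then K2 else K1.

(** Outside K the value is the default [cosetg_x1]; see [val_vtx]. *)
Definition vtx (j : bool) (g : gT) : vertex :=
  insubd (cosetg_x1 K1 K2) (side j :* g).

Lemma sideK j : side j \subset K.
Proof. by case: j; rewrite ?joing_subl ?joing_subr. Qed.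

Lemma val_vtx j g : g \in K -> val (vtx j g) = side j :* g.
Proof.
move=> gK; rewrite /vtx insubdK // inE; case: j => /=.
  by apply/orP; right; apply/rcosetsP; exists g.
by apply/orP; left; apply/rcosetsP; exists g.
Qed.

Lemma vtxP v : exists j, exists2 g, g \in K & v = vtx j g.
Proof.
have := valP v; rewrite inE => /orP[] /rcosetsP[g gK e].
  by exists false; exists g => //; apply: val_inj; rewrite val_vtx.
by exists true; exists g => //; apply: val_inj; rewrite val_vtx.
Qed.

Lemma vtx_eq j g h : g \in K -> h \in K ->
  (vtx j g == vtx j h) = (g * h^-1 \in side j).
Proof.
move=> gK hK; rewrite -val_eqE !val_vtx //.
by apply/eqP/idP => [/rcoset_eqP|h']; [|apply/rcoset_eqP]; rewrite mem_rcoset.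
Qed.

Lemma card_vtx j g : g \in K -> #|val (vtx j g)| = #|side j|.
Proof. by move=> gK; rewrite val_vtx // card_rcoset. Qed.

(** Cosets of K_1 and K_2 have different sizes, so no set is a coset of both and the two sides are
    disjoint. *)
Lemma mem_rcosets_vtx j i g : g \in K ->
  (val (vtx j g) \in rcosets (side i) K) = (i == j).
Proof.
move=> gK; apply/rcosetsP/eqP => [[h hK e]|->]; last by exists g; rewrite ?val_vtx.
have := card_vtx j gK; rewrite e card_rcoset.
by case: i j {e} => [] [] //= /eqP; rewrite ?(negPf oK) // eq_sym (negPf oK).
Qed.

Lemma vtx_side i j g h : g \in K -> h \in K -> vtx i g = vtx j h -> i = j.
Proof.
move=> gK hK e; have := mem_rcosets_vtx j i hK.
by rewrite -e mem_rcosets_vtx // eqxx => /esym/eqP.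
Qed.

Lemma adj_vtx i j g h : g \in K -> h \in K ->
  adj (vtx i g) (vtx j h) = (i != j) && (side i :* g :&: side j :* h != set0).
Proof.
move=> gK hK; rewrite /cosetg_adj.
have := mem_rcosets_vtx i false gK; have := mem_rcosets_vtx i true gK.
have := mem_rcosets_vtx j false hK; have := mem_rcosets_vtx j true hK.
move=> /= -> -> -> ->; rewrite !val_vtx //.
by case: i; case: j; rewrite /= ?andbF ?orbF.
Qed.

Lemma adj_vtxP i j g h : g \in K -> h \in K ->
  reflect (i != j /\ exists2 k, k \in side i & vtx j h = vtx j (k * g))
          (adj (vtx i g) (vtx j h)).
Proof.
move=> gK hK; rewrite adj_vtx //; apply: (iffP andP) => -[ij hx]; split=> //.
  have /set0Pn[x /setIP[/rcosetP[k kK ->] xh]] := hx; exists k => //.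
  have kK' := subsetP (sideK i) _ kK.
  apply/eqP; rewrite eq_sym vtx_eq; [|exact: groupM|by []].
  by rewrite -mem_rcoset.
have [k kK /eqP] := hx; have kK' := subsetP (sideK i) _ kK.
rewrite vtx_eq //; last exact: groupM.
move=> hk; apply/set0Pn; exists (k * g).
by rewrite inE !mem_rcoset mulgK kK -groupV invgM invgK.
Qed.

Lemma act_vtx j g k : g \in K -> k \in K ->
  actperm to k (vtx j g) = vtx j (g * k).
Proof.
move=> gK kK; have dk : k \in act_dom to by apply: subsetP kK; exact: cosetg_acts.
rewrite actpermE; apply: val_inj; rewrite val_vtx ?groupM //= val_subact.
have -> : k \in subact_dom (in_mem^~ (mem (cosetg_vertices K1 K2))) 'Rs by [].
by rewrite [RHS]rcosetM -rcosetE (val_vtx j gK : \val _ = _).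
Qed.

Lemma sub_dom (A : {group gT}) : A \subset K -> A \subset act_dom to.
Proof. by move=> sA; apply: subset_trans sA (cosetg_acts K1 K2). Qed.

Lemma cosetg_permP (A : {group gT}) (p : {perm vertex}) : A \subset K ->
  reflect (exists2 a, a \in A & p = actperm to a) (p \in cosetg_perm K1 K2 A).
Proof.
move=> sA; apply: (iffP idP) => [/morphimP[a _ aA ->]|[a aA ->]]; first by exists a.
by apply: mem_morphim => //; apply: (subsetP (sub_dom sA)).
Qed.

Lemma act_aut k : k \in K -> actperm to k \in graph_aut adj.
Proof.
have imp m u v : m \in K -> adj u v -> adj (actperm to m u) (actperm to m v).
  move=> mK; have [i [g gK ->]] := vtxP u; have [j [h hK ->]] := vtxP v.
  case/adj_vtxP=> // ij [x xK e]; have xK' := subsetP (sideK i) _ xK.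
  rewrite act_vtx // e !act_vtx ?groupM //.
  by apply/adj_vtxP; rewrite ?groupM //; split=> //; exists x; rewrite // mulgA.
move=> kK; apply/graph_autP=> u v; apply/idP/idP; last exact: imp.
have dk : k \in act_dom to by apply: subsetP kK; exact: cosetg_acts.
have kV : k^-1 \in K by rewrite groupV.
move/(imp _ _ _ kV); rewrite morphV //.
by rewrite -!permM mulgV !perm1.
Qed.

Lemma cosetg_perm_sub (A : {group gT}) : A \subset K ->
  cosetg_perm K1 K2 A \subset graph_aut adj.
Proof.
move=> sA; apply/subsetP=> p /(cosetg_permP _ sA)[a aA ->].
by apply: act_aut; apply: (subsetP sA).
Qed.

Lemma x1E : cosetg_x1 K1 K2 = vtx false 1.
Proof. by apply: val_inj; rewrite val_vtx //= mulg1. Qed.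

Lemma x2E : cosetg_x2 K1 K2 = vtx true 1.
Proof. by apply: val_inj; rewrite val_vtx //= mulg1. Qed.

Lemma vstab_vtx (A : {group gT}) j : A \subset K ->
  vstab (cosetg_perm K1 K2 A) (vtx j 1) = (actperm to @* (A :&: side j))%G.
Proof.
move=> sA; apply/val_inj/setP=> p /=; apply/setIP/morphimP.
  case=> /(cosetg_permP _ sA)[a aA ->] /astab1P /= h.
  have aK := subsetP sA _ aA; exists a => //; first exact: (subsetP (sub_dom sA)).
  rewrite inE aA /=; move: h; rewrite /aperm act_vtx // mul1g => /eqP.
  by rewrite vtx_eq // invg1 mulg1.
case=> a da /setIP[aA aj ->]; have aK := subsetP sA _ aA; split.
  by apply/(cosetg_permP _ sA); exists a.
by apply/astab1P; rewrite /= /aperm act_vtx // mul1g; apply/eqP; rewrite vtx_eq // invg1 mulg1.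
Qed.

Lemma nbr_vtxP j g v : g \in K ->
  reflect (exists2 k, k \in side j & v = vtx (~~ j) (k * g)) (adj (vtx j g) v).
Proof.
move=> gK; apply: (iffP idP).
  have [i [h hK ->]] := vtxP v; case/adj_vtxP=> // ji [k kj e]; exists k => //.
  by have -> : ~~ j = i by case: i j ji {kj e} => [] [].
case=> k kj ->; have kK := subsetP (sideK j) _ kj.
by apply/adj_vtxP; rewrite ?groupM //; split; [case: (j) | exists k].
Qed.

(** The hypothesis on [side j] says that the stabilizer in A is transitive on the neighbours. These
    are then cosets of elements of that stabilizer, and fixing them all means lying in every
    conjugate of the stabilizer of the edge. *)
Lemma vkernel_vtx (A : {group gT}) j : A \subset K ->
    side j \subset (side (~~ j) :&: side j) * (A :&: side j) ->
  vkernel adj (cosetg_perm K1 K2 A) (vtx j 1) 1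
    = (actperm to @* gcore (A :&: side j :&: side (~~ j)) (A :&: side j))%G.
Proof.
move=> sA trA; apply/val_inj/setP=> p.
have sAj : A :&: side j \subset K by apply: subset_trans (subsetIl _ _) sA.
have -> : p \in gval (vkernel adj (cosetg_perm K1 K2 A) (vtx j 1) 1) =
    (p \in vstab (cosetg_perm K1 K2 A) (vtx j 1)) &&
    [forall v, adj (vtx j 1) v ==> (p v == v)].
  rewrite inE; apply: andb_id2l => pA; apply/astabP/forallP.
    move=> h v; apply/implyP=> jv; apply/eqP; apply: h.
    by rewrite ball1P jv orbT.
  move=> h v; rewrite ball1P => /orP[/eqP->|jv]; last exact/eqP/(implyP (h v)).
  by case/setIP: pA => _ /astab1P.
rewrite vstab_vtx //; apply/andP/morphimP.
  case=> /morphimP[a da aAj ->] /forallP h; exists a => //.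
  have [aA aj] := setIP aAj; have aK := subsetP sA _ aA.
  rewrite /gcore; apply/bigcapP=> y yAj; have [yA yj] := setIP yAj.
  have yK := subsetP sA _ yA.
  rewrite mem_conjg; have ayAj : a ^ y^-1 \in A :&: side j by rewrite groupJ ?groupV.
  rewrite inE ayAj /=.
  have := implyP (h (vtx (~~ j) y)); rewrite act_vtx //.
  have -> : adj (vtx j 1) (vtx (~~ j) y).
    by apply/nbr_vtxP => //; exists y; rewrite ?mulg1.
  move=> /(_ isT); rewrite (vtx_eq _ (groupM yK aK) yK).
  by rewrite conjgE invgK mulgA.
case=> a da; rewrite /gcore => /bigcapP ha ->.
have := ha 1; rewrite conjsg1 group1 => /(_ isT) /setIP[aAj _].
split; first exact: mem_morphim.
apply/forallP=> v; apply/implyP; case/nbr_vtxP=> // k kj ->; rewrite mulg1.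
have [b y /setIP[bj' bj] yAj ->] := mulsgP (subsetP trA _ kj).
have [yA yj] := setIP yAj; have yK := subsetP sA _ yA.
have bK := subsetP (sideK j) _ bj; have aK := subsetP sAj _ aAj.
have -> : vtx (~~ j) (b * y) = vtx (~~ j) y.
  by apply/eqP; rewrite (vtx_eq _ (groupM bK yK) yK) mulgK.
rewrite act_vtx // (vtx_eq _ (groupM yK aK) yK).
have := ha y yAj; rewrite mem_conjg => /setIP[_].
by rewrite conjgE invgK mulgA.
Qed.

Section Transversals.

Variable ts : bool -> seq gT.
Hypothesis ts_side : forall j, {in ts j, forall t, t \in side j}.
Hypothesis ts_cover : forall j x, x \in side j ->
  exists2 t, t \in ts j & x * t^-1 \in side (~~ j).
Hypothesis ts_uniq : forall j,
  pairwise (fun t t' => t * t'^-1 \notin side (~~ j)) (ts j).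

Lemma nbr_tsP j g v : g \in K ->
  reflect (exists2 t, t \in ts j & v = vtx (~~ j) (t * g)) (adj (vtx j g) v).
Proof.
move=> gK; apply: (iffP (nbr_vtxP _ _ gK)) => -[k kj ->].
  have [t tt h] := ts_cover kj; exists t => //; apply/eqP.
  have tK := subsetP (sideK j) _ (ts_side tt).
  have kK := subsetP (sideK j) _ kj.
  by rewrite (vtx_eq _ (groupM kK gK) (groupM tK gK)) invgM mulgA mulgK.
by exists k => //; apply: ts_side.
Qed.

Lemma uniq_nbrs j g : g \in K -> uniq [seq vtx (~~ j) (t * g) | t <- ts j].
Proof.
move=> gK; rewrite uniq_pairwise pairwise_map.
apply: (sub_in_pairwise (P := mem (ts j))) (ts_uniq j); last exact/allP.
move=> t t' tt tt' /=.
have tK := subsetP (sideK j) _ (ts_side tt).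
have tK' := subsetP (sideK j) _ (ts_side tt').
by rewrite (vtx_eq _ (groupM tK gK) (groupM tK' gK)) invgM mulgA mulgK.
Qed.

Lemma mem_nbrs j g v : g \in K ->
  (v \in [seq vtx (~~ j) (t * g) | t <- ts j]) = adj (vtx j g) v.
Proof.
by move=> gK; apply/mapP/(nbr_tsP _ _ gK) => -[t tt ->]; exists t.
Qed.

Lemma card_nbrs j g : g \in K -> #|nbrs adj (vtx j g)| = size (ts j).
Proof.
move=> gK; rewrite -(size_map (fun t => vtx (~~ j) (t * g))).
rewrite -(card_uniqP (uniq_nbrs j gK)); apply: eq_card => v.
by rewrite inE mem_nbrs.
Qed.

Lemma walks_vtx n x j g : g \in K ->
  walks adj n.+1 x (vtx j g) =
  (\sum_(t <- ts j) walks adj n x (vtx (~~ j) (t * g)))%N.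
Proof.
move=> gK /=; rewrite -(big_map (fun t => vtx (~~ j) (t * g)) xpredT (walks adj n x)).
by rewrite (big_uniq _ (uniq_nbrs j gK)); apply: eq_bigl => v; rewrite mem_nbrs.
Qed.

End Transversals.

Lemma adj_sym : symmetric adj.
Proof.
have imp u v : adj u v -> adj v u.
  have [i [g gK ->]] := vtxP u; have [j [h hK ->]] := vtxP v.
  by rewrite !adj_vtx // eq_sym setIC.
by move=> u v; apply/idP/idP; apply: imp.
Qed.

Lemma core_actperm k : k \in K -> actperm to k = 1 ->
  forall j g, g \in K -> k ^ g^-1 \in side j.
Proof.
move=> kK k1 j g gK; have := act_vtx j gK kK; rewrite k1 perm1 => /eqP.
by rewrite eq_sym (vtx_eq _ (groupM gK kK) gK) conjgE invgK mulgA.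
Qed.

Lemma vstab_conj (A : {group gT}) k v : A \subset K -> k \in A ->
  vstab (cosetg_perm K1 K2 A) (actperm to k v) =
  (vstab (cosetg_perm K1 K2 A) v :^ actperm to k)%G.
Proof.
move=> sA kA; have pk : actperm to k \in cosetg_perm K1 K2 A.
  by apply/(cosetg_permP _ sA); exists k.
apply: val_inj => /=; rewrite conjIg conjGid //.
by rewrite -astab1_act ?in_setT.
Qed.

Lemma ball_aut p i z : p \in graph_aut adj -> ball adj i (p z) = p @: ball adj i z.
Proof.
move=> hp; have /graph_autP pE := hp.
have pathE q x (l : seq vertex) : q \in graph_aut adj ->
    path adj (q x) (map q l) = path adj x l.
  move/graph_autP=> qE; elim: l x => //= y l IHl x; by rewrite qE IHl.
have sub q x v : q \in graph_aut adj -> v \in ball adj i x -> q v \in ball adj i (q x).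
  move=> hq; rewrite inE => /existsP[k /existsP[l /andP[xl /eqP <-]]].
  rewrite inE; apply/existsP; exists k; apply/existsP; exists (map_tuple q l).
  by apply/andP; split; [rewrite pathE | rewrite last_map].
apply/setP=> v; apply/idP/imsetP=> [vb|[u ub ->]]; last exact: sub.
exists (p^-1 v); last by rewrite permKV.
by have := sub p^-1 (p z) v; rewrite permK groupV; apply.
Qed.

Lemma vkernel_conj (A : {group gT}) k v i : A \subset K -> k \in A ->
  vkernel adj (cosetg_perm K1 K2 A) (actperm to k v) i =
  (vkernel adj (cosetg_perm K1 K2 A) v i :^ actperm to k)%G.
Proof.
move=> sA kA; have kK := subsetP sA _ kA.
have /(congr1 val) /= e := vstab_conj v sA kA.
apply: val_inj => /=; rewrite (ball_aut _ _ (act_aut kK)) conjIg e.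
by congr (_ :&: _); rewrite -astab_setact ?in_setT.
Qed.

End CosetGeneral.

(** * The local structure of Delta *)

Definition tsr (j : bool) := if j then ts2 else ts1.
Definition LXr := pcseq [:: (gr, 3)].
Definition LG1 := lprod (lprod L12 ts1) LXr.
Definition LG2 := lprod (lprod L12 ts2) LXr.
Definition LG (j : bool) := if j then LG2 else LG1.
Definition memG j x := memb (LG j) x.

Lemma LGE j : LG j = lprod (lprod L12 (tsr j)) LXr. Proof. by case: j. Qed.

Section Graph.

Variables (gT : finGroupType) (P : crep -> gT).
Hypothesis mP : model P.
Let P1 := model1 mP.
Let PM := modelM mP.
Let PV := modelV mP.
Local Notation vlist L := {in L, forall x, valid x}.
Local Notation r := (P gr).
Local Notation K1 := (G1 P true).
Local Notation K2 := (G2 P true).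
Local Notation side := (side K1 K2).
Definition KK : {group gT} := (K1 <*> K2)%G.
Definition HH : {group gT} := (H1 P <*> H2 P)%G.
Definition AA k : {group gT} := (HH <*> Xr P k)%G.
Definition GG j k : {group gT} := if j then G2 P k else G1 P k.
Hypothesis rHH : r \notin HH.

Lemma side_GG j : side j = GG j true. Proof. by case: j. Qed.

Lemma card_Xtrue : #|Xr P true| = 3. Proof. exact: order_r. Qed.

Lemma card_neq : #|K1| != #|K2|.
Proof. by rewrite (card_G1 mP) (card_G2 mP) card_Xtrue. Qed.

Lemma sH_GG j k : (if j then H2 P else H1 P) \subset GG j k.
Proof. by case: j; exact: joing_subl. Qed.

Lemma Xr_sub k : Xr P k \subset Xr P true.
Proof. by case: k; rewrite ?sub1G. Qed.

Lemma GG_AA j k : GG j k \subset AA k.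
Proof.
case: j; rewrite join_subG joing_subr andbT.
  exact: subset_trans (joing_subr _ _) (joing_subl _ _).
exact: subset_trans (joing_subl _ _) (joing_subl _ _).
Qed.

Lemma AA_true : AA true = KK.
Proof.
apply/val_inj/eqP; rewrite eqEsubset; apply/andP; split; last first.
  by rewrite join_subG (GG_AA false true) (GG_AA true true).
have s1 : K1 \subset KK by exact: joing_subl.
have s2 : K2 \subset KK by exact: joing_subr.
rewrite !join_subG (subset_trans (joing_subl _ _) s1) (subset_trans (joing_subl _ _) s2).
exact: subset_trans (joing_subr _ _) s1.
Qed.

Lemma AA_false : AA false = HH. Proof. by apply: val_inj; rewrite /= joingG1. Qed.

Lemma AA_sub k : AA k \subset KK.
Proof. by rewrite -AA_true genS ?setUS ?Xr_sub. Qed.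

Lemma X_norm_HH : Xr P true \subset 'N(HH).
Proof.
rewrite normsY //; last exact: X_norm_H2.
by apply: cents_norm; exact: X_cent_H1.
Qed.

Lemma KK_mul : KK = Xr P true * HH :> {set gT}.
Proof. by rewrite -AA_true (normC X_norm_HH) /= norm_joinEr ?X_norm_HH. Qed.

Lemma HH_X : HH :&: Xr P true = 1. Proof. exact: X_TI. Qed.

(** For H this is the modular law: K_j = H_j X, and X meets H trivially because r is not in H. *)
Lemma AA_side k j : AA k :&: side j = GG j k.
Proof.
rewrite side_GG; case: k.
  by apply/setIidPr; exact: GG_AA.
rewrite AA_false; have e : HH :&: GG j true = if j then H2 P else H1 P.
  have sH : (if j then H2 P else H1 P) \subset HH.
    by case: j; rewrite ?joing_subl ?joing_subr.
  have -> : GG j true = (if j then H2 P else H1 P) * Xr P true :> {set gT}.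
    by case: j {sH}; [exact: G2_mul | exact: X_mul].
  by rewrite setIC -group_modl // [Xr _ _ :&: _]setIC HH_X mulg1.
by rewrite e; case: j {e} => /=; rewrite joingG1.
Qed.

Lemma GG_side j k : GG j k :&: side (~~ j) = G12 P k.
Proof.
have e12 := meet_G1_G2 mP true.
case: k; last first.
  have -> : G12 P false = H12 P by apply: val_inj; rewrite /= joingG1.
  have -> : GG j false = (if j then H2 P else H1 P) :> {set gT}.
    by case: (j) => /=; rewrite joingG1.
  case: (j); rewrite /=.
    rewrite -(meet_G12_H2 mP true) /= -[gval (G12 P true)]e12 -setIA setIC.
    by congr (_ :&: _); apply/esym/setIidPr; exact: joing_subl.
  rewrite -(meet_G12_H1 mP true) /= -[gval (G12 P true)]e12 setIAC.
  by congr (_ :&: _); apply/esym/setIidPr; exact: joing_subl.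
by case: (j); rewrite /= ?[K2 :&: K1]setIC; exact: e12.
Qed.

(** sigma^2 fixes the base edge, so H_j has the same orbits as K_j on the neighbours of the base
    vertex. *)
Lemma side_trans j k : side j \subset (side (~~ j) :&: side j) * (AA k :&: side j).
Proof.
rewrite AA_side setIC side_GG GG_side; case: k.
  by rewrite mulSGid ?mulg_subr //; case: (j); [exact: sG12_2 | exact: sG12_1].
have -> : GG j true = Xr P true * (if j then H2 P else H1 P) :> {set gT}.
  case: (j).
    by apply: etrans (G2_mul mP true) _; apply/esym/normC; exact: X_norm_H2.
  apply: etrans (X_mul mP true (subxx _)) _; apply/esym/normC.
  by apply: cents_norm; exact: X_cent_H1.
apply: mulgSS; first exact: joing_subr.
by case: (j); rewrite /= joingG1.
Qed.

Definition tsP j := map P (tsr j).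

Lemma vtsr j : vlist (tsr j). Proof. by case: j; [exact: vts2 | exact: vts1]. Qed.

Lemma tsP_side j : {in tsP j, forall t, t \in side j}.
Proof.
move=> _ /mapP[t tt ->]; rewrite side_GG; apply: (subsetP (sH_GG j true)).
by case: j tt; [exact: ts2_H2 | exact: ts1_H1].
Qed.

Lemma tsP_cover j x : x \in side j ->
  exists2 t, t \in tsP j & x * t^-1 \in side (~~ j).
Proof.
move=> xj; have [t tt h] : exists2 t, t \in tsr j & x * (P t)^-1 \in G12 P true.
  by case: j xj; [exact: G2_cover | exact: G1_cover].
exists (P t); first exact: map_f.
by move: h; rewrite -(GG_side j true) => /setIP[].
Qed.

Lemma coset_uniqP L ts (A : {set gT}) : vlist L -> vlist ts ->
    (forall x, valid x -> P x \in A -> memb L x) -> coset_uniq L ts ->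
  pairwise (fun t t' => t * t'^-1 \notin A) (map P ts).
Proof.
move=> vL vt hA; elim: ts vt => //= t ts IHt vt /andP[/allP nt ut].
have vt' : vlist ts by move=> y Ly; apply: vt; rewrite inE Ly orbT.
rewrite IHt // andbT; apply/allP=> _ /mapP[t' tt' ->].
have [v1 v2] := (vt t (mem_head _ _), vt' _ tt').
have v3 : valid (cmul t (cinv t')) by apply: cspanM => //; exact: cspanV.
apply: contra (nt _ tt') => h; apply: hA => //.
by rewrite PM ?PV //; exact: cspanV.
Qed.

Lemma tsP_uniq j : pairwise (fun t t' => t * t'^-1 \notin side (~~ j)) (tsP j).
Proof.
have cu : coset_uniq L12 (tsr j) by case: (j); vm_compute.
have hA x : valid x -> P x \in H12 P -> memb L12 x.
  by move=> vx; rewrite (H12_E mP) (membE mP vL12 vx).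
have := coset_uniqP (A := H12 P) vL12 (@vtsr j) hA cu.
move=> pw; apply: (sub_in_pairwise (P := mem (tsP j))) pw; last exact/allP.
move=> t t' tt tt' /=; apply: contra => h.
have hj : t * t'^-1 \in (if j then H2 P else H1 P).
  have tH u : u \in tsP j -> u \in (if j then H2 P else H1 P).
    by case/mapP=> v vv ->; case: (j) vv; [exact: ts2_H2 | exact: ts1_H1].
  by rewrite groupM ?groupV ?tH.
have h12 : t * t'^-1 \in G12 P true.
  by rewrite -(GG_side j true) inE h andbT (subsetP (sH_GG j true)).
case: (j) hj => hj; first by rewrite -(meet_G12_H2 mP true) inE h12.
by rewrite -(meet_G12_H1 mP true) inE h12.
Qed.

Lemma vLXr : vlist LXr. Proof. by apply: vlist_pcseq; vlist_tac. Qed.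

Lemma LXr_E : Xr P true = pset P LXr :> {set gT}.
Proof.
have <- : grp P (unzip1 [:: (gr, 3)]) = pset P LXr :> {set gT}.
  by apply: (grp_pcseq mP); [vlist_tac | vm_compute].
by rewrite /= pset1.
Qed.

Lemma pset_lprod L M : vlist L -> vlist M ->
  pset P (lprod L M) = pset P L * pset P M.
Proof.
move=> vL vM; apply/setP=> y; apply/psetP/mulsgP.
  case=> _ /allpairsP[[x z] [/= Lx Mz ->]] ->.
  exists (P x) (P z); rewrite ?mem_pset // PM //; [exact: vL | exact: vM].
case=> _ _ /psetP[x Lx ->] /psetP[z Mz ->] ->.
exists (cmul x z); first by apply/allpairsP; exists (x, z).
by rewrite PM //; [exact: vL | exact: vM].
Qed.

Lemma LG_E j : side j = pset P (LG j) :> {set gT}.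
Proof.
have vt := @vtsr j; have v1 := vlist_lprod vL12 vt.
rewrite LGE (pset_lprod v1 vLXr) -LXr_E.
have -> : pset P (lprod L12 (tsr j)) = (if j then H2 P else H1 P).
  apply/setP=> x; apply/psetP/idP => [[y]|].
    case/allpairsP=> -[u t] [/= Lu tt ->] ->; rewrite PM; [|exact: vL12|exact: vt].
    have uH : P u \in H12 P by rewrite (H12_E mP) mem_pset.
    rewrite groupM //.
      by case: (j); apply: subsetP uH; [exact: sH12_2 | exact: sH12_1].
    by case: (j) tt; [exact: ts2_H2 | exact: ts1_H1].
  by case: (j); [exact: H2_list | exact: H1_list].
by case: j {vt v1}; [exact: G2_mul | exact: X_mul].
Qed.

Lemma vLG j : vlist (LG j).
Proof. rewrite LGE; exact: vlist_lprod (vlist_lprod vL12 (@vtsr j)) vLXr. Qed.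

Lemma memGE j x : valid x -> (P x \in side j) = memG j x.
Proof. by move=> vx; rewrite LG_E (membE mP (@vLG j)). Qed.

Lemma gen_KK x : cgen x -> P x \in KK.
Proof.
move=> cx; have s1 j : side j \subset KK by case: j; rewrite ?joing_subl ?joing_subr.
have [j hj] : exists j, memG j x.
  by case: cx; solve [exists false; vm_compute; reflexivity
                     |exists true; vm_compute; reflexivity].
by apply: (subsetP (s1 j)); rewrite memGE //; exact: cspan_gen.
Qed.

Lemma valid_KK x : valid x -> P x \in KK.
Proof.
elim=> {x} [|x|x y vx hx vy hy|x vx hx].
- by rewrite P1.
- exact: gen_KK.
- by rewrite PM ?groupM.
- by rewrite PV ?groupV.
Qed.

(* An element of the kernel of the action on the cosets lies in T1 X, and its  *)
(* conjugate by this word remains in K_2: only the identity does both.         *)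
Definition core_word := let w := cmul gd ge in cmul w (cmul w w).

Lemma faithful_KK x : x \in KK ->
  (forall j g, g \in KK -> x ^ g^-1 \in side j) -> x = 1.
Proof.
move=> xK hx; have vw : valid core_word by valid_tac.
have xT : x \in T1 P <*> Xr P true.
  rewrite -(gcore_G1 mP); apply/bigcapP=> g gK1; rewrite mem_conjg.
  have gK : g \in KK by apply: (subsetP (joing_subl _ _)).
  by rewrite -(GG_side false true) inE (hx false) //= (hx true).
have eX : T1 P <*> Xr P true = T1 P * Xr P true := X_mul mP true (sT1H1 mP).
move: xT; rewrite eX LXr_E (T1_E mP) -(pset_lprod vLT1 vLXr).
case/psetP=> y Ly ex; have vy := vlist_lprod vLT1 vLXr Ly.
rewrite ex -P1; apply/eqP; rewrite (modelE mP) //; last exact: cspan1.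
have vwy : valid (cmul core_word y) by exact: cspanM.
have : memG true (cmul (cmul core_word y) (cinv core_word)).
  rewrite -memGE; last by apply: cspanM => //; exact: cspanV.
  have vV := cspanV vw; have := hx true _ (valid_KK vw).
  by rewrite ex conjgE invgK mulgA -PV // -PM // -PM.
apply/implyP; move: y Ly {vy vwy ex}; apply/allP; vm_compute; reflexivity.
Qed.

End Graph.

Section Local.

Variables (gT : finGroupType) (P : crep -> gT).
Hypothesis mP : model P.
Let P1 := model1 mP.
Let PM := modelM mP.
Let PV := modelV mP.
Local Notation vlist L := {in L, forall x, valid x}.
Local Notation r := (P gr).
Local Notation K1 := (G1 P true).
Local Notation K2 := (G2 P true).
Local Notation side := (side K1 K2).
Local Notation KK := (KK P).
Local Notation HH := (HH P).
Local Notation AA := (AA P).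
Local Notation GG := (GG P).
Local Notation adj := (@cosetg_adj gT K1 K2).
Local Notation to := (cosetg_action K1 K2).
Local Notation pi := (actperm to).
Local Notation vtx := (@vtx gT K1 K2).
Local Notation perm_of A := (cosetg_perm K1 K2 A).
Hypothesis rHH : r \notin HH.
Let oK : #|K1| != #|K2| := card_neq mP.

Lemma ker_act x : x \in KK -> pi x = 1 -> x = 1.
Proof. by move=> xK x1; apply: (faithful_KK mP xK) => j g; apply: core_actperm. Qed.

Lemma faithful_act : [faithful KK, on [set: cosetg_vertex K1 K2] | to].
Proof.
apply/subsetP=> x /setIP[xK hx]; rewrite inE; apply/eqP/ker_act => //.
by apply/permP=> v; rewrite perm1 actpermE (astab_act hx) ?inE.
Qed.

Lemma dom_act x : x \in KK -> x \in act_dom to.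
Proof. by move=> xK; apply: (subsetP (cosetg_acts K1 K2)). Qed.

Definition Pact x := pi (P x).

(** Faithfulness of K makes the passage to permutations injective, so everything proved in a model
    applies to the stabilizers as permutation groups. *)
Lemma model_act : model Pact.
Proof.
have dP x : valid x -> P x \in act_dom to by move=> vx; apply/dom_act/(valid_KK mP).
split=> [|x y vx vy|x vx|x y vx vy].
- by rewrite /Pact P1 morph1.
- by rewrite /Pact PM // morphM ?dP.
- by rewrite /Pact PV // morphV ?dP.
- rewrite -(modelE mP) //; apply/eqP/eqP => [e|e]; last by rewrite /Pact e.
  apply/eqP; rewrite eq_mulgV1; apply/eqP/ker_act.
    by rewrite groupM ?groupV ?(valid_KK mP).
  have dy := dP _ vy; rewrite morphM ?dP ?groupV // morphV //.
  by apply/eqP; rewrite -eq_mulgV1; apply/eqP.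
Qed.

Lemma grp_act L : vlist L -> grp Pact L = (pi @* grp P L)%G.
Proof.
move=> vL; have sL : pset P L \subset act_dom to.
  by apply/subsetP=> _ /psetP[x Lx ->]; apply/dom_act/(valid_KK mP)/vL.
apply: val_inj; rewrite /= morphim_gen //; congr <<_>>.
rewrite morphimEsub //; apply/setP=> y; apply/psetP/imsetP=> [[x Lx ->]|[_ /psetP[x Lx ->] ->]].
  by exists (P x); rewrite ?mem_pset.
by exists x.
Qed.

Lemma Xr_act k : Xr Pact k = (pi @* Xr P k)%G.
Proof.
case: k; apply: val_inj; rewrite /= ?morphim1 // morphim_cycle //.
by apply/dom_act/(valid_KK mP); valid_tac.
Qed.

Lemma join_act (A B : {group gT}) : A \subset KK -> B \subset KK ->
  (pi @* A <*> pi @* B)%G = (pi @* (A <*> B))%G.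
Proof.
by move=> sA sB; apply: val_inj; rewrite /= morphimY //; apply: sub_dom.
Qed.

Lemma sX_KK k : Xr P k \subset KK.
Proof. by rewrite -(AA_true P) (subset_trans (Xr_sub P k)) ?joing_subr. Qed.

Lemma grp_KK L : vlist L -> grp P L \subset KK.
Proof.
by move=> vL; rewrite gen_subG; apply/subsetP=> _ /psetP[x Lx ->]; apply/(valid_KK mP)/vL.
Qed.

Lemma joinX_act L k : vlist L ->
  (grp Pact L <*> Xr Pact k)%G = (pi @* (grp P L <*> Xr P k))%G.
Proof. by move=> vL; rewrite grp_act // Xr_act join_act ?sX_KK ?grp_KK. Qed.

Lemma vstab_base k j :
  vstab (perm_of (AA k)) (vtx j 1) = if j then G2 Pact k else G1 Pact k.
Proof.
rewrite vstab_vtx ?AA_sub //.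
have -> : (AA k :&: side j)%G = GG j k by apply: val_inj; exact: AA_side.
by case: j; rewrite -joinX_act //; [exact: vgens2 | exact: vgens1].
Qed.

Lemma vkernel_base k j :
  vkernel adj (perm_of (AA k)) (vtx j 1) 1 =
  if j then (T2 Pact <*> Xr Pact k)%G else (T1 Pact <*> Xr Pact k)%G.
Proof.
have core : gcore (AA k :&: side j :&: side (~~ j)) (AA k :&: side j) =
    (if j then T2 P <*> Xr P k else T1 P <*> Xr P k)%G.
  rewrite (AA_side mP rHH) GG_side //.
  by case: j; [exact: (gcore_G2 mP k) | exact: (gcore_G1 mP k)].
apply: val_inj; rewrite (vkernel_vtx oK) ?AA_sub ?side_trans //= core.
case: j {core}; last first.
  by rewrite [in RHS](@joinX_act (unzip1 pcT1)) //; vlist_tac.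
by rewrite [in RHS](@joinX_act (unzip1 pcT2)) //; vlist_tac.
Qed.

Lemma vstab_inter k :
  (vstab (perm_of (AA k)) (vtx false 1) :&: vstab (perm_of (AA k)) (vtx true 1))%G
    = G12 Pact k.
Proof. by rewrite !vstab_base; apply: val_inj; exact: meet_G1_G2 model_act k. Qed.

Lemma cent_base k j :
  'C_(vstab (perm_of (AA k)) (vtx j 1))('O_3(vkernel adj (perm_of (AA k)) (vtx j 1) 1))
    \subset 'O_3(vkernel adj (perm_of (AA k)) (vtx j 1) 1).
Proof.
have m' := model_act; rewrite vstab_base vkernel_base; case: j.
  by rewrite (pcore_T2X m'); exact: cent_SX.
by rewrite (pcore_T1X m'); exact: cent_VX.
Qed.

(** sigma^2 lies in both K_1 and K_2, so H is transitive on each side just as K is. *)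
Lemma vtx_HH v : exists j, exists2 h, h \in HH & v = pi h (vtx j 1).
Proof.
have [j [g gK ->]] := vtxP v; exists j.
have: g \in gval KK by []; rewrite (KK_mul mP) => /mulsgP[x h xX hH ->].
have hK : h \in KK by apply: (subsetP (AA_sub P false)); rewrite AA_false.
have xj : x \in side j.
  by rewrite side_GG; case: (j); apply: subsetP xX; exact: joing_subr.
have xK := subsetP (sideK _ _ j) _ xj.
exists h => //; rewrite act_vtx // mul1g; apply/eqP.
by rewrite (vtx_eq _ (groupM xK hK) hK) mulgK.
Qed.

Lemma HH_AA k : HH \subset AA k.
Proof. exact: joing_subl. Qed.

Lemma local_char k : local_characteristic adj (perm_of (AA k)) 3.
Proof.
move=> v; have [j [h hH ->]] := vtx_HH v; have hA := subsetP (HH_AA k) _ hH.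
rewrite (vstab_conj _ (AA_sub P k) hA) (vkernel_conj oK _ _ (AA_sub P k) hA).
by rewrite /= pcoreJ centJ -conjIg conjSg; exact: cent_base.
Qed.

Lemma adj_base : adj (vtx false 1) (vtx true 1).
Proof. by apply/(nbr_vtxP oK) => //; exists 1; rewrite ?group1 ?mulg1. Qed.

Lemma pushing_up k : pushing_up_type adj (perm_of (AA k)) 3 (vtx false 1) (vtx true 1).
Proof.
split; [exact: adj_base | exact: local_char |].
have m' := model_act; rewrite !vkernel_base /= (pcore_T2X m') (pcore_T1X m').
by rewrite genS ?setSU // grpS //; apply/allP.
Qed.

Lemma card_nbrs_base j : #|nbrs adj (vtx j 1)| = if j then 3 else 4.
Proof.
have := card_nbrs oK (tsP_side mP) (tsP_cover mP) (tsP_uniq mP) j (group1 _).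
by move=> ->; rewrite size_map; case: j.
Qed.

Lemma shape_D2_HH S0 : S0 \in 'Syl_3(AGL3 2) -> let A := perm_of HH in
  shape_D2 (vstab A (vtx false 1)) (vstab A (vtx true 1))
    (vstab A (vtx false 1) :&: vstab A (vtx true 1))%G S0.
Proof.
by move=> hS /=; rewrite -AA_false vstab_inter !vstab_base; apply: shape_D2_model model_act _ _.
Qed.

Lemma shape_E2_KK S0 : S0 \in 'Syl_3(AGL3 2) -> let A := perm_of KK in
  shape_E2 (vstab A (vtx false 1)) (vstab A (vtx true 1))
    (vstab A (vtx false 1) :&: vstab A (vtx true 1))%G S0.
Proof.
by move=> hS /=; rewrite -AA_true vstab_inter !vstab_base; apply: shape_E2_model model_act _ _.
Qed.

End Local.

(** * Arc transitivity *)

Section ArcGeneral.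

Variables (T : finType) (e : rel T).
Implicit Types (z v : T) (y l : seq T) (G : {group {perm T}}).

(** The induction step of arc transitivity, relative to a base arc Y. At i = 0 there is no previous
    vertex to avoid. *)
Definition arc_step G (Y : nat -> T) i := forall v, e (Y i) v ->
  (0 < i -> v != Y i.-1) ->
  exists2 g, g \in G & (forall m, m <= i -> g (Y m) = Y m) /\ g (Y i.+1) = v.

Lemma nonbacktrackingP z y :
  reflect (forall i, i.+2 < size y -> nth z y i != nth z y i.+2) (nonbacktracking y).
Proof.
elim: y => [|a [|b [|c y]] IHy] /=; do ?[by constructor=> -[]].
apply: (iffP andP) => [[ac /IHy h] [|i] // hi|h]; first exact: (h i).
by split; [exact: (h 0) | apply/IHy=> i hi; exact: (h i.+1)].
Qed.

Lemma arcP s z l : arc_from e s z l ->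
  [/\ size l = s, forall i, i < s -> e (nth z (z :: l) i) (nth z (z :: l) i.+1)
    & forall i, i.+1 < s -> nth z (z :: l) i != nth z (z :: l) i.+2].
Proof.
case/and3P=> /eqP <- /(pathP z) pl /(nonbacktrackingP z) nl.
by split=> // i hi; apply: nl.
Qed.

Lemma arc_partial G Y s l n : G \subset graph_aut e -> arc_from e s (Y 0) l ->
    n <= s -> (forall i, i < n -> arc_step G Y i) ->
  exists2 g, g \in G & forall m, m <= n -> g (Y m) = nth (Y 0) (Y 0 :: l) m.
Proof.
move=> sG /arcP[sl pl nl]; elim: n => [|n IHn] lt_ns hs.
  by exists 1 => // -[|//] _; rewrite perm1.
have [g gG hg] := IHn (ltnW lt_ns) (fun i hi => hs i (ltnW hi)).
have /graph_autP autg := subsetP sG _ gG.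
(* Pulled back by g, the next vertex of l is a continuation of the base arc. *)
have [|n0|h hG [h1 h2]] := hs n (leqnn _) (g^-1 (nth (Y 0) (Y 0 :: l) n.+1)).
- by rewrite -autg permKV hg //; exact: pl.
- rewrite -(inj_eq (@perm_inj _ g)) permKV hg ?leq_pred // eq_sym.
  by have := nl n.-1; rewrite prednK //; apply.
exists (h * g); first exact: groupM.
move=> m; rewrite leq_eqVlt => /predU1P[->|hm]; first by rewrite permM h2 permKV.
by rewrite permM h1 // hg.
Qed.

Lemma arc_trans G Y s : G \subset graph_aut e ->
  (forall i, i < s -> arc_step G Y i) -> arc_transitive_from e G s (Y 0).
Proof.
move=> sG st l l' hl hl'.
have [g gG eg] := arc_partial sG hl (leqnn s) st.
have [g' gG' eg'] := arc_partial sG hl' (leqnn s) st.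
have [[sl _ _] [sl' _ _]] := (arcP hl, arcP hl').
have /= e0 := eg 0 (leq0n _); have /= e0' := eg' 0 (leq0n _).
exists (g^-1 * g').
  rewrite inE groupM ?groupV //=; apply/astab1P; rewrite /= /aperm permM.
  by rewrite -{1}e0 permK.
apply: (@eq_from_nth _ (Y 0)); rewrite ?size_map ?sl ?sl' // => i hi.
rewrite (nth_map (Y 0)) ?sl // permM.
by have := eg i.+1 hi => /= <-; rewrite permK; exact: (eg' i.+1).
Qed.

Lemma arc_from_aut p s z l : p \in graph_aut e ->
  arc_from e s z l -> arc_from e s (p z) (map p l).
Proof.
move=> /graph_autP autp /arcP[sm pm nm].
have mE i : i <= s -> nth (p z) (p z :: map p l) i = p (nth z (z :: l) i).
  by case: i => [|i] hi //=; rewrite (nth_map z) ?sm.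
apply/and3P; split; first by rewrite size_map sm.
  apply/(pathP (p z))=> i; rewrite size_map sm => hi.
  rewrite (mE i (ltnW hi)); have /= -> := mE i.+1 hi.
  by rewrite autp; exact: pm.
apply/(nonbacktrackingP (p z))=> i; rewrite /= size_map sm => hi.
have hi' : i <= s by exact: ltnW (ltnW hi).
by rewrite (mE i hi'); have /= -> := mE i.+2 hi; rewrite (inj_eq perm_inj) nm.
Qed.

Lemma arc_trans_conj G s z g : g \in G -> G \subset graph_aut e ->
  arc_transitive_from e G s z -> arc_transitive_from e G s (g z).
Proof.
move=> gG sG tr l l' hl hl'; have gV : g^-1 \in G by rewrite groupV.
have pull m : arc_from e s (g z) m -> arc_from e s z (map g^-1 m).
  by move/(arc_from_aut (subsetP sG _ gV)); rewrite permK.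
have [h /setIP[hG /astab1P hz] eh] := tr _ _ (pull _ hl) (pull _ hl').
rewrite /= /aperm in hz; exists (g^-1 * h * g).
  have gG' : g^-1 * h * g \in G by rewrite groupM // groupM.
  by rewrite inE gG' /=; apply/astab1P; rewrite /= /aperm !permM permK hz.
have := congr1 (map g) eh; rewrite -!map_comp => e'.
rewrite -[RHS]map_id -[RHS](@eq_map _ _ (g \o g^-1)) => [|x]; last by rewrite /= permKV.
by rewrite -e'; apply: eq_map => x; rewrite /= !permM.
Qed.

Lemma arc_step_ext G Y Y' i : (forall m, m <= i.+1 -> Y m = Y' m) ->
  arc_step G Y i -> arc_step G Y' i.
Proof.
move=> eY st v; rewrite -(eY i) // => av nb.
have [i0|g gG [fx mv]] := st v av; first by rewrite eY ?nb // (leq_trans (leq_pred _)).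
exists g => //; split=> [m hm|]; last by rewrite -eY.
by rewrite -eY ?fx // (leq_trans hm).
Qed.

End ArcGeneral.

Definition cconjw w h := cmul (cmul w h) (cinv w).

(* y_i is the vertex given by the i-th word of ws; the words hs provide        *)
(* elements that fix y_0, .., y_i and send y_(i+1) to each of the other        *)
(* continuations. The coset of ts given by cone is the vertex y_(i-1).         *)
Definition step_ok j0 ws hs i :=
  let w := nth cone ws i in let j := j0 (+) odd i in
  ((i == 0) || memG (~~ j) (cmul (nth cone ws i.-1) (cinv w))) &&
  all (fun t => has (fun h =>
      all (fun m => memG (j0 (+) odd m) (cconjw (nth cone ws m) h)) (iota 0 i.+1) &&
      memG (~~ j) (cmul (cmul (nth cone ws i.+1) h) (cinv (cmul t w)))) hs)
    (if i is 0 then tsr j else behead (tsr j)).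

(** sigma^2 is left out, so that these words evaluate into H. *)
Definition hgens := [:: ga; gb; gc; gd; ge; gf; gt].
Notation hvalid := (cspan (fun x => x \in hgens)).
(** Successive vertices are cosets of t_1, t_2 t_1, and so on, alternately on the two sides; an
    initial [cone] in ts is the step across the base edge. *)
Definition arc_words ts := cone :: scanl (fun w t => cmul t w) cone ts.
Definition path2 := arc_words [:: cone; gd; ge; gd; ge; gd].
Definition path1 := arc_words [:: cone; ge; gd; ge; gd].
(** One list for each step. Their sizes multiply to 324 = |H_2|, and in [hs1] to 144 = |H_1| / 3. *)
Definition hs2 := [:: [:: cone; ge; gee]; [:: cone; gc; cmul gc gc]; [:: cone; gf];
  [:: cone; gb; cmul gb gb]; [:: cone; gt]; [:: cone; ga; cmul ga ga]].
Definition hs1 := [:: ts1; [:: cone; gt];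
  [:: cone; gc; cmul gc gc]; [:: cone; gft]; [:: cone; gb; cmul gb gb]].

Lemma hvalid_valid x : hvalid x -> valid x.
Proof.
apply: cspan_sub => y; rewrite !inE.
by do 6?[case/predU1P=> [->|]]; last move/eqP->; apply: cspan_gen; constructor.
Qed.

Section Arcs.

Variables (gT : finGroupType) (P : crep -> gT).
Hypothesis mP : model P.
Let P1 := model1 mP.
Let PM := modelM mP.
Let PV := modelV mP.
Local Notation vlist L := {in L, forall x, valid x}.
Local Notation K1 := (G1 P true).
Local Notation K2 := (G2 P true).
Local Notation side := (side K1 K2).
Local Notation KK := (KK P).
Local Notation HH := (HH P).
Local Notation AA := (AA P).
Local Notation adj := (@cosetg_adj gT K1 K2).
Local Notation pi := (actperm (cosetg_action K1 K2)).
Local Notation vtx := (@vtx gT K1 K2).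
Local Notation perm_of A := (cosetg_perm K1 K2 A).
Let oK : #|K1| != #|K2| := card_neq mP.

Definition word_vtx j x := vtx j (P x).

Lemma nbr_wvtxP j x v : valid x ->
  reflect (exists2 t, t \in tsr j & v = word_vtx (~~ j) (cmul t x)) (adj (word_vtx j x) v).
Proof.
move=> vx; have vt := @vtsr j.
apply: (iffP (nbr_tsP oK (tsP_side mP) (tsP_cover mP) _ _ (valid_KK mP vx))).
  by case=> _ /mapP[t tt ->] ->; exists t; rewrite // /word_vtx PM //; exact: vt.
case=> t tt ->; exists (P t); first exact: map_f.
by rewrite /word_vtx PM //; exact: vt.
Qed.

Lemma wvtx_eq j x y : valid x -> valid y ->
  (word_vtx j x == word_vtx j y) = memG j (cmul x (cinv y)).
Proof.
move=> vx vy; have vV := cspanV vy.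
rewrite [LHS](vtx_eq _ (valid_KK mP vx) (valid_KK mP vy)) -PV // -PM //.
by rewrite (memGE mP) //; exact: cspanM.
Qed.

Lemma act_wvtx j x h : valid x -> valid h -> pi (P h) (word_vtx j x) = word_vtx j (cmul x h).
Proof. by move=> vx vh; rewrite /word_vtx act_vtx ?(valid_KK mP) // PM. Qed.

Lemma act_wvtx_eq j x y h : valid x -> valid y -> valid h ->
  (pi (P h) (word_vtx j x) == word_vtx j y) = memG j (cmul (cmul x h) (cinv y)).
Proof. by move=> vx vy vh; rewrite act_wvtx // wvtx_eq //; exact: cspanM. Qed.

Definition base_arc j0 ws m := word_vtx (j0 (+) odd m) (nth cone ws m).

Lemma valid_nth ws i : vlist ws -> valid (nth cone ws i).
Proof.
move=> vw; have [lt|ge] := ltnP i (size ws); first by apply/vw/mem_nth.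
by rewrite nth_default //; exact: cspan1.
Qed.

Lemma step_okP k j0 ws hs i : vlist ws -> vlist hs ->
    {in hs, forall h, P h \in AA k} -> step_ok j0 ws hs i ->
  arc_step adj (perm_of (AA k)) (base_arc j0 ws) i.
Proof.
move=> vw vh hA /andP[back /allP ok] v; have vN m := valid_nth m vw.
case/nbr_wvtxP=> // t tt -> nb.
have vt : valid t := vtsr tt.
(* The identity representative would lead back to the previous vertex. *)
have tt' : t \in (if i is 0 then tsr (j0 (+) odd i) else behead (tsr (j0 (+) odd i))).
  case: i back tt nb {ok} => // i /=; set w := nth _ _ _; set w' := nth _ _ _.
  set j := j0 (+) _ => back tt nb.
  have: t != cone.
    apply: contraTneq (nb isT) => ->; rewrite negbK /base_arc eq_sym.
    have -> : j0 (+) odd i = ~~ j by rewrite /j /=; case: (j0); case: (odd i).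
    have -> : word_vtx (~~ j) (cmul cone w') = word_vtx (~~ j) w'.
      by rewrite /word_vtx PM ?P1 ?mul1g //; [exact: cspan1 | exact: vN].
    by rewrite wvtx_eq //; exact: vN.
  by case: (j) tt; rewrite !inE => /predU1P[->|->]; rewrite ?eqxx.
have /hasP[h hh /andP[/allP fx mv]] := ok _ tt'; have vh' := vh _ hh.
exists (pi (P h)); first by apply/(cosetg_permP _ (AA_sub P k)); exists (P h); rewrite ?hA.
have vtw : valid (cmul t (nth cone ws i)) by exact: cspanM.
split=> [m hm|]; apply/eqP.
  by rewrite act_wvtx_eq //; apply: fx; rewrite mem_iota.
have -> : base_arc j0 ws i.+1 = word_vtx (~~ (j0 (+) odd i)) (nth cone ws i.+1).
  by rewrite /base_arc /= -addbN.
by rewrite act_wvtx_eq.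
Qed.

Lemma hvalid_HH x : hvalid x -> P x \in HH.
Proof.
have vh : vlist hgens by move=> y hy; apply/hvalid_valid/cspan_gen.
move/(mem_span mP vh); apply: subsetP; rewrite gen_subG.
apply/subsetP=> _ /psetP[y hy ->].
have: (y \in gens1) || (y \in gens2) by move: y hy; apply/allP.
case/orP=> hg; first by apply: (subsetP (joing_subl _ _)); exact: mem_grp.
by apply: (subsetP (joing_subr _ _)); exact: mem_grp.
Qed.

Lemma wvtx1 j : word_vtx j cone = vtx j 1. Proof. by rewrite /word_vtx P1. Qed.

Lemma hstep k j0 ws hs i : vlist ws -> {in hs, forall x, hvalid x} ->
  step_ok j0 ws hs i -> arc_step adj (perm_of (AA k)) (base_arc j0 ws) i.
Proof.
move=> vw hh; apply: step_okP => // h /hh hv; first exact: hvalid_valid.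
by apply: (subsetP (joing_subl _ _)); exact: hvalid_HH.
Qed.

Lemma aut_AA k : perm_of (AA k) \subset graph_aut adj.
Proof. exact: cosetg_perm_sub oK _ (AA_sub P k). Qed.

Lemma hsteps k j0 ws hss : vlist ws -> {in flatten hss, forall x, hvalid x} ->
    all (fun i => step_ok j0 ws (nth [::] hss i) i) (iota 0 (size hss)) ->
  forall i, i < size hss -> arc_step adj (perm_of (AA k)) (base_arc j0 ws) i.
Proof.
move=> vw hh /allP ok i hi; apply: (@hstep k j0 ws (nth [::] hss i)) => //.
  by move=> x hx; apply: hh; apply/flattenP; exists (nth [::] hss i); rewrite ?mem_nth.
by apply: ok; rewrite mem_iota.
Qed.

Lemma steps2 k i : i < 6 -> arc_step adj (perm_of (AA k)) (base_arc true path2) i.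
Proof. by apply: (@hsteps k true path2 hs2); [vlist_tac | vlist_tac | lazy]. Qed.

Lemma steps1 k i : i < 5 -> arc_step adj (perm_of (AA k)) (base_arc false path1) i.
Proof. by apply: (@hsteps k false path1 hs1); [vlist_tac | vlist_tac | lazy]. Qed.

Lemma base_arc0 j0 ts : base_arc j0 (arc_words ts) 0 = vtx j0 1.
Proof. by rewrite -wvtx1 /base_arc addbF. Qed.

Lemma arc6_x2 k : arc_transitive_from adj (perm_of (AA k)) 6 (vtx true 1).
Proof.
by have := arc_trans (aut_AA k) (@steps2 k); rewrite base_arc0.
Qed.

Lemma locally_5arc k : locally_arc_transitive adj (perm_of (AA k)) 5.
Proof.
move=> v; have [j [h hH ->]] := vtx_HH mP v.
have hA : pi h \in perm_of (AA k).
  apply/(cosetg_permP _ (AA_sub P k)); exists h => //.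
  by apply: (subsetP (joing_subl _ _)).
apply: (arc_trans_conj hA (aut_AA k)); case: j.
  have st i : i < 5 -> arc_step adj (perm_of (AA k)) (base_arc true path2) i.
    by move/ltnW; exact: steps2.
  by have := arc_trans (aut_AA k) st; rewrite base_arc0.
by have := arc_trans (aut_AA k) (@steps1 k); rewrite base_arc0.
Qed.

End Arcs.

(** * The automorphism group of Delta *)

Section FixedArcs.

Variables (T : finType) (e : rel T) (bt : pred T) (p : T -> T).
Hypothesis e_sym : symmetric e.
Hypothesis bt_adj : forall u v, e u v -> bt v = ~~ bt u.
Hypothesis other_nbr : forall u v, exists2 w, e u w & w != v.

Lemma exists_arc8 x2 : exists l, arc_from e 8 x2 l.
Proof.
have [y1 a1 _] := other_nbr x2 x2; have [y2 a2 n2] := other_nbr y1 x2.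
have [y3 a3 n3] := other_nbr y2 y1; have [y4 a4 n4] := other_nbr y3 y2.
have [y5 a5 n5] := other_nbr y4 y3; have [y6 a6 n6] := other_nbr y5 y4.
have [y7 a7 n7] := other_nbr y6 y5; have [y8 a8 n8] := other_nbr y7 y6.
exists [:: y1; y2; y3; y4; y5; y6; y7; y8].
rewrite /arc_from /= a1 a2 a3 a4 a5 a6 a7 a8 /=.
rewrite eq_sym n2 eq_sym n3 eq_sym n4 eq_sym n5 eq_sym n6 eq_sym n7.
by rewrite eq_sym n8.
Qed.

Definition farc z l :=
  [&& arc_from e 8 z l, all (fun v => p v == v) (z :: l) & bt z].

Lemma farcP z l : farc z l -> exists y1 y2 y3 y4 y5 y6 y7 y8,
  l = [:: y1; y2; y3; y4; y5; y6; y7; y8].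
Proof.
case/and3P=> /and3P[/eqP sl _ _] _ _.
case: l sl => [|y1 [|y2 [|y3 [|y4 [|y5 [|y6 [|y7 [|y8 [|//]]]]]]]]] //= _.
by exists y1, y2, y3, y4, y5, y6, y7, y8.
Qed.

(** The length is even, so the last vertex has the type of the first. *)
Lemma farc_rev z y1 y2 y3 y4 y5 y6 y7 y8 :
  farc z [:: y1; y2; y3; y4; y5; y6; y7; y8] ->
  farc y8 [:: y7; y6; y5; y4; y3; y2; y1; z].
Proof.
rewrite /farc /arc_from /= !andbT => /and3P[/andP[pa na] fx bz].
have sy := e_sym.
move: pa => /and5P[a1 a2 a3 a4 /and4P[a5 a6 a7 a8]].
move: na => /and5P[n1 n2 n3 n4 /and3P[n5 n6 n7]].
move: fx => /and5P[f0 f1 f2 f3 /and5P[f4 f5 f6 f7 f8]].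
have b8 : bt y8.
  by rewrite (bt_adj a8) (bt_adj a7) (bt_adj a6) (bt_adj a5)
    (bt_adj a4) (bt_adj a3) (bt_adj a2) (bt_adj a1) bz.
rewrite b8 f0 f1 f2 f3 f4 f5 f6 f7 f8.
rewrite (sy y8 y7) (sy y7 y6) (sy y6 y5) (sy y5 y4) (sy y4 y3) (sy y3 y2) (sy y2 y1) (sy y1 z).
rewrite a1 a2 a3 a4 a5 a6 a7 a8.
by rewrite eq_sym n7 eq_sym n6 eq_sym n5 eq_sym n4 eq_sym n3 eq_sym n2 eq_sym n1.
Qed.

Hypothesis farc_ext : forall z y1 y2 y3 y4 y5 y6 y7 y8 y9 y10,
    farc z [:: y1; y2; y3; y4; y5; y6; y7; y8] ->
  e y8 y9 -> y9 != y7 -> e y9 y10 -> p y9 = y9 /\ p y10 = y10.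

(** The window slides by two vertices, which keeps the type of its origin. *)
Lemma farc_shift z y1 y2 y3 y4 y5 y6 y7 y8 y9 y10 :
    farc z [:: y1; y2; y3; y4; y5; y6; y7; y8] ->
    e y8 y9 -> y9 != y7 -> e y9 y10 -> y10 != y8 ->
  farc y2 [:: y3; y4; y5; y6; y7; y8; y9; y10].
Proof.
move=> hf a9 n9 a10 n10; have [/eqP f9 /eqP f10] := farc_ext hf a9 n9 a10.
move: hf; rewrite /farc /arc_from /= !andbT => /and3P[/andP[pa na] fx bz].
move: pa => /and5P[a1 a2 a3 a4 /and4P[a5 a6 a7 a8]].
move: na => /and5P[n1 n2 n3 n4 /and3P[n5 n6 n7]].
move: fx => /and5P[f0 f1 f2 f3 /and5P[f4 f5 f6 f7 f8]].
have b2 : bt y2 by rewrite (bt_adj a2) (bt_adj a1) bz.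
rewrite a3 a4 a5 a6 a7 a8 a9 a10 n3 n4 n5 n6 n7 f2 f3 f4 f5 f6 f7 f8 f9 f10 b2.
by rewrite eq_sym n9 eq_sym n10.
Qed.

Definition Fx z := exists l, farc z l.

(** Reversed, the arc ends at z and extends through a to z'; sliding it there and reversing again
    gives a fixed arc that starts at z'. *)
Lemma farc_side z y l a z' : farc z (y :: l) -> e z a -> a != y -> e a z' ->
  p a = a /\ (z' != z -> Fx z').
Proof.
move=> hf za ay az'; have [y1 [y2 [y3 [y4 [y5 [y6 [y7 [y8 el]]]]]]]] := farcP hf.
case: el hf ay => -> -> hf ay; have hr := farc_rev hf.
split; first by have [] := farc_ext hr za ay az'.
by move=> zz'; have /farc_rev := farc_shift hr za ay az' zz'; eexists; eassumption.
Qed.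

(** Reversed, the arc ends at z; after sliding forward by eight vertices it starts at z, along a new
    edge. *)
Lemma farc_turn z y l : farc z (y :: l) -> exists a, exists2 l', a != y & farc z (a :: l').
Proof.
move=> hf; have [y1 [y2 [y3 [y4 [y5 [y6 [y7 [y8 el]]]]]]]] := farcP hf.
case: el hf => -> -> hf; have hr := farc_rev hf.
have [a1 za1 n1] := other_nbr z y1; have [b1 ab1 m1] := other_nbr a1 z.
have h1 := farc_shift hr za1 n1 ab1 m1.
have [a2 za2 n2] := other_nbr b1 a1; have [b2 ab2 m2] := other_nbr a2 b1.
have h2 := farc_shift h1 za2 n2 ab2 m2.
have [a3 za3 n3] := other_nbr b2 a2; have [b3 ab3 m3] := other_nbr a3 b2.
have h3 := farc_shift h2 za3 n3 ab3 m3.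
have [a4 za4 n4] := other_nbr b3 a3; have [b4 ab4 m4] := other_nbr a4 b3.
have h4 := farc_shift h3 za4 n4 ab4 m4.
by exists a1; eexists; [exact: n1 | exact: h4].
Qed.

(** If a happens to be the first vertex after z of the given arc, [farc_turn] supplies a fixed arc
    that leaves z in another direction. *)
Lemma Fx_step z a z' : Fx z -> e z a -> e a z' -> p a = a /\ Fx z'.
Proof.
move=> [l hf] za az'; have fz : Fx z by exists l.
have [y [l' el]] : exists y l', l = y :: l'.
  by have [y1 [y2 [y3 [y4 [y5 [y6 [y7 [y8 ->]]]]]]]] := farcP hf; do 2!eexists.
rewrite el in hf.
have [b [l2 [hb ab]]] : exists b l2, farc z (b :: l2) /\ a != b.
  have [ay|ay] := eqVneq a y; last by exists y, l'.
  by have [b [l2 nb hb]] := farc_turn hf; exists b, l2; rewrite ay eq_sym.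
have [pa h] := farc_side hb za ab az'; split=> //.
by have [->|/h] := eqVneq z' z.
Qed.

End FixedArcs.

(* The representative of orbit i + 1 is the s-th element of the transversal     *)
(* times the representative of orbit p, where (p, s) is the i-th pair.         *)
Definition orbit_parents : seq (nat * nat) := [:: (0, 0); (1, 1); (2, 1); (3, 1);
    (4, 1); (5, 1); (6, 1); (6, 2); (7, 1); (8, 1); (9, 1); (9, 2); (10, 1); (10, 2);
    (11, 1); (11, 2); (11, 3); (12, 1); (12, 2); (12, 3); (13, 1); (13, 2); (13, 3);
    (14, 1); (14, 2); (14, 3); (15, 1); (15, 2); (16, 1); (16, 2); (17, 2); (18, 1);
    (18, 2); (19, 1); (19, 2); (20, 1); (20, 2); (21, 1); (22, 1); (22, 2); (24, 2);
    (26, 2); (27, 1); (27, 3); (28, 3); (29, 1); (30, 1); (30, 2); (31, 1); (31, 2);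
    (31, 3); (32, 2); (33, 2); (33, 3); (34, 1); (35, 1); (35, 3); (36, 3); (37, 2);
    (38, 1); (39, 2); (39, 3); (40, 1); (41, 1); (41, 3); (42, 1); (43, 1); (44, 2);
    (46, 1); (47, 1); (48, 2); (49, 2); (50, 2); (52, 2); (55, 2); (62, 2); (63, 2);
    (64, 1); (67, 1); (68, 3); (69, 3); (70, 2); (70, 3); (71, 1); (71, 3); (72, 2);
    (75, 3); (76, 1); (77, 1); (89, 1); (90, 1)]%N.

(* For each orbit, the orbits of the neighbours of its representative, with the *)
(* exponents (see lword) of an element of K_2 that moves the neighbour to the   *)
(* representative of its orbit.                                                *)
Definition orbit_nbrs : seq (seq (nat * seq nat)) := [::
  [:: (1, [::]); (1, [:: 0; 0; 8]); (1, [:: 0; 0; 1; 0; 1])];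
  [:: (0, [::]); (2, [::]); (2, [:: 0; 2]); (2, [:: 0; 1; 0; 0; 1])];
  [:: (1, [::]); (3, [::]); (3, [:: 0; 0; 0; 1])];
  [:: (2, [::]); (4, [::]); (4, [:: 0; 0; 3; 0; 1]); (4, [:: 0; 0; 6])];
  [:: (3, [::]); (5, [::]); (5, [:: 0; 0; 0; 0; 1])];
  [:: (4, [::]); (6, [::]); (6, [:: 0; 0; 0; 0; 0; 1]); (6, [:: 0; 0; 0; 0; 0; 2])];
  [:: (5, [::]); (7, [::]); (8, [::])];
  [:: (6, [::]); (9, [::]); (9, [:: 2; 0; 0; 0; 0; 1]); (9, [:: 1; 0; 0; 0; 0; 2])];
  [:: (6, [::]); (10, [::]); (10, [:: 1; 0; 0; 0; 0; 2]); (10, [:: 2; 0; 0; 0; 0; 1])];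
  [:: (7, [::]); (11, [::]); (12, [::])];
  [:: (8, [::]); (13, [::]); (14, [::])];
  [:: (9, [::]); (15, [::]); (16, [::]); (17, [::])];
  [:: (9, [::]); (18, [::]); (19, [::]); (20, [::])];
  [:: (10, [::]); (21, [::]); (22, [::]); (23, [::])];
  [:: (10, [::]); (24, [::]); (25, [::]); (26, [::])];
  [:: (11, [::]); (27, [::]); (28, [::])];
  [:: (11, [::]); (29, [::]); (30, [::])];
  [:: (11, [::]); (28, [:: 1; 1; 8; 0; 1]); (31, [::])];
  [:: (12, [::]); (32, [::]); (33, [::])];
  [:: (12, [::]); (34, [::]); (35, [::])];
  [:: (12, [::]); (36, [::]); (37, [::])];
  [:: (13, [::]); (38, [::]); (30, [:: 0; 2; 7; 1])];
  [:: (13, [::]); (39, [::]); (40, [::])];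
  [:: (13, [::]); (32, [:: 0; 1; 1; 0; 0; 2]); (34, [:: 0; 0; 7; 1; 0; 2])];
  [:: (14, [::]); (28, [:: 1; 1; 4; 0; 1]); (41, [::])];
  [:: (14, [::]); (27, [:: 0; 0; 5; 1; 0; 1]); (40, [:: 1; 1; 8; 1; 0; 2])];
  [:: (14, [::]); (29, [:: 1; 0; 2; 1; 1; 1]); (42, [::])];
  [:: (15, [::]); (43, [::]); (25, [:: 0; 0; 2; 1; 0; 2]); (44, [::])];
  [:: (15, [::]); (24, [:: 2; 0; 1; 0; 1]); (17, [:: 2; 2; 8; 0; 1]); (45, [::])];
  [:: (16, [::]); (46, [::]); (45, [:: 0; 1; 5; 0; 0; 2]); (26, [:: 1; 1; 4; 1; 1; 2])];
  [:: (16, [::]); (47, [::]); (48, [::]); (21, [:: 0; 1; 7; 1])];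
  [:: (17, [::]); (49, [::]); (50, [::]); (51, [::])];
  [:: (18, [::]); (50, [:: 0; 1; 0; 1; 0; 2]); (52, [::]); (23, [:: 0; 2; 2; 0; 0; 1])];
  [:: (18, [::]); (18, [:: 0; 0; 7; 0; 1]); (53, [::]); (54, [::])];
  [:: (19, [::]); (55, [::]); (23, [:: 0; 0; 4; 1; 0; 1]); (45, [:: 2; 2])];
  [:: (19, [::]); (56, [::]); (51, [:: 1; 1; 0; 0; 1]); (57, [::])];
  [:: (20, [::]); (20, [:: 2; 1; 2; 0; 0; 2]); (20, [:: 1; 0; 1; 0; 0; 1]); (58, [::])];
  [:: (20, [::]); (47, [:: 1; 2; 0; 1; 1]); (59, [::]); (56, [:: 0; 0; 7; 1; 1; 1])];
  [:: (21, [::]); (60, [::]); (54, [:: 1; 2; 5; 1; 0; 1]); (55, [:: 1; 2; 6; 1; 1; 2])];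
  [:: (22, [::]); (22, [:: 0; 2; 1; 0; 1]); (61, [::]); (62, [::])];
  [:: (22, [::]); (63, [::]); (25, [:: 1; 1; 2; 1; 0; 1]); (49, [:: 2; 2; 3; 1; 0; 1])];
  [:: (24, [::]); (64, [::]); (57, [:: 2; 2; 5; 1; 0; 2]); (65, [::])];
  [:: (26, [::]); (66, [::]); (61, [:: 1; 0; 4]); (66, [:: 0; 0; 8; 1; 1; 1])];
  [:: (27, [::]); (67, [::]); (27, [:: 0; 2; 5; 0; 1])];
  [:: (27, [::]); (27, [:: 1; 1; 2; 1]); (68, [::])];
  [:: (28, [::]); (34, [:: 1; 1; 6]); (29, [:: 0; 2; 1; 0; 0; 1])];
  [:: (29, [::]); (69, [::]); (29, [:: 2; 1; 1; 1])];
  [:: (30, [::]); (70, [::]); (37, [:: 1; 2; 3; 1; 1])];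
  [:: (30, [::]); (30, [:: 2; 1; 4; 1]); (71, [::])];
  [:: (31, [::]); (40, [:: 2; 1; 6; 1; 0; 2]); (72, [::])];
  [:: (31, [::]); (32, [:: 0; 2; 0; 1; 0; 1]); (73, [::])];
  [:: (31, [::]); (72, [:: 2; 1; 2; 1; 1; 1]); (35, [:: 2; 1; 3; 0; 1])];
  [:: (32, [::]); (32, [:: 0; 0; 8; 0; 1]); (74, [::])];
  [:: (33, [::]); (67, [:: 2; 0; 0; 1; 0; 1]); (74, [:: 0; 0; 1; 1; 1; 2])];
  [:: (33, [::]); (38, [:: 1; 1; 5; 1; 1; 2]); (38, [:: 1; 0; 5; 1; 0; 2])];
  [:: (34, [::]); (38, [:: 1; 2; 6; 1; 1; 1]); (75, [::])];
  [:: (35, [::]); (37, [:: 0; 0; 8; 1; 1; 2]); (73, [:: 1; 1; 8; 0; 0; 1])];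
  [:: (35, [::]); (41, [:: 2; 2; 8; 1; 0; 1]); (75, [:: 1; 0; 0; 1; 0; 2])];
  [:: (36, [::]); (36, [:: 0; 1; 3; 0; 0; 2]); (36, [:: 0; 2; 6; 0; 0; 1])];
  [:: (37, [::]); (69, [:: 2; 1; 8; 0; 0; 1]); (37, [:: 0; 0; 8; 1])];
  [:: (38, [::]); (68, [:: 2; 1]); (38, [:: 2; 2; 8; 1])];
  [:: (39, [::]); (42, [:: 2; 0; 8; 0; 1]); (42, [:: 2; 1; 2])];
  [:: (39, [::]); (39, [:: 0; 0; 1; 1]); (76, [::])];
  [:: (40, [::]); (73, [:: 1; 1; 6; 0; 1]); (77, [::])];
  [:: (41, [::]); (78, [::]); (41, [:: 1; 1; 3; 1; 1])];
  [:: (41, [::]); (41, [:: 0; 0; 4; 1]); (68, [:: 1; 2; 1; 0; 0; 2])];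
  [:: (42, [::]); (70, [:: 2; 0; 6; 1; 1; 1]); (42, [:: 0; 0; 4; 1; 1; 2])];
  [:: (43, [::]); (79, [::]); (53, [:: 2; 0; 0; 1; 0; 2]); (79, [:: 2; 2; 1; 1; 1])];
  [:: (44, [::]); (65, [:: 2; 2; 2; 0; 0; 1]); (60, [:: 1; 2; 3]); (80, [::])];
  [:: (46, [::]); (79, [:: 0; 2; 7; 0; 1; 1]); (59, [:: 1; 0; 6; 1; 0; 2]); (81, [::])];
  [:: (47, [::]); (66, [:: 2; 0; 3; 1; 1; 2]); (82, [::]); (83, [::])];
  [:: (48, [::]); (84, [::]); (82, [:: 1; 2; 1; 1; 1; 1]); (85, [::])];
  [:: (49, [::]); (51, [:: 2; 0; 7; 1; 1; 2]); (86, [::]); (83, [:: 2; 0; 1])];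
  [:: (50, [::]); (56, [:: 2; 1; 4; 0; 0; 2]); (63, [:: 2; 1; 0; 0; 1]); (80, [:: 0;
    1; 1; 1; 0; 1])];
  [:: (52, [::]); (83, [:: 2; 0; 4; 1; 0; 2]); (53, [:: 0; 0; 2; 1; 1; 1]);
    (83, [:: 2; 1; 1; 1; 1; 2])];
  [:: (55, [::]); (57, [:: 1; 0; 0; 1; 0; 1]); (85, [:: 1; 2; 3; 0; 1; 2]); (87, [::])];
  [:: (62, [::]); (88, [::]); (62, [:: 0; 0; 0; 1; 1]); (62, [:: 0; 2])];
  [:: (63, [::]); (89, [::]); (63, [:: 1; 1; 5]); (63, [:: 2; 1; 4])];
  [:: (64, [::]); (88, [:: 2; 1; 2; 0; 1; 1]); (64, [:: 0; 1; 6]); (64, [:: 1; 0; 0;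
    1; 1])];
  [:: (67, [::]); (67, [:: 2; 0; 2; 1; 1]); (69, [:: 2; 0; 6; 1; 1; 2])];
  [:: (68, [::]); (73, [:: 1; 0; 7; 0; 0; 2]); (73, [:: 0; 2; 4; 1; 0; 2])];
  [:: (69, [::]); (69, [:: 0; 0; 3; 1]); (69, [:: 2; 1; 7])];
  [:: (70, [::]); (70, [:: 0; 0; 5; 1]); (71, [:: 2; 2; 6; 0; 1; 2])];
  [:: (70, [::]); (72, [:: 1; 2; 5]); (74, [:: 2; 2; 2; 1; 1; 1])];
  [:: (71, [::]); (71, [:: 1; 2; 4; 1]); (71, [:: 0; 0; 7; 1])];
  [:: (71, [::]); (75, [:: 2; 2; 0; 0; 1; 1]); (75, [:: 0; 1; 4; 1; 1; 1])];
  [:: (72, [::]); (72, [:: 1; 0; 8; 0; 0; 2]); (72, [:: 2; 2; 1; 0; 0; 1])];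
  [:: (75, [::]); (75, [:: 1; 2; 7; 0; 0; 1]); (75, [:: 2; 2; 8; 0; 0; 2])];
  [:: (76, [::]); (78, [:: 1; 2; 8; 0; 0; 2]); (78, [:: 1; 2; 5; 0; 1; 2])];
  [:: (77, [::]); (90, [::]); (77, [:: 0; 0; 3; 1])];
  [:: (89, [::]); (91, [::]); (89, [:: 0; 1; 0; 0; 0; 1]); (89, [:: 0; 2; 0; 0; 0; 2])];
  [:: (90, [::]); (90, [:: 2; 1; 7]); (90, [:: 0; 0; 0; 1])]]%N.

(** One list for each of the two base arcs: orbit certificates in the order in which [arc8_ok]
    consumes them. *)
Definition sep_certs1 : seq (seq (nat * seq nat)) := [::
  [:: (7, [::]); (11, [::]); (12, [::])];
  [:: (7, [:: 0; 0; 0; 0; 1]); (12, [:: 0; 0; 0; 0; 1]); (11, [:: 0; 0; 0; 0; 1])];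
  [:: (9, [:: 0; 0; 0; 0; 1]); (18, [:: 0; 0; 0; 0; 1]); (20, [:: 0; 0; 0; 0; 1]);
    (19, [:: 0; 0; 0; 0; 1])];
  [:: (9, [::]); (18, [::]); (19, [::]); (20, [::])];
  [:: (22, [:: 0; 0; 0; 0; 1]); (25, [:: 1; 2; 7; 1; 1; 1]); (63, [:: 0; 0; 0; 0;
    1]); (49, [:: 2; 1; 6; 1; 1; 1])];
  [:: (9, [::])]]%N.

Definition sep_certs2 : seq (seq (nat * seq nat)) := [::
  [:: (8, [::]); (13, [::]); (14, [::])];
  [:: (8, [:: 0; 0; 0; 1; 0; 1]); (14, [:: 2; 0; 0; 1]); (13, [:: 2; 0; 0; 1])];
  [:: (10, [:: 2; 0; 0; 1]); (26, [:: 2; 0; 0; 1]); (24, [:: 2; 0; 0; 1]);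
    (25, [:: 2; 0; 0; 1])];
  [:: (10, [::]); (21, [::]); (22, [::]); (23, [::])];
  [:: (26, [:: 0; 0; 0; 0; 1]); (46, [:: 2; 2; 3; 0; 0; 1]); (16, [:: 1; 0; 7; 1; 0;
    1]); (45, [:: 1; 1; 8; 1])];
  [:: (10, [::])]]%N.

(** * Certificates for orbits and walk counts *)

(** Normal forms of K_2: the relative orders 3, 3, 9, 2, 2, 3 multiply to 972. Omitted trailing
    exponents are zero. *)
Definition lword s :=
  foldl (fun w xk => cmul w (iter xk.2 (cmul xk.1) cone)) cone
    (zip [:: ga; gc; ge; gf; gt; gr] s).

Definition orbit_step (reps : seq (bool * crep)) ps :=
  let jx := nth (true, cone) reps ps.1 in
  rcons reps (~~ jx.1, cmul (nth cone (tsr jx.1) ps.2) jx.2).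
Definition orbit_reps := foldl orbit_step [:: (true, cone)] orbit_parents.
Definition orep i := nth (true, cone) orbit_reps i.
Definition onbrs i := nth [::] orbit_nbrs i.

(* (o, s) certifies that the vertex (j, x) lies in the K_2-orbit number o.     *)
Definition in_orbit j x (os : nat * seq nat) :=
  [&& eqb (orep os.1).1 j, memG true (lword os.2), os.1 < 92
    & memG j (cmul (cmul x (lword os.2)) (cinv (orep os.1).2))].
Definition in_orbits j x cs :=
  (size cs == size (tsr j)) &&
  all (fun tc => in_orbit (~~ j) (cmul tc.1 x) tc.2) (zip (tsr j) cs).

Definition orbits_ok :=
  all (fun i => in_orbits (orep i).1 (orep i).2 (onbrs i)) (iota 0 92).
(** Guarantees that x_2 is not among the later representatives, as the table for walks of length 0
    asserts. *)
Definition orbits0_ok :=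
  all (fun i => (orep i).1 ==> ~~ memG true (orep i).2) (iota 1%N 91).

(* Numbers of walks of length n from x_2 to the orbit representatives, mod 20. *)
Definition wnext (tab : seq nat) :=
  [seq sumn [seq nth 0 tab os.1 | os <- nbs] %% 20 | nbs <- orbit_nbrs].
Definition wtab n := iter n wnext (1%N :: nseq 91 0).

Definition cvals n (cs : seq (nat * seq nat)) := [seq nth 0 (wtab n) os.1 | os <- cs].

Definition sep_at (vals : seq nat) i :=
  all (fun m => (nth 0 vals m == nth 0 vals i) ==> (m == i)) (iota 0 (size vals)).

(* K has two orbits on the 8-arcs starting at x_2, represented by these words. *)
Definition arcw (eps : bool) :=
  arc_words [:: cone; gd; ge; gd; ge; gd; if eps then ge else gee; gd].
Definition w8 eps := nth cone (arcw eps) 8.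
Definition certs eps i := nth [::] (if eps then sep_certs1 else sep_certs2) i.
(** The subgroup of order 3 generated by A^2 sigma^2, the stabilizer in K of a 7-arc. It is not
    contained in H. *)
Definition hs7 := [:: cone; cmul (cmul ga ga) gr; cmul ga (cmul gr gr)].
(** An additional reference vertex off the arc, at distance 2 from x_2. *)
Definition uword := cmul gd (cmul ge cone).
Definition sep_all n cs := all (sep_at (cvals n cs)) (iota 0 (size cs)).
Definition tA (eps : bool) := if eps then gee else ge.

(** Counts from x_2 separate the neighbours of y_8. Counts from y_8 single out the neighbour K_1 E
    of x_2, and then its neighbour u = K_2 D E. Counts from x_2 and from u separate the neighbours
    of the two vertices that may follow y_8. The last three tests say that the identity coset leads
    back to y_7, that K permutes the continuations at y_7 transitively, and in which orbit y_8
    lies. *)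
Definition arc8_ok eps :=
  [&& in_orbits true (cmul (w8 eps) (cinv cone)) (certs eps 0),
      sep_all 15 (certs eps 0),
      in_orbits true (cmul cone (cinv (w8 eps))) (certs eps 1),
      sep_at (cvals 15 (certs eps 1)) 1 &
  [&& in_orbits false (cmul (cmul ge cone) (cinv (w8 eps))) (certs eps 2),
      sep_at (cvals 14 (certs eps 2)) 1,
      in_orbits false (cmul (cmul (tA eps) (w8 eps)) (cinv cone)) (certs eps 3),
      sep_all 14 (certs eps 3) &
  [&& in_orbits false (cmul (cmul (tA (~~ eps)) (w8 eps)) (cinv uword)) (certs eps 4),
      sep_all 14 (certs eps 4),
      memG false (cmul (cmul cone (w8 eps)) (cinv (nth cone (arcw eps) 7))),
      step_ok true (arcw eps) hs7 7 &
      in_orbit true (w8 eps) (head (0, [::]) (certs eps 5))]]].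

(** * From walk counts to automorphisms *)

Section Automorphisms.

Variables (gT : finGroupType) (P : crep -> gT).
Hypothesis mP : model P.
Let P1 := model1 mP.
Let PM := modelM mP.
Let PV := modelV mP.
Local Notation vlist L := {in L, forall x, valid x}.
Local Notation K1 := (G1 P true).
Local Notation K2 := (G2 P true).
Local Notation side := (side K1 K2).
Local Notation KK := (KK P).
Local Notation adj := (@cosetg_adj gT K1 K2).
Local Notation pi := (actperm (cosetg_action K1 K2)).
Local Notation vtx := (@vtx gT K1 K2).
Local Notation KD := (cosetg_perm K1 K2 KK).
Local Notation wvtx := (word_vtx P).
Local Notation x2 := (wvtx true cone).
Local Notation aut := (graph_aut adj).
Local Notation W := (walks adj).
Let oK : #|K1| != #|K2| := card_neq mP.

Lemma valid_lword s : valid (lword s).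
Proof.
rewrite /lword; have: vlist (unzip1 (zip [:: ga; gc; ge; gf; gt; gr] s)).
  have vg : vlist [:: ga; gc; ge; gf; gt; gr] by vlist_tac.
  move=> x /mapP[[y k] yk ->]; apply: vg; rewrite /=.
  elim: [:: ga; _; _; _; _; _] s yk => [|z l IHl] [|k' s] //=; rewrite !inE xpair_eqE.
  by case/orP=> [/andP[-> _]|/IHl->] //; rewrite orbT.
elim: (zip _ _) {1 3}cone (cspan1 _ : valid cone) => //= -[x k] l IHl w vw vl.
apply: IHl; last first.
  by move=> y ly; apply: vl; rewrite inE ly orbT.
apply: cspanM => //; have vx := vl x (mem_head _ _).
by elim: k {vl} => [|k IHk]; [exact: cspan1 | exact: cspanM].
Qed.

Lemma valid_orep i : valid (orep i).2.
Proof.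
rewrite /orep; have: forall i, valid (nth (true, cone) [:: (true, cone)] i).2.
  by case=> [|[|?]]; exact: cspan1.
rewrite /orbit_reps; elim: orbit_parents [:: _] i => [|ps l IHl] reps i hr //=.
apply: IHl => m; rewrite nth_rcons; case: ifP => // _; case: ifP => _; last exact: cspan1.
apply: cspanM => //; apply: valid_nth => t; exact: vtsr.
Qed.

Lemma valid_ts j i : valid (nth cone (tsr j) i).
Proof. by apply: valid_nth => t; exact: vtsr. Qed.

Lemma aut_pi x : valid x -> pi (P x) \in aut.
Proof. by move=> vx; apply: (act_aut oK); exact: valid_KK. Qed.

(** Translation moves the first vertex to x_2, so the tables for x_2 suffice. *)
Lemma walks_shift n x j y : valid x -> valid y ->
  W n (wvtx true x) (wvtx j y) = W n x2 (wvtx j (cmul y (cinv x))).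
Proof.
move=> vx vy; have vV := cspanV vx; rewrite -(walks_aut n _ _ (aut_pi vV)).
rewrite !(act_wvtx mP) //; congr (W n _ _).
by rewrite /word_vtx PM // PV // mulgV P1.
Qed.

Lemma walks_K2 n j x y : valid x -> valid y -> memG true y ->
  W n x2 (wvtx j (cmul x y)) = W n x2 (wvtx j x).
Proof.
move=> vx vy hy; rewrite -(act_wvtx mP) //.
have {1}-> : x2 = pi (P y) x2.
  apply/esym/eqP; rewrite /word_vtx P1 act_vtx ?(valid_KK mP) // mul1g.
  by rewrite (vtx_eq _ (valid_KK mP vy) (group1 _)) invg1 mulg1 (memGE mP).
exact: walks_aut (aut_pi vy).
Qed.

Lemma walks_in_orbit n j x os : valid x -> in_orbit j x os ->
  W n x2 (wvtx j x) = W n x2 (wvtx j (orep os.1).2).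
Proof.
move=> vx /and4P[_ hl _ hm]; have vl := valid_lword os.2.
rewrite -(walks_K2 n j vx vl hl); congr (W n _ _); apply/eqP.
by rewrite (wvtx_eq mP) //; [exact: cspanM | exact: valid_orep].
Qed.

Lemma walks_step n j x : valid x -> W n.+1 x2 (wvtx j x) =
  (\sum_(t <- tsr j) W n x2 (wvtx (~~ j) (cmul t x)))%N.
Proof.
move=> vx; rewrite (walks_vtx oK (tsP_side mP) (tsP_cover mP) (tsP_uniq mP) _ _ _ (valid_KK mP vx)).
rewrite big_map; apply: eq_big_seq => t tt; congr (W n _ _).
by rewrite /word_vtx PM //; exact: vtsr tt.
Qed.

Lemma in_orbitsP j x cs i : in_orbits j x cs -> i < size (tsr j) ->
  in_orbit (~~ j) (cmul (nth cone (tsr j) i) x) (nth (0, [::]) cs i).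
Proof.
case/andP=> /eqP sc /allP h hi.
have := h (nth cone (tsr j) i, nth (0, [::]) cs i).
by rewrite /= => -> //; rewrite -nth_zip // mem_nth // size_zip sc minnn.
Qed.

Lemma wtabS n i : i < 92 ->
  nth 0 (wtab n.+1) i = sumn [seq nth 0 (wtab n) os.1 | os <- onbrs i] %% 20.
Proof.
move=> hi; have hs : i < size orbit_nbrs by exact: hi.
exact: (nth_map [::] 0 (fun nbs => sumn [seq nth 0 (wtab n) os.1 | os <- nbs] %% 20) hs).
Qed.

Lemma orep0 : orep 0 = (true, cone). Proof. by lazy. Qed.

(** K_2 fixes x_2, so counts are constant on its orbits and the recursion over neighbours becomes
    that of the table. *)
Lemma walks_orep n i : i < 92 ->
  W n x2 (wvtx (orep i).1 (orep i).2) %% 20 = nth 0 (wtab n) i.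
Proof.
have ok0 : orbits0_ok by lazy.
have /allP ok : orbits_ok by lazy.
elim: n i => [|n IHn] i hi.
  case: i hi => [|i] hi; first by rewrite orep0 /= eqxx.
  have -> : nth 0 (wtab 0) i.+1 = 0.
    by rewrite -[LHS]/(nth 0 (nseq 91 0) i) nth_nseq if_same.
  have /allP/(_ i.+1) := ok0; rewrite mem_iota => /(_ hi).
  move: (valid_orep i.+1); case: (orep i.+1) => jx x /= vi hx.
  case: (x2 =P wvtx jx x) => [e|_]; last exact: mod0n.
  case: jx hx e => hx e.
    case/negP: hx; rewrite -(memGE mP true vi); move/esym/eqP: e.
    rewrite (vtx_eq _ (valid_KK mP vi) (valid_KK mP (cspan1 _))) P1 invg1 mulg1.
    exact: id.
  by have := vtx_side oK (valid_KK mP (cspan1 _)) (valid_KK mP vi) e.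
have hN := ok i; rewrite mem_iota in hN; have {}hN := hN hi.
have [/eqP sN _] := andP hN.
rewrite walks_step; last exact: valid_orep.
rewrite (wtabS n hi) (big_nth cone) big_mkord sumnE big_map (big_nth (0, [::])) big_mkord sN.
rewrite -modn_summ -[RHS]modn_summ; congr (_ %% _); apply: eq_bigr => m _.
have hm := in_orbitsP hN (ltn_ord m).
have vm : valid (cmul (nth cone (tsr (orep i).1) m) (orep i).2).
  by apply: cspanM; [exact: valid_ts | exact: valid_orep].
rewrite (walks_in_orbit n vm hm); have /and4P[/eqP e _ ho _] := hm.
by rewrite -e -(IHn _ ho) modn_mod.
Qed.

Lemma walks_cert n j x os : valid x -> in_orbit j x os ->
  W n x2 (wvtx j x) %% 20 = nth 0 (wtab n) os.1.
Proof.
move=> vx h; rewrite (walks_in_orbit n vx h); have /and4P[/eqP <- _ ho _] := h.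
exact: walks_orep.
Qed.

Lemma sep_cert p n j x u cs i : p \in aut -> valid x -> valid u ->
    p (wvtx j x) = wvtx j x -> p (wvtx true u) = wvtx true u ->
    in_orbits j (cmul x (cinv u)) cs -> sep_at (cvals n cs) i -> i < size (tsr j) ->
  p (wvtx (~~ j) (cmul (nth cone (tsr j) i) x)) =
  wvtx (~~ j) (cmul (nth cone (tsr j) i) x).
Proof.
move=> hp vx vu px pu hc /allP hs hi; have vV := cspanV vu.
have [/eqP sc _] := andP hc.
have val m : m < size (tsr j) ->
    W n (wvtx true u) (wvtx (~~ j) (cmul (nth cone (tsr j) m) x)) %% 20 =
    nth 0 (cvals n cs) m.
  move=> hm; have vm := valid_ts j m; have := in_orbitsP hc hm.
  rewrite walks_shift //; last exact: cspanM.
  have -> : wvtx (~~ j) (cmul (cmul (nth cone (tsr j) m) x) (cinv u)) =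
      wvtx (~~ j) (cmul (nth cone (tsr j) m) (cmul x (cinv u))).
    by rewrite /word_vtx !PM ?mulgA //; exact: cspanM.
  move/walks_cert=> ->; last by do 2![apply: cspanM => //].
  by rewrite (nth_map (0, [::])) ?sc.
apply: (sep_fix hp px pu (n := n)).
  by apply/(nbr_wvtxP mP) => //; exists (nth cone (tsr j) i); rewrite ?mem_nth.
move=> z' /(nbr_wvtxP mP _ _ vx)[t /(nthP cone)[m hm <-] ->].
move/(congr1 (modn^~ 20)); rewrite !val // => /eqP e.
have := hs m; rewrite mem_iota size_map sc hm => /(_ isT).
by rewrite e => /eqP ->.
Qed.

Lemma arc8_okT eps : arc8_ok eps.
Proof. by case: eps; lazy. Qed.

Lemma vlist_arcw eps : vlist (arcw eps).
Proof. by case: eps; vlist_tac. Qed.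

Lemma valid_w8 eps : valid (w8 eps).
Proof. by apply: valid_nth; exact: vlist_arcw. Qed.

Local Notation Y eps := (base_arc P true (arcw eps)).

Lemma sep_allP p n j x u cs t : p \in aut -> valid x -> valid u ->
    p (wvtx j x) = wvtx j x -> p (wvtx true u) = wvtx true u ->
    in_orbits j (cmul x (cinv u)) cs -> sep_all n cs -> t \in tsr j ->
  p (wvtx (~~ j) (cmul t x)) = wvtx (~~ j) (cmul t x).
Proof.
move=> hp vx vu px pu hc /allP hs /(nthP cone)[i hi <-].
have [/eqP sc _] := andP hc.
apply: (sep_cert hp vx vu px pu hc (hs i _) hi).
by rewrite mem_iota sc.
Qed.

(** The ends x_2 and y_8 serve as reference points. The neighbours of y_8 and the vertex u are fixed
    next, and then u and x_2 separate the vertices two steps beyond y_8. *)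
Lemma base8 eps p v w : p \in aut -> (forall m, m <= 8 -> p (Y eps m) = Y eps m) ->
  adj (Y eps 8) v -> v != Y eps 7 -> adj v w -> p v = v /\ p w = w.
Proof.
move=> hp fx; have v8 := valid_w8 eps.
have p8 : p (wvtx true (w8 eps)) = wvtx true (w8 eps) := fx 8 isT.
have p0 : p x2 = x2 := fx 0 isT.
have [ve vd v1] : [/\ valid ge, valid gd & valid (cone)] by split; valid_tac.
have vT b : valid (tA b) by case: b; rewrite /tA; valid_tac.
have ve1 : valid (cmul ge cone) by exact: cspanM.
have vu : valid uword by exact: cspanM.
have := arc8_okT eps; case/and5P=> c0 s0 c1 s1 /and5P[c2 s2 c3 s3 /and5P[c4 s4 back _ _]].
have p9 t : t \in tsr true -> p (wvtx false (cmul t (w8 eps))) = wvtx false (cmul t (w8 eps)).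
  by move=> tt; apply: (sep_allP hp v8 v1 p8 p0 c0 s0 tt).
have pe : p (wvtx false (cmul ge cone)) = wvtx false (cmul ge cone).
  exact: (sep_cert hp v1 v8 p0 p8 c1 s1 (isT : 1 < size (tsr true))).
have pu : p (wvtx true uword) = wvtx true uword.
  exact: (sep_cert hp ve1 v8 pe p8 c2 s2 (isT : 1 < size (tsr false))).
case/(nbr_wvtxP mP _ _ v8) => t tt ->{v} nb; have vt := vtsr tt.
have vtw : valid (cmul t (w8 eps)) by exact: cspanM.
case/(nbr_wvtxP mP _ _ vtw) => t' tt' ->{w}.
split; first exact: p9.
have [et|et] : t = tA eps \/ t = tA (~~ eps).
- move: tt; rewrite !inE => /or3P[/eqP et|/eqP ->|/eqP ->].
  + have v7 : valid (nth cone (arcw eps) 7) by exact: valid_nth (@vlist_arcw eps).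
    case/eqP: nb; rewrite et in vtw *; apply/eqP.
    exact: etrans (wvtx_eq mP false vtw v7) back.
  + by case: (eps); [right | left].
  + by case: (eps); [left | right].
- have pv := p9 _ tt; rewrite et in tt pv vtw *.
  by apply: (sep_allP hp vtw v1 pv p0 c3 s3 tt').
- have pv := p9 _ tt; rewrite et in tt pv vtw *.
  by apply: (sep_allP hp vtw vu pv pu c4 s4 tt').
Qed.

Lemma aut_KD : KD \subset aut. Proof. by rewrite -AA_true; exact: aut_AA. Qed.

Lemma stepY6 eps i : i < 6 -> arc_step adj KD (Y eps) i.
Proof.
move=> hi; rewrite -(AA_true P); apply: arc_step_ext (steps2 mP true hi) => m hm.
have: m <= 6 by exact: leq_trans hm hi.
by rewrite /base_arc; move: m {hm} => [|[|[|[|[|[|[|//]]]]]]] _; case: (eps).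
Qed.

Lemma stepY7 eps : arc_step adj KD (Y eps) 7.
Proof.
rewrite -(AA_true P); apply: (step_okP mP (hs := hs7) (@vlist_arcw eps)).
- vlist_tac.
- have vh : vlist hs7 by vlist_tac.
  by move=> h /vh vx; rewrite (AA_true P); exact: valid_KK.
- by have := arc8_okT eps; case/and5P=> _ _ _ _ /and5P[_ _ _ _ /and5P[]].
Qed.

Lemma Y6_eps eps m : m <= 6 -> Y eps m = Y true m.
Proof. by rewrite /base_arc; move: m => [|[|[|[|[|[|[|//]]]]]]] _; case: (eps). Qed.

(** Six steps form one orbit, the seventh offers the two continuations labelled by [eps], and at the
    eighth K is again transitive. *)
Lemma arc8_base l : arc_from adj 8 x2 l -> exists eps, exists2 g, g \in KD &
  forall m, m <= 8 -> g (Y eps m) = nth x2 (x2 :: l) m.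
Proof.
move=> hl; have [sl pl nl] := arcP hl.
have [g gK hg] := arc_partial (Y := Y true) aut_KD hl (isT : 6 <= 8) (@stepY6 true).
have /graph_autP autg := subsetP aut_KD _ gK.
have a7 : adj (Y true 6) (g^-1 (nth x2 (x2 :: l) 7)).
  by rewrite -autg permKV (hg 6 isT); exact: pl.
have n7 : g^-1 (nth x2 (x2 :: l) 7) != Y true 5.
  rewrite -(inj_eq (@perm_inj _ g)) permKV (hg 5 isT) eq_sym; exact: nl.
have [eps e7] : exists eps, g^-1 (nth x2 (x2 :: l) 7) = Y eps 7.
  have vw6 : valid (nth cone (arcw true) 6) by exact: valid_nth (@vlist_arcw true).
  case/(nbr_wvtxP mP _ _ vw6): a7 => t tt e; rewrite e in n7 *.
  move: tt; rewrite !inE => /or3P[/eqP et|/eqP ->|/eqP ->]; last 2 first.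
  - by exists true.
  - by exists false.
  have v5 : valid (nth cone (arcw true) 5) by exact: valid_nth (@vlist_arcw true).
  have v6 : valid (cmul cone (nth cone (arcw true) 6)) by apply: cspanM => //; exact: cspan1.
  have back : memG false (cmul (cmul cone (nth cone (arcw true) 6))
                               (cinv (nth cone (arcw true) 5))) by lazy.
  case/eqP: n7; rewrite et; apply/eqP.
  exact: etrans (wvtx_eq mP false v6 v5) back.
exists eps; have hg7 m : m <= 7 -> g (Y eps m) = nth x2 (x2 :: l) m.
  rewrite leq_eqVlt => /predU1P[->|hm]; first by rewrite -e7 permKV.
  by rewrite Y6_eps // hg.
have [||h hK [fx mv]] := @stepY7 eps (g^-1 (nth x2 (x2 :: l) 8)).
- by rewrite -autg permKV (hg7 7 isT); exact: pl.
- move=> _; rewrite -(inj_eq (@perm_inj _ g)) permKV (hg7 6 isT) eq_sym; exact: nl.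
exists (h * g); first exact: groupM.
move=> m; rewrite leq_eqVlt => /predU1P[->|hm]; first by rewrite permM mv permKV.
by rewrite permM fx // hg7.
Qed.

(** The type is expressed by the valency, which every automorphism of the graph preserves, whether
    or not it comes from K. *)
Definition btype z := #|nbrs adj z| == 3.

Lemma btype_vtx j g : g \in KK -> btype (vtx j g) = j.
Proof.
move=> gK; rewrite /btype (card_nbrs oK (tsP_side mP) (tsP_cover mP) (tsP_uniq mP) _ gK).
by rewrite size_map; case: j.
Qed.

Lemma btype_aut p z : p \in aut -> btype (p z) = btype z.
Proof. by move=> hp; rewrite /btype graph_aut_nbrs. Qed.

Lemma btype_adj u v : adj u v -> btype v = ~~ btype u.
Proof.
have [i [g gK ->]] := vtxP u; have [j [h hK ->]] := vtxP v.
by rewrite adj_vtx // => /andP[ij _]; rewrite !btype_vtx //; case: i j ij => [] [].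
Qed.

Lemma btypeP z : btype z -> exists2 g, g \in KD & z = g x2.
Proof.
have [j [g gK ->]] := vtxP z; rewrite btype_vtx // => ->.
exists (pi g); first by apply/cosetg_permP => //; exists g.
by rewrite /word_vtx P1 act_vtx // mul1g.
Qed.

Lemma arc8_all z l : btype z -> arc_from adj 8 z l -> exists eps, exists2 g, g \in KD &
  forall m, m <= 8 -> g (Y eps m) = nth z (z :: l) m.
Proof.
case/btypeP=> k kK ->{z} hl; have autk := subsetP aut_KD _ kK.
have autV : k^-1 \in aut by rewrite groupV.
have := arc_from_aut autV hl; rewrite permK => /arc8_base[eps [g gK hg]].
have [sl _ _] := arcP hl.
exists eps; exists (g * k); first exact: groupM.
move=> m hm; rewrite permM hg //; case: m hm => [|m] hm //=.
by rewrite (nth_map (k x2)) ?permKV ?sl.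
Qed.

Lemma other_nbr u v : exists2 w, adj u w & w != v.
Proof.
have [j [g gK ->]] := vtxP u.
have := card_nbrs oK (tsP_side mP) (tsP_cover mP) (tsP_uniq mP) j gK.
rewrite size_map => c.
have /card_gt0P[w] : 0 < #|nbrs adj (vtx j g) :\ v|.
  have := cardsD1 v (nbrs adj (vtx j g)); rewrite c.
  by case: (v \in _) => /=; case: (#|_|) => //; case: (j).
by rewrite !inE => /andP[wv uw]; exists w.
Qed.

Section FixedPoints.

Variable p : {perm cosetg_vertex K1 K2}.
Hypothesis hp : p \in aut.
Local Notation farc := (farc adj btype p).
Local Notation Fx := (Fx adj btype p).

(** An element of K carries the arc to a base arc; conjugation by it reduces the claim to
    [base8]. *)
Lemma farc_ext z y1 y2 y3 y4 y5 y6 y7 y8 y9 y10 :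
    farc z [:: y1; y2; y3; y4; y5; y6; y7; y8] ->
  adj y8 y9 -> y9 != y7 -> adj y9 y10 -> p y9 = y9 /\ p y10 = y10.
Proof.
case/and3P=> ha /allP fx bz a9 n9 a10.
have [eps [g gK hg]] := arc8_all bz ha; have gA := subsetP aut_KD _ gK.
have gAV : g^-1 \in aut by rewrite groupV.
have qA : g * p * g^-1 \in aut by rewrite !groupM.
have /graph_autP autV := gAV.
set l := [:: _; _; _; _; _; _; _; _] in fx hg.
have Yg m : m <= 8 -> g^-1 (nth z (z :: l) m) = Y eps m.
  by move=> hm; rewrite -hg // permK.
have [||||e9 e10] := @base8 eps (g * p * g^-1) (g^-1 y9) (g^-1 y10) qA.
- move=> m hm; rewrite !permM hg // -(Yg m hm); congr (fun_of_perm _ _).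
  by apply/eqP; apply: fx; rewrite mem_nth.
- by rewrite -(Yg 8 isT) autV.
- by rewrite -(Yg 7 isT) (inj_eq perm_inj).
- by rewrite autV.
move: e9 e10; rewrite !permM !permKV.
by split; apply: (@perm_inj _ g^-1).
Qed.

Lemma Fx_stepP z a z' : Fx z -> adj z a -> adj a z' -> p a = a /\ Fx z'.
Proof. exact: (Fx_step (adj_sym oK) btype_adj other_nbr farc_ext). Qed.

Lemma adj_same j g : g \in KK -> adj (vtx j g) (vtx (~~ j) g).
Proof. by move=> gK; apply/(nbr_vtxP oK) => //; exists 1; rewrite ?group1 ?mul1g. Qed.

(** For y in K_2 the vertex does not change; for y in K_1 both vertices are neighbours of K_1 g. *)
Lemma Fx_mul g y : g \in KK -> y \in K1 :|: K2 -> Fx (vtx true g) -> Fx (vtx true (y * g)).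
Proof.
move=> gK /setUP[] hy hF; last first.
  have yK : y \in KK by apply: (subsetP (joing_subr _ _)).
  suff -> : vtx true (y * g) = vtx true g by [].
  by apply/eqP; rewrite (vtx_eq _ (groupM yK gK) gK) mulgK.
have az : adj (vtx false g) (vtx true (y * g)) by apply/(nbr_vtxP oK) => //; exists y.
by have [] := Fx_stepP hF (adj_same true gK) az.
Qed.

Lemma Fx_all : Fx x2 -> p = 1.
Proof.
move=> F0; have F1 : Fx (vtx true 1) by rewrite -P1.
have allF g : g \in KK -> Fx (vtx true g).
  (* Expanding the inverse of g as a product makes the last factor of that product, inverted, the
     first factor of g. *)
  move=> gK; rewrite -[g]invgK; have: g^-1 \in gval KK by rewrite groupV.
  case/gen_prodgP=> n [c hc ->].
  elim: n c hc => [|n IHn] c hc; first by rewrite big_ord0 invg1.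
  rewrite big_ord_recr invgM; apply: Fx_mul; last by apply: IHn => i; apply: hc.
    by rewrite groupV group_prod // => i _; rewrite mem_gen // hc.
  by have := hc ord_max; rewrite !inE !groupV.
apply/permP=> v; rewrite perm1; have [j [g gK ->]] := vtxP v.
case: j; last by have [] := Fx_stepP (allF _ gK) (adj_same true gK) (adj_same false gK).
by have [l /and3P[_ /andP[/eqP]]] := allF _ gK.
Qed.

End FixedPoints.

(** The distinct residues show that no automorphism maps one base arc to the other. *)
Lemma walks_w8 eps : W 14 (Y eps 0) (Y eps 8) %% 20 = if eps then 0 else 18.
Proof.
have := arc8_okT eps; case/and5P=> _ _ _ _ /and5P[_ _ _ _ /and5P[_ _ _ _ h8]].
have := walks_cert 14 (valid_w8 eps) h8 => e; apply: (etrans e).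
by case: (eps); lazy.
Qed.

Lemma aut_KK : KD = graph_aut adj :> {set _}.
Proof.
apply/eqP; rewrite eqEsubset aut_KD; apply/subsetP=> p hp.
have [l hl] := exists_arc8 other_nbr x2; have [sl _ _] := arcP hl.
have [eps [g gK hg]] := arc8_base hl.
have b2 : btype x2 by rewrite /word_vtx P1 btype_vtx.
have bp : btype (p x2) by rewrite btype_aut.
have [eps' [g' gK' hg']] := arc8_all bp (arc_from_aut hp hl).
have [gA gA'] := (subsetP aut_KD _ gK, subsetP aut_KD _ gK').
have pE m : m <= 8 -> nth (p x2) (p x2 :: map p l) m = p (nth x2 (x2 :: l) m).
  by case: m => [|m] hm //=; rewrite (nth_map x2) ?sl.
have ee : eps' = eps.
  have eW : W 14 (Y eps' 0) (Y eps' 8) = W 14 (Y eps 0) (Y eps 8).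
    rewrite -(walks_aut 14 (Y eps 0) (Y eps 8) gA) -(walks_aut 14 (Y eps' 0) (Y eps' 8) gA').
    rewrite (hg 0 isT) (hg 8 isT) (hg' 0 isT) (hg' 8 isT) (pE 0 isT) (pE 8 isT).
    exact: walks_aut.
  have := walks_w8 eps'; rewrite eW walks_w8.
  by case: (eps); case: (eps').
have q1 : p * g'^-1 * g = 1.
  apply: Fx_all; first by rewrite !groupM ?groupV.
  exists l; apply/and3P; split=> //; apply/allP=> v /(nthP x2)[m hm <-].
  rewrite /= sl ltnS in hm; apply/eqP; rewrite !permM -pE // -hg' // permK ee.
  exact: hg.
have -> : p = g^-1 * g'.
  by apply/eqP; rewrite eq_mulgV1 invMg invgK mulgA q1.
by rewrite groupM ?groupV.
Qed.

End Automorphisms.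

(** * The group PSU_3(8) *)

(** The subfield of order 8, starting with 0 and 1. Positions in this list serve as names of its
    elements. *)
Definition F8 := [::
  F64 false false false false false false;
  F64 true false false false false false;
  F64 false true true false true false;
  F64 true true true false true false;
  F64 false true true false false true;
  F64 true true true false false true;
  F64 false false false false true true;
  F64 true false false false true true].

(* The words were found by a search; a pair (p, q) stands for the element       *)
(* dgm p q * D, see hmat. They are indexed by the coordinates of the vector     *)
(* that they map to a multiple of a basis vector.                               *)
Definition words1 : seq (seq (nat * nat)) := [::
  [::]; [::]; [:: (0, 1); (0, 1); (1, 1); (2, 2)];
  [:: (0, 1); (0, 2); (0, 1); (2, 1)]; [:: (0, 1); (2, 1); (2, 1); (2, 2)];
  [:: (0, 1); (1, 2); (2, 1); (1, 1)]; [:: (0, 1); (1, 1); (1, 1); (2, 2)];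
  [:: (0, 1); (2, 2); (0, 1); (2, 1)]; [::]; [:: (0, 0)];
  [:: (0, 1); (1, 1); (0, 1); (2, 2); (2, 1)];
  [:: (0, 1); (0, 1); (2, 1); (2, 1); (2, 2)];
  [:: (0, 1); (0, 1); (0, 1); (2, 2); (0, 1)];
  [:: (0, 1); (0, 1); (2, 1); (2, 1); (0, 2)];
  [:: (0, 1); (1, 2); (0, 1); (1, 1); (0, 1)];
  [:: (0, 1); (0, 1); (1, 1); (2, 1); (0, 2)]; [:: (0, 1); (2, 2); (2, 1); (0, 1)];
  [:: (1, 0); (0, 1); (1, 1); (0, 2); (0, 1)];
  [:: (1, 0); (0, 2); (0, 2); (0, 1); (0, 2)]; [:: (0, 1); (1, 1); (2, 1); (0, 2)];
  [:: (1, 1); (0, 2); (2, 2); (1, 2)]; [:: (1, 2); (0, 2); (2, 1); (0, 2)];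
  [:: (1, 1); (1, 1); (2, 2); (0, 1)]; [:: (1, 2); (1, 1); (2, 1); (1, 1)];
  [:: (0, 1); (1, 1); (1, 1); (0, 2)]; [:: (1, 0); (1, 2); (1, 1); (0, 1); (2, 1)];
  [:: (0, 1); (2, 2); (0, 1); (1, 1)]; [:: (1, 0); (1, 1); (0, 2); (0, 2); (2, 2)];
  [:: (0, 1); (0, 2); (0, 2); (1, 2)]; [:: (0, 0); (0, 1)];
  [:: (0, 1); (0, 1); (2, 2); (0, 1)]; [:: (0, 0); (0, 2)];
  [:: (0, 1); (0, 2); (2, 1); (0, 1)]; [:: (1, 0); (0, 1); (0, 1); (0, 2); (2, 1)];
  [:: (1, 1); (0, 1); (2, 2); (2, 1)]; [:: (1, 2); (2, 1); (1, 1); (2, 1)];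
  [:: (1, 0); (0, 2); (2, 2); (2, 1); (0, 2)]; [:: (0, 1); (0, 1); (2, 1); (0, 2)];
  [:: (1, 1); (1, 2); (0, 2); (0, 2)]; [:: (1, 2); (2, 2); (1, 1); (2, 2)];
  [:: (0, 1); (0, 1); (1, 1); (0, 2)]; [:: (1, 0); (1, 2); (2, 1); (2, 1); (2, 1)];
  [:: (0, 1); (2, 1); (1, 2); (2, 1)]; [:: (0, 0); (0, 2)];
  [:: (0, 1); (0, 2); (0, 1); (1, 1)]; [:: (1, 0); (1, 1); (1, 2); (1, 2); (2, 2)];
  [:: (0, 1); (1, 2); (1, 2); (1, 2)]; [:: (0, 0); (0, 1)];
  [:: (0, 1); (1, 2); (1, 1); (0, 1)]; [:: (1, 0); (0, 1); (2, 1); (2, 2); (2, 1)];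
  [:: (1, 1); (2, 2); (2, 2); (0, 2)]; [:: (1, 2); (1, 2); (2, 1); (1, 2)];
  [:: (1, 1); (2, 1); (1, 2); (1, 1)]; [:: (1, 2); (0, 1); (1, 1); (0, 1)];
  [:: (1, 0); (0, 2); (1, 2); (0, 1); (1, 2)]; [:: (0, 1); (2, 1); (0, 1); (2, 2)];
  [:: (0, 1); (2, 1); (2, 1); (0, 2)]; [:: (1, 0); (1, 2); (0, 1); (2, 1); (0, 1)];
  [:: (0, 1); (2, 2); (0, 2); (0, 2)]; [:: (0, 0); (0, 1)];
  [:: (0, 1); (1, 1); (2, 2); (1, 1)]; [:: (0, 0); (0, 2)];
  [:: (0, 1); (1, 2); (2, 1); (0, 1)]; [:: (1, 0); (1, 1); (2, 2); (0, 2); (1, 2)];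
  [::]; [::]; [:: (0, 1); (0, 1); (1, 1); (2, 2)];
  [:: (0, 1); (0, 2); (0, 1); (2, 1)]; [:: (0, 1); (2, 1); (2, 1); (2, 2)];
  [:: (0, 1); (1, 2); (2, 1); (1, 1)]; [:: (0, 1); (1, 1); (1, 1); (2, 2)];
  [:: (0, 1); (2, 2); (0, 1); (2, 1)]; [::];
  [:: (0, 0); (0, 1); (2, 2); (2, 1); (1, 2)]; [:: (1, 1); (0, 1); (2, 1); (2, 1)];
  [:: (2, 1); (1, 1); (2, 2); (2, 1)]; [:: (0, 1); (2, 1); (0, 1); (0, 1)];
  [:: (1, 1); (0, 1); (2, 2); (1, 1)]; [:: (2, 1); (1, 1); (2, 1); (2, 1)];
  [:: (0, 1); (2, 1); (1, 2); (0, 1)]; [:: (0, 0); (2, 2); (2, 1); (0, 1)];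
  [:: (1, 1); (1, 2); (2, 2); (0, 2)]; [:: (1, 2); (2, 1); (0, 1); (1, 1)];
  [:: (0, 0); (2, 1); (1, 2); (2, 2)]; [:: (0, 1); (1, 2); (1, 1)];
  [:: (1, 2); (1, 2); (2, 1)]; [:: (1, 1); (2, 1); (1, 2)];
  [:: (0, 2); (2, 1); (0, 2)]; [:: (0, 0); (1, 1); (1, 1); (0, 2)];
  [:: (0, 0); (2, 1); (1, 2); (1, 1)]; [:: (0, 0); (1, 2); (0, 2); (0, 1)];
  [:: (0, 0); (2, 2); (2, 1); (0, 2)]; [:: (0, 0); (1, 2); (0, 1)];
  [:: (0, 2); (1, 1); (1, 2); (0, 2); (1, 2)]; [:: (0, 0); (1, 1); (2, 2)];
  [:: (0, 1); (0, 2); (1, 1); (0, 1); (2, 1)]; [:: (0, 0); (0, 2); (2, 1); (0, 1)];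
  [:: (0, 1); (2, 2); (1, 2); (1, 2)]; [:: (0, 1); (1, 1); (2, 2)];
  [:: (2, 2); (0, 1); (0, 2)]; [:: (0, 2); (0, 1); (0, 1); (2, 1)];
  [:: (0, 0); (0, 1); (1, 2); (2, 2)]; [:: (2, 1); (2, 2); (2, 1)];
  [:: (0, 2); (0, 2); (2, 1)]; [:: (0, 0); (0, 1); (1, 1); (0, 2)];
  [:: (1, 1); (1, 2); (2, 1); (2, 2)]; [:: (2, 0); (1, 1); (0, 2)];
  [:: (1, 0); (0, 2); (2, 1); (0, 1); (1, 1)]; [:: (0, 0); (0, 2); (0, 2); (0, 1)];
  [:: (1, 2); (2, 1); (1, 2); (2, 1)]; [:: (2, 0); (1, 2); (1, 1)];
  [:: (1, 0); (0, 1); (1, 2); (2, 2); (0, 2)]; [:: (0, 0); (1, 2); (1, 1); (0, 1)];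
  [:: (0, 0); (2, 1); (0, 1); (2, 1)]; [:: (1, 1); (0, 2); (2, 1)];
  [:: (2, 2); (2, 2); (1, 1)]; [:: (2, 1); (0, 1); (2, 2)];
  [:: (1, 2); (1, 1); (2, 2)]; [:: (0, 0); (2, 2); (2, 2); (0, 2)];
  [:: (0, 0); (1, 1); (0, 2); (0, 2)]; [:: (0, 0); (2, 1); (2, 1); (0, 2)];
  [:: (0, 1); (2, 2); (0, 1); (1, 2)]; [:: (1, 0); (1, 2); (2, 1)];
  [:: (0, 0); (0, 1); (2, 2); (1, 2); (1, 2)]; [:: (1, 0); (1, 1); (1, 2)];
  [:: (0, 0); (0, 2); (0, 1); (0, 1); (2, 1)]; [:: (0, 0); (2, 2); (1, 2); (1, 1)];
  [:: (0, 2); (0, 1); (1, 2); (2, 1)]; [::]; [::];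
  [:: (0, 1); (0, 1); (1, 1); (2, 2)]; [:: (0, 1); (0, 2); (0, 1); (2, 1)];
  [:: (0, 1); (2, 1); (2, 1); (2, 2)]; [:: (0, 1); (1, 2); (2, 1); (1, 1)];
  [:: (0, 1); (1, 1); (1, 1); (2, 2)]; [:: (0, 1); (2, 2); (0, 1); (2, 1)]; [::];
  [:: (0, 0); (0, 1); (2, 1); (0, 1); (0, 1)]; [:: (0, 1); (0, 2); (2, 1); (1, 2)];
  [:: (2, 1); (2, 2); (0, 2); (2, 2)]; [:: (1, 1); (1, 2); (1, 1); (1, 2)];
  [:: (0, 1); (0, 2); (0, 2); (0, 2)]; [:: (2, 1); (2, 2); (2, 1); (1, 2)];
  [:: (1, 1); (1, 2); (1, 2); (0, 2)]; [:: (0, 0); (0, 2); (2, 2); (0, 1)];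
  [:: (0, 2); (1, 2); (1, 1); (0, 2)]; [:: (0, 1); (2, 1); (0, 2); (2, 1)];
  [:: (0, 0); (0, 1); (0, 1); (1, 2)]; [:: (1, 2); (1, 2); (2, 2)];
  [:: (0, 1); (1, 2); (1, 2)]; [:: (0, 2); (2, 1); (2, 1)];
  [:: (1, 1); (2, 1); (0, 1)]; [:: (0, 0); (0, 1); (1, 2); (0, 2)];
  [:: (1, 0); (1, 1); (2, 1); (0, 1)]; [:: (0, 0); (0, 2); (2, 1); (1, 1)];
  [:: (1, 0); (1, 2); (1, 2); (2, 2)]; [:: (1, 0); (2, 2); (0, 2)];
  [:: (1, 1); (0, 1); (0, 1); (2, 2); (2, 1)]; [:: (1, 0); (2, 1); (1, 1)];
  [:: (1, 2); (2, 1); (0, 2); (1, 2); (1, 2)]; [:: (0, 0); (2, 2); (0, 2); (2, 1)];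
  [:: (0, 0); (1, 1); (2, 2); (2, 1)]; [:: (1, 2); (0, 1); (2, 1)];
  [:: (2, 1); (1, 1); (2, 1)]; [:: (0, 0); (1, 2); (0, 1); (0, 2)];
  [:: (0, 0); (2, 1); (1, 1); (2, 2)]; [:: (2, 2); (0, 2); (2, 2)];
  [:: (1, 1); (2, 2); (0, 2)]; [:: (0, 0); (1, 1); (0, 2); (1, 2)];
  [:: (0, 2); (1, 2); (1, 2); (1, 2)]; [:: (2, 0); (2, 1); (0, 1)];
  [:: (0, 0); (0, 2); (1, 2); (1, 1); (0, 2)]; [:: (0, 0); (1, 2); (1, 1); (1, 1)];
  [:: (0, 1); (2, 1); (2, 1); (1, 1)]; [:: (2, 0); (2, 2); (2, 2)];
  [:: (0, 0); (0, 1); (2, 1); (0, 2); (2, 1)]; [:: (0, 0); (1, 2); (2, 2); (0, 1)];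
  [:: (1, 0); (1, 1); (0, 2); (2, 1)]; [:: (0, 2); (2, 2); (0, 2)];
  [:: (2, 1); (0, 2); (0, 2)]; [:: (2, 2); (1, 1); (0, 1)];
  [:: (0, 1); (0, 1); (2, 1)]; [:: (1, 0); (1, 2); (1, 1); (2, 2)];
  [:: (0, 0); (1, 1); (0, 1); (1, 2)]; [:: (0, 0); (2, 1); (1, 2); (0, 2)];
  [:: (0, 0); (1, 1); (0, 1); (2, 1)]; [:: (0, 0); (2, 2); (1, 2)];
  [:: (0, 1); (0, 2); (2, 1); (0, 1); (2, 1)]; [:: (0, 0); (2, 1); (2, 1)];
  [:: (0, 2); (0, 2); (0, 2); (2, 1); (0, 2)]; [:: (0, 0); (2, 2); (2, 1); (1, 1)];
  [:: (0, 0); (1, 2); (2, 2); (0, 2)]]%N.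

Definition words2 : seq (seq (nat * nat)) := [::
  [::]; [::]; [:: (1, 0); (2, 7); (0, 7); (2, 5); (2, 2); (1, 2); (2, 1)];
  [:: (1, 0); (2, 7); (0, 7); (2, 5); (2, 2); (1, 2); (2, 1)];
  [:: (2, 5); (2, 7); (2, 7); (0, 5); (2, 1); (0, 1); (2, 2)];
  [:: (2, 5); (2, 7); (2, 7); (0, 5); (2, 1); (0, 1); (2, 2)];
  [:: (2, 6); (2, 2); (2, 1); (0, 7); (0, 2); (1, 1); (2, 1)];
  [:: (2, 6); (2, 2); (2, 1); (0, 7); (0, 2); (1, 1); (2, 1)]]%N.

(** * Norms, polar coordinates and diagonal matrices *)

(** The norm x^9 from F_64 to F_8. *)
Definition nrm x := fmul (fconj x) x.
Definition bpow n := iter n fmulX f1.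
Definition cmat x := let: CR M _ := x in M.
Definition vmul (v : f64 * f64 * f64) M :=
  let: (x, y, z) := v in let: M9 a b c d e f g h i := M in
  (dot3 x y z a d g, dot3 x y z b e h, dot3 x y z c f i).
Definition vscale s (v : f64 * f64 * f64) :=
  let: (x, y, z) := v in (fmul s x, fmul s y, fmul s z).
Definition row1 M := let: M9 a b c _ _ _ _ _ _ := M in (a, b, c).
Definition row2 M := let: M9 _ _ _ d e f _ _ _ := M in (d, e, f).

(** The diagonal matrix C^p E^q; the exponent 8 q stands for -q modulo 9. *)
Definition dgm p q := cdiag (bpow p) (bpow (4 * p + q)%N) (bpow (4 * p + 8 * q)%N).
Definition mpow M n := iter n (cmmul M) cmone.
Definition hmat (ws : seq (nat * nat)) :=
  foldr (fun pq M => cmmul (cmmul (dgm pq.1 pq.2) (cmat gd)) M) cmone ws.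

Notation f8 n := (nth f0 F8 n).
Definition isE1 (v : f64 * f64 * f64) := let: (_, y, z) := v in feq y f0 && feq z f0.
Definition isE2 (v : f64 * f64 * f64) := let: (x, _, z) := v in feq x f0 && feq z f0.

(** The index determines n_3: on F_8 the norm is squaring, so a vector of norm 1 has n_1 + n_2 + n_3
    = 1. A power of A brings the resulting basis vector to e_1. *)
Definition word1_ok e n1 n2 n3 :=
  feq (fadd (nrm (f8 n1)) (fadd (nrm (f8 n2)) (nrm (f8 n3)))) f1 ==>
  let v := vmul (fmul (bpow e) (f8 n1), f8 n2, f8 n3)
                (hmat (nth [::] words1 (64 * e + 8 * n1 + n2))) in
  has (fun k => isE1 (vmul v (mpow (cmat ga) k))) (iota 0 3).
Definition words1_ok := all (fun e => all (fun n1 => all (fun n2 => all (fun n3 =>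
  word1_ok e n1 n2 n3) (iota 0 8)) (iota 0 8)) (iota 0 8)) (iota 0 3).

(** Both e_1 and a vector orthogonal to it are followed; A^k F^l then puts the two resulting basis
    vectors in the positions 1 and 2. *)
Definition word2_ok n2 n3 :=
  feq (fadd (nrm (f8 n2)) (nrm (f8 n3))) f1 ==>
  let M := hmat (nth [::] words2 n2) in
  let e := vmul (f1, f0, f0) M in let v := vmul (f0, f8 n2, f8 n3) M in
  has (fun k => has (fun l => let Q := cmmul (mpow (cmat ga) k) (mpow (cmat gf) l) in
    isE1 (vmul e Q) && isE2 (vmul v Q)) (iota 0 2)) (iota 0 3).
Definition words2_ok :=
  all (fun n2 => all (word2_ok n2) (iota 0 8)) (iota 0 8).

Definition dgm_ok := all (fun p => all (fun q =>
  cmeq (dgm p q) (cmmul (mpow (cmat gc) p) (mpow (cmat ge) q))) (iota 0 9)) (iota 0 9).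

(** The group F_64^* is the direct product of <b>, of order 9, and F_8^*. *)
Definition polar_ok := f64_all (fun x => has (fun n => has (fun i =>
  feq x (fmul (bpow i) (f8 n))) (iota 0 9)) (iota 0 8)).
Definition nrm_ok := all (fun n => all (fun i =>
  feq (nrm (fmul (bpow i) (f8 n))) (nrm (f8 n))) (iota 0 9)) (iota 0 8).
Definition unit_ok := f64_all (fun x =>
  feq (nrm x) f1 ==> has (fun i => feq x (bpow i)) (iota 0 9)).

(* Exponents by which a vector (b^i n1, b^j n2, b^k n3), with b of order 9 and *)
(* n1, n2, n3 in F_8, is brought to a multiple of (b^e n1, n2, n3).            *)
Definition exp_e i j k := (i + j + k) %% 3.
Definition exp_s i j k := (i + j + k) %/ 3.
Definition exp_p i j k := (exp_s i j k + exp_e i j k + (9 - i)) %% 9.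
Definition exp_q i j k := (exp_s i j k + 5 * exp_p i j k + (9 - j)) %% 9.
Definition exps_ok := all (fun i => all (fun j => all (fun k =>
  let s := bpow (exp_s i j k) in let p := exp_p i j k in let q := exp_q i j k in
  [&& feq (fmul (bpow p) (bpow i)) (fmul s (bpow (exp_e i j k))),
      feq (fmul (bpow (4 * p + q)) (bpow j)) s &
      feq (fmul (bpow (4 * p + 8 * q)) (bpow k)) s]) (iota 0 9)) (iota 0 9)) (iota 0 9).

(** Solves 4p + q + j = 0 and 4p - q + k = 0 modulo 9; the sum of the two equations gives p = j +
    k. *)
Definition exp2_p j k := (j + k) %% 9.
Definition exp2_q j k := (5 * (j + k) + (9 - j)) %% 9.
Definition exps2_ok := all (fun j => all (fun k =>
  let p := exp2_p j k in let q := exp2_q j k in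
  feq (fmul (bpow (4 * p + q)) (bpow j)) f1 &&
  feq (fmul (bpow (4 * p + 8 * q)) (bpow k)) f1) (iota 0 9)) (iota 0 9).

(** Diagonal matrices of determinant 1 with entries of norm 1 are the C^i E^q. *)
Definition diag_ok := all (fun i => all (fun j =>
  let q := (j + 5 * i) %% 9 in
  feq (bpow (4 * i + q)) (bpow j) &&
  feq (fmul (bpow i) (fmul (bpow j) (bpow (4 * i + 8 * q)))) f1) (iota 0 9)) (iota 0 9).

Lemma all_iotaP (n : nat) (q : pred nat) : all q (iota 0 n) -> forall i, i < n -> q i.
Proof. by move/allP=> h i hi; apply: h; rewrite mem_iota. Qed.

Notation lspan M := (hvalid (CR M 0)).

Lemma lspanM M N : lspan M -> lspan N -> lspan (cmmul M N).
Proof. exact: cspanM. Qed.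

Lemma lspan1 : lspan cmone. Proof. exact: cspan1. Qed.

Lemma lspan_mpow M n : lspan M -> lspan (mpow M n).
Proof. by move=> hM; elim: n => [|n IHn]; [exact: lspan1 | exact: lspanM]. Qed.

Lemma lspan_dgm p q : p < 9 -> q < 9 -> lspan (dgm p q).
Proof.
have ok : dgm_ok by lazy.
move=> hp hq; have /cmeqP-> := all_iotaP (all_iotaP ok hp) hq.
by apply: lspanM; apply: lspan_mpow; apply: cspan_gen.
Qed.

Lemma lspan_hmat ws : all (fun pq => (pq.1 < 9) && (pq.2 < 9)) ws -> lspan (hmat ws).
Proof.
elim: ws => [_|[p q] ws IHws /andP[/andP[hp hq] hw]]; first exact: lspan1.
apply: lspanM; last exact: IHws.
by apply: lspanM; [exact: lspan_dgm | apply: cspan_gen].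
Qed.

Lemma lspan_words (l : seq (seq (nat * nat))) i :
  all (all (fun pq => (pq.1 < 9) && (pq.2 < 9))) l -> lspan (hmat (nth [::] l i)).
Proof.
move/allP=> hl; apply: lspan_hmat; have [hi|hi] := ltnP i (size l).
  by apply: hl; rewrite mem_nth.
by rewrite nth_default.
Qed.

Lemma row1M M N : row1 (cmmul M N) = vmul (row1 M) N.
Proof. by case: M N => [? ? ? ? ? ? ? ? ?] []. Qed.

Lemma row2M M N : row2 (cmmul M N) = vmul (row2 M) N.
Proof. by case: M N => [? ? ? ? ? ? ? ? ?] []. Qed.

Lemma isE1P v : isE1 v -> exists c, v = (c, f0, f0).
Proof. by case: v => [[x y] z] /= /andP[]; rewrite !feqE => /eqP-> /eqP->; exists x. Qed.

Lemma isE2P v : isE2 v -> exists c, v = (f0, c, f0).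
Proof. by case: v => [[x y] z] /= /andP[]; rewrite !feqE => /eqP-> /eqP->; exists y. Qed.

Lemma polarP x : exists i n, [/\ i < 9, n < 8 & x = fmul (bpow i) (f8 n)].
Proof.
have ok : polar_ok by lazy.
have /hasP[n hn /hasP[i hi]] := f64_allP ok x; rewrite feqE => /eqP e.
by exists i, n; rewrite !mem_iota in hi hn.
Qed.

Lemma nrm_polar i n : i < 9 -> n < 8 -> nrm (fmul (bpow i) (f8 n)) = nrm (f8 n).
Proof.
have ok : nrm_ok by lazy.
by move=> hi hn; have := all_iotaP (all_iotaP ok hn) hi; rewrite feqE => /eqP.
Qed.

Lemma unitP x : nrm x = f1 -> exists2 i, i < 9 & x = bpow i.
Proof.
have ok : unit_ok by lazy.
move=> hx; have := f64_allP ok x; rewrite hx => /implyP/(_ isT)/hasP[i].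
by rewrite mem_iota feqE => hi /eqP; exists i.
Qed.

(** * Reduction of SU_3(8) to words, and the structure of H and K *)

Section Special.

Variables (F : finFieldType) (hF : #|F| = 64) (zeta : F).
Hypothesis hzeta : (63.-primitive_root zeta)%R.
Local Notation ev := (fev zeta).
Local Notation mev := (mev zeta).
Local Notation pgl := (pgl zeta).

Ltac evring := apply: (fev_inj hF hzeta);
  rewrite /dot3 ?(fevD hF, fevM hF hzeta, fev0, fev1); ring.

Lemma vmulA v M N : vmul v (cmmul M N) = vmul (vmul v M) N.
Proof.
case: v M N => [[x y] z] [a b c d e f g h i] [a' b' c' d' e' f' g' h' i'] /=.
by congr (_, _, _); evring.
Qed.

Lemma vscale_vmul s v M : vmul (vscale s v) M = vscale s (vmul v M).
Proof.
case: v M => [[x y] z] [a b c d e f g h i] /=.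
by congr (_, _, _); evring.
Qed.

Lemma vmul_diag x y z a b c : vmul (x, y, z) (cdiag a b c) = (fmul a x, fmul b y, fmul c z).
Proof. by rewrite /cdiag /=; congr (_, _, _); evring. Qed.

Lemma fmulx0 x : fmul x f0 = f0. Proof. evring. Qed.

Lemma vscale0 s c : vscale s (c, f0, f0) = (fmul s c, f0, f0).
Proof. by rewrite /vscale !fmulx0. Qed.

(** Polar coordinates and a diagonal matrix of H bring the vector to a tabulated one (b^e n_1, n_2,
    n_3), up to the scalar s. *)
Lemma reach1 x y z : fadd (nrm x) (fadd (nrm y) (nrm z)) = f1 ->
  exists2 N, lspan N & exists c, vmul (x, y, z) N = (c, f0, f0).
Proof.
have [i [n1 [hi h1 ->]]] := polarP x; have [j [n2 [hj h2 ->]]] := polarP y.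
have [k [n3 [hk h3 ->]]] := polarP z; rewrite !nrm_polar // => hu.
have okw : words1_ok by lazy.
have okE : exps_ok by lazy.
have he : exp_e i j k < 3 by exact: ltn_pmod.
have hp : exp_p i j k < 9 by exact: ltn_pmod.
have hq : exp_q i j k < 9 by exact: ltn_pmod.
have := all_iotaP (all_iotaP (all_iotaP (all_iotaP okw he) h1) h2) h3.
rewrite /word1_ok hu => /implyP/(_ isT)/hasP[m _ /isE1P[c ec]].
have /and3P := all_iotaP (all_iotaP (all_iotaP okE hi) hj) hk.
rewrite !feqE => -[/eqP e1 /eqP e2 /eqP e3].
set M := hmat _ in ec; set s := bpow (exp_s i j k) in e1 e2 e3.
exists (cmmul (dgm (exp_p i j k) (exp_q i j k)) (cmmul M (mpow (cmat ga) m))).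
  apply: lspanM; first exact: lspan_dgm hp hq.
  apply: lspanM; first by apply: lspan_words; lazy.
  by apply: lspan_mpow; apply: cspan_gen.
exists (fmul s c); rewrite vmulA vmul_diag.
set v := (fmul (bpow (exp_e i j k)) (f8 n1), f8 n2, f8 n3) in ec.
have -> : (fmul (bpow (exp_p i j k)) (fmul (bpow i) (f8 n1)),
           fmul (bpow (4 * exp_p i j k + exp_q i j k)) (fmul (bpow j) (f8 n2)),
           fmul (bpow (4 * exp_p i j k + 8 * exp_q i j k)) (fmul (bpow k) (f8 n3)))
        = vscale s v.
  have fA a b c' : fmul a (fmul b c') = fmul (fmul a b) c' by evring.
  by rewrite /v /= !fA e1 e2 e3.
by rewrite vscale_vmul vmulA ec vscale0.
Qed.

(** The word has to keep the line of e_1, so that the first row of a matrix, once reduced, remains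
    so while the second is treated. *)
Lemma reach2 y z : fadd (nrm y) (nrm z) = f1 ->
  exists2 N, lspan N & (forall x, exists c, vmul (x, f0, f0) N = (c, f0, f0)) /\
    exists c, vmul (f0, y, z) N = (f0, c, f0).
Proof.
have [j [n2 [hj h2 ->]]] := polarP y; have [k [n3 [hk h3 ->]]] := polarP z.
rewrite !nrm_polar // => hu.
have okw : words2_ok by lazy.
have okE : exps2_ok by lazy.
have hp : exp2_p j k < 9 by exact: ltn_pmod.
have hq : exp2_q j k < 9 by exact: ltn_pmod.
have := all_iotaP (all_iotaP okw h2) h3.
rewrite /word2_ok hu => /implyP/(_ isT)/hasP[m _ /hasP[l _ /andP[/isE1P[c1 ec1] /isE2P[c2 ec2]]]].
have /andP := all_iotaP (all_iotaP okE hj) hk.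
rewrite !feqE => -[/eqP e2 /eqP e3].
set M := hmat _ in ec1 ec2; set Q := cmmul (mpow _ m) _ in ec1 ec2.
exists (cmmul (dgm (exp2_p j k) (exp2_q j k)) (cmmul M Q)).
  apply: lspanM; first exact: lspan_dgm hp hq.
  apply: lspanM; first by apply: lspan_words; lazy.
  by apply: lspanM; apply: lspan_mpow; apply: cspan_gen.
split=> [x|].
  exists (fmul (fmul (bpow (exp2_p j k)) x) c1).
  rewrite vmulA vmul_diag !fmulx0 -{1}[fmul _ x](_ : fmul (fmul (bpow (exp2_p j k)) x) f1 = _); last by evring.
  have -> : (fmul (fmul (bpow (exp2_p j k)) x) f1, f0, f0)
     = vscale (fmul (bpow (exp2_p j k)) x) (f1, f0, f0) by rewrite vscale0.
  by rewrite vscale_vmul vmulA ec1 vscale0.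
exists c2; rewrite vmulA vmul_diag fmulx0.
have fA a b c' : fmul a (fmul b c') = fmul (fmul a b) c' by evring.
have f1x a : fmul f1 a = a by evring.
by rewrite !fA e2 e3 !f1x vmulA.
Qed.

Definition special m : Prop :=
  cmmul m (cmtr (cmmap fconj m)) = cmone /\ cmdet m = f1.

Lemma special_mev m : special m <->
  (mev m *m starmx (mev m) = 1%:M)%R /\ (\det (mev m) = 1)%R.
Proof.
rewrite /special (mev_det hF hzeta) -(mev_star hF hzeta) -(mevM hF hzeta).
split=> [[-> ->]|[e d]]; first by rewrite mev1 fev1.
split; first by apply: (mev_inj hF hzeta); rewrite e mev1.
by apply: (fev_inj hF hzeta); rewrite d fev1.
Qed.

Lemma lspan_special N : lspan N -> special N.
Proof.
by move/hvalid_valid/(valid_unitary hF hzeta)=> [d u _]; apply/special_mev.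
Qed.

Lemma specialM m N : special m -> special N -> special (cmmul m N).
Proof.
move=> /special_mev[u d] /special_mev[u' d']; apply/special_mev.
rewrite (mevM hF hzeta) det_mulmx d d' mulr1 (starmxM hF); split=> //.
by rewrite mulmxA -(mulmxA (mev m)) u' mulmx1 u.
Qed.

Lemma lspan_cancel m N : lspan N -> lspan (cmmul m N) -> lspan m.
Proof.
move=> hN hm; have hV : lspan (cmtr (cmmap fconj N)) by exact: cspanV hN.
have := lspanM hm hV; have /special_mev[u _] := lspan_special hN.
suff -> : cmmul (cmmul m N) (cmtr (cmmap fconj N)) = m by [].
apply: (mev_inj hF hzeta); rewrite !(mevM hF hzeta) (mev_star hF hzeta).
by rewrite -mulmxA u mulmx1.
Qed.

Lemma fconj0 : fconj f0 = f0. Proof. by []. Qed.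

Lemma dot3_conj0 a b c u : dot3 a b c u f0 f0 = fmul u a.
Proof. evring. Qed.

Lemma dot3_conj1 a b c u : dot3 a b c f0 u f0 = fmul u b.
Proof. evring. Qed.

Lemma orth0 x d : nrm x = f1 -> fmul (fconj x) d = f0 -> d = f0.
Proof.
move=> /(congr1 ev); rewrite /nrm (fevM hF hzeta) fev1 => hx.
move/(congr1 ev); rewrite (fevM hF hzeta) fev0 => /eqP; rewrite mulf_eq0.
case/orP=> /eqP e0; last by apply: (fev_inj hF hzeta); rewrite e0 fev0.
by move/eqP: hx; rewrite e0 mul0r eq_sym oner_eq0.
Qed.

Lemma special_lspan m : special m -> lspan m.
Proof.
have rows a b c d e f g h i : special (M9 a b c d e f g h i) ->
  [/\ dot3 a b c (fconj a) (fconj b) (fconj c) = f1,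
      dot3 d e f (fconj a) (fconj b) (fconj c) = f0,
      dot3 d e f (fconj d) (fconj e) (fconj f) = f1,
      dot3 g h i (fconj a) (fconj b) (fconj c) = f0
    & dot3 g h i (fconj d) (fconj e) (fconj f) = f0].
  by case=> -[? _ _ ? ? _ ? ? _] _.
move=> sm; have [N1 l1 [c1 e1]] : exists2 N, lspan N & exists c, row1 (cmmul m N) = (c, f0, f0).
  case: m sm => a b c d e f g h i /rows[hu _ _ _ _].
  have [N lN [c' ec]] := reach1 hu; exists N => //; exists c'; by rewrite row1M.
apply: (lspan_cancel l1); move: (specialM sm (lspan_special l1)) e1.
move: (cmmul m N1) => {}m {}sm e1.
have [y [z [er hu1 hu2]]] : exists y z, [/\ row2 m = (f0, y, z), nrm c1 = f1
    & fadd (nrm y) (nrm z) = f1].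
  case: m sm e1 => a b c d e f g h i /rows[h1 h2 h3 _ _] [ea eb ec].
  rewrite {}ea {}eb {}ec fconj0 !dot3_conj0 in h1 h2.
  have d0 := orth0 h1 h2; rewrite {}d0 in h3 *.
  exists e, f; split=> //; rewrite -[RHS]h3 /nrm; evring.
have [N2 l2 [h1 [c2 h2]]] := reach2 hu2.
have [c1' h1'] := h1 c1.
apply: (lspan_cancel l2); move: (specialM sm (lspan_special l2)).
have := row1M m N2; have := row2M m N2; rewrite e1 er h1' h2.
case: (cmmul m N2) => a b c d e f g h i [-> -> ->] [-> -> ->] {}sm.
have [h3 _ h4 h5 h6] := rows _ _ _ _ _ _ _ _ _ sm.
rewrite fconj0 !dot3_conj0 in h3 h5; rewrite fconj0 !dot3_conj1 in h4 h6.
have g0 := orth0 h3 h5; have h0 := orth0 h4 h6; rewrite {}g0 {}h0 in sm *.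
have [p hp ep] := unitP h3; have [j hj ej] := unitP h4.
have okd : diag_ok by lazy.
have /andP := all_iotaP (all_iotaP okd hp) hj; rewrite !feqE => -[/eqP eq1 /eqP eq2].
have [_ hd] := sm.
(* The second entry forces q = j - 4p modulo 9, written j + 5p; the determinant then gives the third
   entry. *)
suff -> : M9 c1' f0 f0 f0 c2 f0 f0 f0 i = dgm p ((j + 5 * p) %% 9).
  exact: lspan_dgm hp (ltn_pmod _ (isT : 0 < 9)).
rewrite /dgm /cdiag ep ej eq1; congr (M9 _ _ _ _ _ _ _ _ _).
apply: (fev_inj hF hzeta); move/(congr1 ev): hd; move/(congr1 ev): eq2.
rewrite ep ej /cmdet ?(fevD hF, fevM hF hzeta, fev0, fev1) => eq2 hd.
have hd' : (ev (bpow p) * ev (bpow j) * ev i = 1)%R by rewrite -hd; ring.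
have nz : (ev (bpow p) * ev (bpow j) != 0)%R.
  by apply: contra_eq_neq hd' => ->; rewrite mul0r eq_sym oner_eq0.
by apply: (mulfI nz); rewrite hd' -eq2 mulrA.
Qed.

Local Notation s := (sbar F).

Lemma model_pgl : model pgl.
Proof.
split; [exact: pgl1 | exact: pglM hF _ hzeta | exact: pglV hF _ hzeta |].
exact: pgl_eq hF _ hzeta.
Qed.
Local Notation mP := model_pgl.

Lemma mev_surj M : exists m, M = mev m.
Proof.
have [q qE] : exists q : F -> f64, forall c, c = ev (q c).
  have h c : exists x, c == ev x by have [x ->] := fev_surj hF hzeta c; exists x.
  by exists (fun c => xchoose (h c)) => c; exact/eqP/(xchooseP (h c)).
pose o i : 'I_3 := inord i; pose t i j := q (M (o i) (o j)).
exists (M9 (t 0 0) (t 0 1%N) (t 0 2) (t 1%N 0) (t 1%N 1%N) (t 1%N 2) (t 2 0) (t 2 1%N) (t 2 2)).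
apply: mx3P => i j hi hj; rewrite mx3E //.
by move: i hi j hj => [|[|[|//]]] _ [|[|[|//]]] _ /=; rewrite -qE.
Qed.

Lemma special_isometry M : (\det M = 1)%R -> isometry_mx M ->
  exists2 m, special m & M = mev m.
Proof.
move=> d /'forall_forallP iM; have [m e] := mev_surj M; exists m => //.
apply/special_mev; rewrite -e; split=> //; apply: (star_isometry hF) => u v.
exact/eqP.
Qed.

Lemma pgl_linear m : pgl (CR m 0) = bar (mx_perm (mev m)).
Proof. exact: pgl_mx. Qed.

Lemma pgl_PSU3 m : special m -> pgl (CR m 0) \in PSU3 F.
Proof.
move=> /special_mev[u d]; rewrite pgl_linear; apply: mem_quotient; apply/SU3P.
exists (mev m); split=> //; first exact: (isometry_star hF).
by move=> v; rewrite mx_permE // unitary_unit.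
Qed.

Lemma PSU3P y : y \in PSU3 F -> exists2 m, special m & y = pgl (CR m 0).
Proof.
case/morphimP=> g _ /SU3P[M [d iM gM]] ->.
have [|m sm e] := special_isometry d; first by apply/'forall_forallP=> u v; apply/eqP.
exists m => //; rewrite pgl_linear -e; congr (coset _ _); apply/permP=> v.
by rewrite gM mx_permE // e unitary_unit //; case/special_mev: sm.
Qed.

Lemma PSU3_HH : PSU3 F \subset HH pgl.
Proof. by apply/subsetP=> _ /PSU3P[m /special_lspan lm ->]; exact: (hvalid_HH mP). Qed.

Lemma sX k : s ^+ k = pgl (CR cmone k). Proof. by rewrite pgl_sigma. Qed.

Lemma s6 : s ^+ 6 = 1.
Proof. by rewrite /sbar /bar -morphX ?(sigma_norm hF) // (sigma6 hF hzeta) morph1. Qed.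

Lemma valid_sX k : k < 6 -> valid (CR cmone k).
Proof.
have [vt vr] : valid gt /\ valid gr by split; valid_tac.
move: k => [|[|[|[|[|[|//]]]]]] _.
- exact: cspan1.
- exact: (cspanM vt (cspanM vr vr)).
- exact: vr.
- exact: vt.
- exact: (cspanM vr vr).
- exact: (cspanM vt vr).
Qed.

Lemma PSU3_sX m k : special m -> k < 6 -> pgl (CR m 0) = s ^+ k -> k = 0.
Proof.
move=> /special_lspan/hvalid_valid vm hk; rewrite sX => /eqP.
by rewrite (modelE mP) //; [case: k {hk} | exact: valid_sX].
Qed.

Lemma order_s : #[s] = 6.
Proof.
apply/eqP; rewrite eqn_dvd order_dvdn s6 eqxx /=; apply/eqP.
have sp1 : special cmone by apply: lspan_special; exact: lspan1.
apply: (PSU3_sX sp1); first exact: ltn_pmod.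
by rewrite expg_mod ?s6 // expg_order; exact: pgl1.
Qed.

Lemma conj_s M : (\det M = 1)%R -> isometry_mx M ->
  bar (mx_perm M) ^ s = bar (mx_perm (map_mx (@rho F) M)).
Proof.
move=> d /(special_isometry d)[m /special_mev[u _] ->].
have := mx_perm_sigma hF hzeta 1 (unitary_unit u); rewrite !expg1 => e.
have u' := frob_unitary hF hzeta 1 u.
rewrite -(mev_frob hF hzeta); apply: (mulgI s); rewrite -conjgC /sbar /bar.
have nG : forall N : 'M[F]_3, (N *m starmx N = 1%:M)%R -> mx_perm N \in 'N(scalars F).
  by move=> N uN; apply: (subsetP (GammaU3_norm F)); exact: mx_perm_GammaU3.
by rewrite -!morphM ?nG ?(sigma_norm hF) // e.
Qed.

Lemma s_norm : s \in 'N(PSU3 F).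
Proof.
rewrite inE; apply/subsetP=> _ /imsetP[_ /PSU3P[m /special_mev[u d] ->] ->].
rewrite pgl_linear conj_s //; last first.
  by apply/'forall_forallP=> v w; apply/eqP; exact: (isometry_star hF).
rewrite -(mev_frob hF hzeta) -pgl_linear; apply: pgl_PSU3; apply/special_mev.
split; first exact: (frob_unitary hF hzeta 1 u).
by rewrite (frob_det hF hzeta 1) d /= /rho expr1n.
Qed.

Lemma PSU3_TI : PSU3 F :&: <[s]> = 1.
Proof.
apply/trivgP/subsetP=> _ /setIP[/PSU3P[m sm ->] /cycleP[i e]].
have k0 := PSU3_sX sm (ltn_pmod i (isT : 0 < 6)).
by rewrite inE e -(expg_mod i s6) k0 // expg_mod ?s6.
Qed.

Lemma hgens_PSU3 x : x \in hgens -> pgl x \in PSU3 F <*> <[s ^+ 3]>.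
Proof.
have lin y : y \in hgens -> CR (cmat y) 0 = y -> pgl y \in PSU3 F <*> <[s ^+ 3]>.
  move=> hy e; apply: (subsetP (joing_subl _ _)); rewrite -e; apply: pgl_PSU3.
  by apply: lspan_special; rewrite e; exact: cspan_gen.
move=> hx; have := hx; rewrite !inE.
do 6?[case/predU1P=> [ex|]; first by apply: lin => //; rewrite ex].
move/eqP->; apply: (subsetP (joing_subr _ _)).
by rewrite -[gt]/(CR cmone 3) -sX cycle_id.
Qed.

Lemma HH_PSU3 : HH pgl = PSU3 F <*> <[s ^+ 3]> :> {set _}.
Proof.
apply/eqP; rewrite eqEsubset; apply/andP; split.
  rewrite join_subG !gen_subG; apply/andP; split; apply/subsetP=> _ /psetP[x xx ->];
    apply: hgens_PSU3; move: x xx; exact/allP.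
rewrite join_subG PSU3_HH cycle_subG sX; apply: (hvalid_HH mP).
by apply: cspan_gen.
Qed.

Lemma KK_PSU3 : KK pgl = PSU3 F <*> <[s]> :> {set _}.
Proof.
rewrite -(AA_true pgl) [LHS]/= -[<<_>> <*> _]/(gval (HH pgl)) HH_PSU3.
have er : pgl gr = s ^+ 2 by rewrite sX.
apply/eqP; rewrite eqEsubset !join_subG !cycle_subG er; apply/andP; split.
  rewrite joing_subl /= !(subsetP (joing_subr _ _)) ?mem_cycle //.
pose A := (PSU3 F <*> <[s ^+ 3]> <*> <[s ^+ 2]>)%G; rewrite -/A; have h3 : s ^+ 3 \in A.
  by apply: (subsetP (joing_subl _ _)); apply: (subsetP (joing_subr _ _)); exact: cycle_id.
have h2 : s ^+ 2 \in A by apply: (subsetP (joing_subr _ _)); exact: cycle_id.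
rewrite (subset_trans (joing_subl _ _) (joing_subl _ _)) /=.
suff : s ^+ 3 * (s ^+ 2)^-1 \in A by rewrite (expgS s 2) mulgK.
by rewrite groupM ?groupV.
Qed.

(** Otherwise sigma^2 = x sigma^(3i) with x in PSU_3(8); then x is also a power of sigma, hence
    trivial, and 2 = 3i modulo 6 is absurd modulo 3. This discharges the assumption under which H
    and K are compared. *)
Lemma r_HH : pgl gr \notin HH pgl.
Proof.
rewrite HH_PSU3 norm_joinEr ?cycle_subG ?groupX ?s_norm //.
have -> : pgl gr = s ^+ 2 by rewrite sX.
apply/negP=> /mulsgP[x _ xP /cycleP[i ->] e].
have xs : x \in PSU3 F :&: <[s]>.
  rewrite inE xP -(mulgK (s ^+ 3 ^+ i) x) -e groupM ?groupV ?groupX ?cycle_id //.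
move: xs; rewrite PSU3_TI => /set1P x1; move: e; rewrite x1 mul1g -expgM => /eqP.
rewrite eq_expg_mod_order order_s => /eqP /(congr1 (modn^~ 3)).
by rewrite !modn_dvdm // mulnC modnMl.
Qed.

Lemma isog_H : HH pgl \isog PSU3 F ><| <[s ^+ 3]>.
Proof.
rewrite sdprodEY ?cycle_subG ?groupX ?s_norm //; first by rewrite -HH_PSU3 isog_refl.
by apply/trivgP; rewrite -PSU3_TI setIS // cycleX.
Qed.

Lemma isog_K : KK pgl \isog PSU3 F ><| <[s]>.
Proof.
by rewrite sdprodEY ?cycle_subG ?s_norm ?PSU3_TI // -KK_PSU3 isog_refl.
Qed.

(** E detects the order: conjugation by sigma^n maps it to E^(2^n), and 2 has order 6 modulo 9, the
    order of E in PSU_3(8). *)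
Lemma order_conj_s : #[conj_aut (PSU3 F) s] = 6.
Proof.
have cX n : conj_aut (PSU3 F) s ^+ n = conj_aut (PSU3 F) (s ^+ n).
  by rewrite -morphX ?s_norm.
apply/eqP; rewrite eqn_dvd order_dvdn cX s6 morph1 eqxx /=; apply/eqP.
set n := #[_]; have hn : n %% 6 < 6 by exact: ltn_pmod.
have ve : valid ge by valid_tac.
have eP : pgl ge \in PSU3 F.
  have le : lspan (cmat ge) by apply: cspan_gen.
  exact: (pgl_PSU3 (lspan_special le)).
have := cX n; rewrite expg_order => /esym/permP/(_ (pgl ge)).
rewrite perm1 (norm_conj_autE (groupX n s_norm) eP) => e.
have {e} : pgl ge * s ^+ (n %% 6) = s ^+ (n %% 6) * pgl ge.
  by rewrite (expg_mod n s6) conjgC e.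
have vk := valid_sX hn.
rewrite sX -!(modelM mP) // => /eqP; rewrite (modelE mP); try exact: cspanM.
by move: (n %% 6) hn {vk} => [|[|[|[|[|[|//]]]]]].
Qed.

Lemma grpH1E : grpH1 zeta = H1 pgl.
Proof.
apply: val_inj; rewrite /= /pset /= !set_cons set_nil setU0 -[gt]/(CR cmone 3) -sX.
by rewrite pgl_a pgl_b // pgl_c // pgl_d // !setUA.
Qed.

Lemma grpH2E : grpH2 zeta = H2 pgl.
Proof.
apply: val_inj; rewrite /= /pset /= !set_cons set_nil setU0 -[gt]/(CR cmone 3) -sX.
by rewrite pgl_a pgl_b // pgl_c // pgl_e // pgl_f !setUA.
Qed.

Lemma grpK1E : grpK1 zeta = G1 pgl true.
Proof.
by rewrite /grpK1 grpH1E; apply: val_inj; rewrite /= -[gr]/(CR cmone 2) -sX.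
Qed.

Lemma grpK2E : grpK2 zeta = G2 pgl true.
Proof.
by rewrite /grpK2 grpH2E; apply: val_inj; rewrite /= -[gr]/(CR cmone 2) -sX.
Qed.

End Special.

Theorem theorem1p1 (F : finFieldType) (hF : #|F| = 64) (zeta : F)
    (hzeta : (63.-primitive_root zeta)%R)
    (S0 : {group {perm 'rV['F_3]_2}}) (hS0 : S0 \in 'Syl_3(AGL3 2)) :
  let K1 := grpK1 zeta in
  let K2 := grpK2 zeta in
  let H := grpH zeta in
  let K := grpK zeta in
  let adj := @cosetg_adj _ K1 K2 in
  let x1 := cosetg_x1 K1 K2 in
  let x2 := cosetg_x2 K1 K2 in
  let HD := cosetg_perm K1 K2 H in
  let KD := cosetg_perm K1 K2 K in
  [/\ adj x1 x2,
      [/\ H \subset K,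
          [faithful K, on [set: cosetg_vertex K1 K2] | cosetg_action K1 K2]
        & KD :=: graph_aut adj],
      forall G : {group {perm cosetg_vertex K1 K2}}, G = HD \/ G = KD ->
        [/\ [/\ G \subset graph_aut adj, locally_arc_transitive adj G 5
              & local_characteristic adj G 3],
            #|nbrs adj x1| = 4 /\ #|nbrs adj x2| = 3,
            pushing_up_type adj G 3 x1 x2
          & arc_transitive_from adj G 6 x2],
      shape_D2 (vstab HD x1) (vstab HD x2) (vstab HD x1 :&: vstab HD x2)%G S0
      /\ shape_E2 (vstab KD x1) (vstab KD x2) (vstab KD x1 :&: vstab KD x2)%G S0
    & [/\ H \isog PSU3 F ><| <[sbar F ^+ 3]>,
          K \isog PSU3 F ><| <[sbar F]>,
          (forall M : 'M[F]_3, (\det M = 1)%R -> isometry_mx M ->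
             bar (mx_perm M) ^ sbar F = bar (mx_perm (map_mx (@rho F) M)))
        & #[conj_aut (PSU3 F) (sbar F)] = 6]].
Proof.
have mP := model_pgl hF hzeta; have rH := r_HH hF hzeta.
have eH : grpH zeta = HH (pgl zeta) by rewrite /grpH grpH1E // grpH2E.
have eK : grpK zeta = KK (pgl zeta) by rewrite /grpK grpK1E // grpK2E.
rewrite (grpK1E hF hzeta) (grpK2E hF hzeta) eH eK; cbv zeta; rewrite x1E x2E.
split.
- exact: adj_base.
- split; first by rewrite -AA_false; exact: AA_sub.
    exact: faithful_act.
  exact: aut_KK.
(* H and K are the members k = false and k = true of the family [AA]. *)
- move=> G hG; have [k ->] : exists k, G = cosetg_perm _ _ (AA (pgl zeta) k).
    by case: hG => ->; [exists false; rewrite AA_false | exists true; rewrite AA_true].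
  split; first (split; [exact: aut_AA | exact: locally_5arc | exact: local_char]).
  + by rewrite !card_nbrs_base.
  + exact: pushing_up.
  + exact: arc6_x2.
- by split; [exact: shape_D2_HH | exact: shape_E2_KK].
- split; [exact: (isog_H hF hzeta) | exact: (isog_K hF hzeta) | |].
    by move=> M; exact: (conj_s hF hzeta).
  exact: (order_conj_s hF hzeta).
Qed.
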